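(* Under the model and assumptions listed in the context, the sequence $(\boldsymbol a_k)_{k\ge1}$ generated by the DOSP-S algorithm satisfies $\boldsymbol a_k\to\boldsymbol a^*$ as $k\to\infty$ almost surely.
   Context: Model. There are $N$ nodes, $\mathcal N=\{1,\dots,N\}$, and time-slots $k=1,2,\dots$. The indicator $\delta_{i,k}\in\{0,1\}$ tells whether node $i$ is active at slot $k$; the $\delta_{i,k}$ are i.i.d. with $\mathbb P(\delta_{i,k}=1)=q_a\in(0,1]$, and $\lambda=Nq_a<\infty$. The number of active nodes is binomial with mean $\lambda$ (if $N\to\infty$, $q_a$ is small so that $\lambda<\infty$ and the number is Poisson with parameter $\lambda$). Put $\boldsymbol\delta_k=(\delta_{1,k},\dots,\delta_{N,k})^T$ and $\mathcal N^{(k)}=\{i:\delta_{i,k}=1\}$. Actions take values in $\mathcal A_i=[a_{i,\min},a_{i,\max}]$; $\mathcal A=\mathcal A_1\times\cdots\times\mathcal A_N$. The environment states $\mathbf S_k\in\mathcal S$ are i.i.d. random matrices. The symbol $\circ$ is the element-wise product and $\|\cdot\|$ the Euclidean norm. Utilities. Each node has a real local utility function $u_i(\boldsymbol a,\boldsymbol\delta,\mathbf S)$ of the action vector $\boldsymbol a$, the activity vector $\boldsymbol\delta\in\{0,1\}^N$ and the environment state $\mathbf S\in\mathcal S$, with $u_i=0$ if $\delta_i=0$. Put $f=\sum_{i:\delta_i=1}u_i$, $G(\boldsymbol a,\boldsymbol\delta)=\mathbb E_{\mathbf S}f(\boldsymbol a,\boldsymbol\delta,\mathbf S)$, $F(\boldsymbol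 a)=\mathbb E_{\boldsymbol\delta,\mathbf S}f(\boldsymbol a,\boldsymbol\delta,\mathbf S)$. Observations. At slot $k$, if $\widehat{\boldsymbol a}$ is the performed action vector, active node $i$ observes $\widetilde u_{i,k}=u_i(\widehat{\boldsymbol a},\boldsymbol\delta_k,\mathbf S_k)+\eta_{i,k}$, where the noises $\eta_{i,k}$ are independent with mean $0$ and variance $\sigma_\eta^2<\infty$. Active node $i$ receives $\widetilde u_{j,k}$ for $j$ in a random set $\mathcal I^{(i,k)}\subseteq\mathcal N^{(k)}\setminus\{i\}$; each $j\in\mathcal N^{(k)}\setminus\{i\}$ belongs to it with constant probability $q_r\in(0,1]$ (the joint probability that $j$ is a neighbor of $i$ and that the transmission succeeds), independently over $j$. Node $i$ computes $\widetilde f_{i,k}=\widetilde u_{i,k}+q_r^{-1}\sum_{j\in\mathcal I^{(i,k)}}\widetilde u_{j,k}$. Regularity. (a) $G(\boldsymbol a,\boldsymbol\delta)$ and $F(\boldsymbol a)$ are first and second order differentiable functions of $\boldsymbol a\in\mathcal A$; the optimal point $\boldsymbol a^*\in\mathcal A$ (maximizer of $F$ over $\mathcal A$) exists, with $\partial F(\boldsymbol a^* )/\partial a_i=0$, $\partial^2F(\boldsymbol a^* )/\partial a_i^2<0$ and $a_i^*\in(a_{i,\min},a_{i,\max})$ for all $i$; and $F$ is strictly concave: $(\boldsymbol a-\boldsymbol a')^T(\nabla F(\boldsymbol a)-\nabla F(\boldsymbol a'))<0$ for all $\boldsymbol a\ne\boldsymbol a'$ in $\mathcal A$. (b) There is $\alpha_G\in(0,\infty)$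 with $|\partial^2G(\boldsymbol a,\boldsymbol\delta)/\partial a_i\partial a_j|\le\alpha_G$ for all active $i,j$ ($\delta_i=\delta_j=1$). (c) For any $\boldsymbol\delta,\mathbf S$, $|u_i(\boldsymbol a,\boldsymbol\delta,\mathbf S)-u_i(\boldsymbol a',\boldsymbol\delta,\mathbf S)|\le L_{\mathbf S}\|(\boldsymbol a-\boldsymbol a')\circ\boldsymbol\delta\|$ with $L_{\mathbf S}<\infty$ and $L=\sqrt{\mathbb E(L_{\mathbf S}^2)}<\infty$. Parameters. $\beta_\ell=\beta_0\ell^{-c_1}$, $\gamma_\ell=\gamma_0\ell^{-c_2}$ for $\ell\ge1$, with $\beta_0,\gamma_0>0$, $c_1\in(0.5,1)$, $c_2\in(0,1-c_1]$ (so $\sum\beta_\ell\gamma_\ell=\infty$, $\sum\beta_\ell^2<\infty$). The perturbations $\Phi_{i,k}$ are i.i.d., mean zero, with $\mathbb E(\Phi_{i,k}^2)=\sigma_\Phi^2$, $\sigma_\Phi>0$, and $|\Phi_{i,k}|\le\alpha_\Phi$, $\alpha_\Phi>0$. There is $K_0<\infty$ with $\alpha_\Phi\gamma_\ell\le\min_{i}\min\{|a_{i,\max}-a_i^*|,|a_{i,\min}-a_i^*|\}$ for all $\ell\ge K_0$. Random step-sizes. $\widetilde\ell_{i,k}\sim\mathrm{Binomial}(k-1,q_a)$, generated independently by each node; $\ell_{i,k}=\widetilde\ell_{i,k}+\delta_{i,k}$, $\widetilde\beta_{i,k}=\delta_{i,k}\beta_{\ell_{i,k}}$, $\widetilde\gamma_{i,k}=\delta_{i,k}\gamma_{\ell_{i,k}}$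 (both $0$ if $\delta_{i,k}=0$). The variables $\widetilde\ell$, $\Phi$, $\eta$, $\mathbf S$, $\delta$ and the receptions are mutually independent, and independent across time-slots. DOSP-S algorithm. $a_{i,1}$ is chosen randomly in $[a_{i,\min}+\alpha_\Phi\widetilde\gamma_{i,1},a_{i,\max}-\alpha_\Phi\widetilde\gamma_{i,1}]$. At slot $k$ the performed action is $\boldsymbol a_k+\widetilde{\boldsymbol\gamma}_k\circ\boldsymbol\Phi_k$, $\widetilde f_{i,k}$ is computed from the resulting observations, and for every $i$ $$\widetilde a_{i,k+1}=a_{i,k}+\widetilde\beta_{i,k}\Phi_{i,k}\widetilde f_{i,k},\qquad a_{i,k+1}=\min\{\max\{\widetilde a_{i,k+1},\,a_{i,\min}+\alpha_\Phi\widetilde\gamma_{i,k+1}\},\,a_{i,\max}-\alpha_\Phi\widetilde\gamma_{i,k+1}\}.$$ The projection is applied to ensure that the performed actions belong to $\mathcal A$.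
   Formalization: The formal theorem additionally assumes that every local utility has a finite second moment over the environment state at each action in the box; without this the claim fails, e.g. one always-active node with utility −a²+S and S centred with heavy tails. *)

(* Defs.v *)
From HB Require Import structures.
From mathcomp Require Import all_boot all_order all_algebra.
From mathcomp Require Import all_classical all_reals all_analysis.

Set Implicit Arguments.
Unset Strict Implicit.
Unset Printing Implicit Defensive.

Import Order.TTheory GRing.Theory Num.Theory.
Import numFieldNormedType.Exports.

Local Open Scope classical_set_scope.
Local Open Scope ring_scope.

(* Time: the index t : nat denotes the time-slot k = t + 1, so that every
   sequence over the slots k >= 1 is a plain sequence over nat. *)

Section independence.
Context {d} {T : measurableType d} {R : realType} (P : probability T R).

Definition events d' (E : measurableType d') (X : T -> E) : set_system T :=
  preimage_set_system setT X measurable.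

(* The product rule over every finite subfamily, a finite subfamily being an
   injective enumeration of its indices. *)
Definition mutually_independent (J : Type) (G : J -> set_system T) : Prop :=
  forall (n : nat) (j : 'I_n -> J) (B : 'I_n -> set T),
    injective j -> (forall m, G (j m) (B m)) ->
    P (\bigcap_(m in [set: 'I_n]) B m) = (\prod_(m < n) P (B m))%E.

Definition independent_sigma (G H : set_system T) : Prop :=
  forall A B, <<s G >> A -> <<s H >> B -> P (A `&` B) = (P A * P B)%E.

Definition identically_distributed d' (E : measurableType d') (X Y : T -> E) :=
  forall B, measurable B -> P (X @^-1` B) = P (Y @^-1` B).

End independence.

Section geometry.
Context {R : realType} {N : nat}.
Implicit Types (a b lo hi : 'rV[R]_N) (A : set 'rV[R]_N).

Definition box lo hi : set 'rV[R]_N :=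
  [set a | forall i, lo 0 i <= a 0 i <= hi 0 i].

Definition euclid a : R := Num.sqrt (\sum_i a 0 i ^+ 2).

Definition masked a (dl : {ffun 'I_N -> bool}) : 'rV[R]_N :=
  \row_i (a 0 i * (dl i)%:R).

Definition dot a b : R := \sum_i a 0 i * b 0 i.

(* f is differentiable on A with gradient g.  The limit is taken within A, so
   that only the values of f on A matter, boundary points included.  On a box
   with nonempty interior such a g is unique on A. *)
Definition gradient_on A (f : 'rV[R]_N -> R) (g : 'rV[R]_N -> 'rV[R]_N) :=
  forall a, A a ->
    (f b - f a - dot (g a) (b - a)) / euclid (b - a)
      @[b --> within A a^'] --> (0 : R).

(* First and second order differentiability on A, with gradient g and
   Hessian h. *)
Definition twice_differentiable_on A (f : 'rV[R]_N -> R)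
    (g : 'rV[R]_N -> 'rV[R]_N) (h : 'rV[R]_N -> 'M[R]_N) :=
  gradient_on A f g /\
  forall i, gradient_on A (fun a => g a 0 i) (fun a => row i (h a)).

End geometry.

Record params (R : realType) := Params {
  qa : R;
  qr : R;
  sigma_eta : R;
  sigma_Phi : R;
  alpha_Phi : R;
  beta0 : R;
  c1 : R;
  gamma0 : R;
  c2 : R }.

Section params.
Context {R : realType} (p : params R).

Definition beta (l : nat) : R := beta0 p * l%:R `^ (- c1 p).
Definition gamma (l : nat) : R := gamma0 p * l%:R `^ (- c2 p).

Record params_ok : Prop := ParamsOk {
  qa_range : 0 < qa p <= 1;
  qr_range : 0 < qr p <= 1;
  sigma_Phi_gt0 : 0 < sigma_Phi p;
  alpha_Phi_gt0 : 0 < alpha_Phi p;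
  beta0_gt0 : 0 < beta0 p;
  gamma0_gt0 : 0 < gamma0 p;
  c1_range : 2^-1 < c1 p < 1;
  c2_range : 0 < c2 p <= 1 - c1 p }.

End params.

(* The random inputs: [active i t] is delta_{i,k}, [counter i t] is
   tilde l_{i,k}, [pert i t] is Phi_{i,k}, [noise i t] is eta_{i,k}, [env t] is S_k
   and [recv i j t] tells whether j is a neighbor of i and the transmission
   from j to i succeeds (whatever the activity of j; [recv i i t] is not
   used).  The environment states live in an arbitrary measurable space. *)
Record inputs {d} {T : measurableType d} {R : realType} (P : probability T R)
    {dS} (St : measurableType dS) (N : nat) := Inputs {
  active : 'I_N -> nat -> {RV P >-> bool};
  counter : 'I_N -> nat -> {RV P >-> nat};
  pert : 'I_N -> nat -> {RV P >-> R};
  noise : 'I_N -> nat -> {RV P >-> R};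
  env : nat -> {RV P >-> St};
  recv : 'I_N -> 'I_N -> nat -> {RV P >-> bool} }.

Inductive source (N : nat) :=
| SrcActive of 'I_N & nat
| SrcCount of 'I_N & nat
| SrcPert of 'I_N & nat
| SrcNoise of 'I_N & nat
| SrcEnv of nat
| SrcRecv of nat.
Arguments SrcEnv {N} _.
Arguments SrcRecv {N} _.

Section inputs.
Context {d} {T : measurableType d} {R : realType} {P : probability T R}.
Context {dS} {St : measurableType dS} {N : nat}.
Variables (W : inputs P St N) (p : params R).

(* All the receptions of one slot form a single source: they need not be
   independent across receivers. *)
Definition source_events (s : source N) : set_system T :=
  match s with
  | SrcActive i t => events (active W i t)
  | SrcCount i t => events (counter W i t)
  | SrcPert i t => events (pert W i t)
  | SrcNoise i t => events (noise W i t)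
  | SrcEnv t => events (env W t)
  | SrcRecv t =>
      <<s \bigcup_(ij in [set: 'I_N * 'I_N]) events (recv W ij.1 ij.2 t) >>
  end.

Record inputs_law : Prop := InputsLaw {
  sources_independent : mutually_independent P source_events;
  active_law : forall i t, P (active W i t @^-1` [set true]) = (qa p)%:E;
  count_law : forall i t B,
    P (counter W i t @^-1` B) = binomial_prob t (qa p) B;
  pert_law : forall i t j u,
    identically_distributed P (pert W i t) (pert W j u);
  pert_mean : forall i t, 'E_P[pert W i t]%E = 0%E;
  pert_var : forall i t,
    'E_P[fun w => (pert W i t w ^+ 2)%R]%E = (sigma_Phi p ^+ 2)%:E;
  pert_bound : forall i t w, `|pert W i t w| <= alpha_Phi p;
  noise_mean : forall i t, 'E_P[noise W i t]%E = 0%E;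
  noise_var : forall i t,
    'E_P[fun w => (noise W i t w ^+ 2)%R]%E = (sigma_eta p ^+ 2)%:E;
  env_law : forall t u, identically_distributed P (env W t) (env W u);
  recv_law : forall i j t, j != i ->
    P (recv W i j t @^-1` [set true]) = (qr p)%:E;
  recv_independent : forall i t,
    mutually_independent P (fun j => events (recv W i j t)) }.

Definition activity (t : nat) (w : T) : {ffun 'I_N -> bool} :=
  [ffun i => active W i t w].

Definition step (i : 'I_N) (t : nat) (w : T) : nat :=
  (counter W i t w + active W i t w)%N.

Definition tbeta (i : 'I_N) (t : nat) (w : T) : R :=
  if active W i t w then beta p (step i t w) else 0.

Definition tgamma (i : 'I_N) (t : nat) (w : T) : R :=
  if active W i t w then gamma p (step i t w) else 0.

Section utilities.
Variable u : 'I_N -> 'rV[R]_N -> {ffun 'I_N -> bool} -> St -> R.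

Definition sum_utility (a : 'rV[R]_N) (dl : {ffun 'I_N -> bool}) (s : St) : R :=
  \sum_(i | dl i) u i a dl s.

(* The laws of S_k and delta_k do not depend on k; the first slot is used. *)
Definition G (dl : {ffun 'I_N -> bool}) (a : 'rV[R]_N) : R :=
  fine 'E_P[fun w => sum_utility a dl (env W 0%N w)]%E.

Definition F (a : 'rV[R]_N) : R :=
  fine 'E_P[fun w => sum_utility a (activity 0%N w) (env W 0%N w)]%E.

(* [utility_moment] is what makes G and F (and the variance of the
   observations) finite: the Lipschitz condition alone only controls
   differences of utilities. *)
Record utilities_ok (lo hi : 'rV[R]_N) : Prop := UtilitiesOk {
  utility_inactive : forall i a (dl : {ffun 'I_N -> bool}) s,
    dl i = false -> u i a dl s = 0;
  utility_measurable : forall i a dl, box lo hi a ->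
    measurable_fun setT (u i a dl);
  utility_moment : forall i a dl, box lo hi a ->
    (\int[P]_w ((u i a dl (env W 0%N w)) ^+ 2)%:E < +oo)%E;
  utility_lipschitz : exists Lip : St -> R,
    [/\ measurable_fun setT Lip,
        (\int[P]_w ((Lip (env W 0%N w)) ^+ 2)%:E < +oo)%E &
        forall i a b dl s, box lo hi a -> box lo hi b ->
          `|u i a dl s - u i b dl s| <= Lip s * euclid (masked (a - b) dl)] }.

Record regularity (lo hi astar : 'rV[R]_N)
    (dF : 'rV[R]_N -> 'rV[R]_N) (d2F : 'rV[R]_N -> 'M[R]_N)
    (dG : {ffun 'I_N -> bool} -> 'rV[R]_N -> 'rV[R]_N)
    (d2G : {ffun 'I_N -> bool} -> 'rV[R]_N -> 'M[R]_N) : Prop := Regularity {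
  F_smooth : twice_differentiable_on (box lo hi) F dF d2F;
  G_smooth : forall dl,
    twice_differentiable_on (box lo hi) (G dl) (dG dl) (d2G dl);
  astar_max : forall a, box lo hi a -> F a <= F astar;
  astar_interior : forall i, lo 0 i < astar 0 i < hi 0 i;
  astar_critical : forall i, dF astar 0 i = 0;
  astar_curvature : forall i, d2F astar i i < 0;
  F_strictly_concave : forall a b, box lo hi a -> box lo hi b -> a != b ->
    dot (a - b) (dF a - dF b) < 0;
  G_hessian_bounded : exists2 alphaG : R, 0 < alphaG &
    forall a (dl : {ffun 'I_N -> bool}) i j, box lo hi a -> dl i -> dl j ->
      `|d2G dl a i j| <= alphaG;
  perturbation_small : exists K0 : nat, forall l i, (0 < l)%N -> (K0 <= l)%N ->
    alpha_Phi p * gamma p l <=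
      Num.min `|hi 0 i - astar 0 i| `|lo 0 i - astar 0 i| }.

Section algorithm.
Variables (lo hi : 'rV[R]_N) (a : nat -> T -> 'rV[R]_N).

Definition performed (t : nat) (w : T) : 'rV[R]_N :=
  \row_i (a t w 0 i + tgamma i t w * pert W i t w).

Definition tu (i : 'I_N) (t : nat) (w : T) : R :=
  u i (performed t w) (activity t w) (env W t w) + noise W i t w.

Definition received (i : 'I_N) (t : nat) (w : T) : {set 'I_N} :=
  [set j | [&& active W j t w, j != i & recv W i j t w]]%SET.

Definition tf (i : 'I_N) (t : nat) (w : T) : R :=
  tu i t w + (qr p)^-1 * \sum_(j in received i t w) tu j t w.

(* The initial action may depend on the first activities (through the interval
   it is drawn from) and on private randomness, but on nothing else: the pair
   formed by the initial action and the first activities is independent of all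
   the other inputs. *)
Record dosp_s : Prop := DospS {
  init_measurable : forall i, measurable_fun setT (fun w => a 0%N w 0 i);
  init_range : forall i w,
    lo 0 i + alpha_Phi p * tgamma i 0%N w <= a 0%N w 0 i
      <= hi 0 i - alpha_Phi p * tgamma i 0%N w;
  init_independent : independent_sigma P
    (\bigcup_(i in [set: 'I_N])
       (events (fun w => a 0%N w 0 i) `|` source_events (SrcActive i 0)))
    (\bigcup_(s in [set s | forall i, s <> SrcActive i 0]) source_events s);
  projected_update : forall i t w,
    a t.+1 w 0 i =
      Num.min
        (Num.max (a t w 0 i + tbeta i t w * pert W i t w * tf i t w)
                 (lo 0 i + alpha_Phi p * tgamma i t.+1 w))
        (hi 0 i - alpha_Phi p * tgamma i t.+1 w) }.

End algorithm.
End utilities.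
End inputs.

(* Main.v *)
Require Import Defs.
From HB Require Import structures.
From mathcomp Require Import all_boot all_order all_algebra.
From mathcomp Require Import all_classical all_reals all_analysis.
From mathcomp Require Import measurable_realfun zify ring lra.

Set Implicit Arguments.
Unset Strict Implicit.
Unset Printing Implicit Defensive.

Import Order.TTheory GRing.Theory Num.Theory.
Import numFieldNormedType.Exports.

Local Open Scope classical_set_scope.
Local Open Scope ring_scope.

(** The proof follows the targets: [target t] is the updated action of slot t clipped
    to the box, before the projection that depends on the activity and the counter of
    slot t + 1.  It is known at the end of slot t, and the next action differs from it
    by at most the size of a perturbation ([action_target_close]).

    As clipping to an interval that contains the optimum does not increase distances,
    the squared distance of the target to the optimum grows in slot t + 1 by at most
    twice the scalar product of the update with the offset a - a* of the action, plus
    the square of the update.  The scalar product splits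
    ([gain_tf], [update_decomposition]) into
    - terms that have mean 0 given the past: the observation noise, the missing
      receptions (compensated by 1 / qr), the deviation of the utilities from their
      mean G over the environments (the performed action is independent of the
      environment of its slot, [freezing_mean0]), and the value of G without the
      perturbation of node i, times this perturbation;
    - the effect of the perturbation of node i on G, which by the mean value theorem
      is this perturbation times the partial derivative of G at the target, up to an
      error which is small compared to the product of both step sizes
      ([perturbation_error]).  Here the step sizes gamma tend to 0 almost surely,
      because the squares of the step sizes beta are summable;
    - the drift that is left: replacing the random coefficients of the partial
      derivatives by their means adds another centered term.  With the means, the sum
      over the nodes is
      sigma_Phi ^+ 2 * rho t times the derivative of F at the target in the direction
      away from the optimum ([drift_direction]), where rho t is the mean of the product
      of the step sizes of an active node in slot t.

    A counter visits each value for 1 / qa slots on average, so the second moments of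
    the step sizes beta have a sum of at most the sum of beta_l ^+ 2 over qa, which is
    finite as c1 > 1 / 2.  Kolmogorov's maximal inequality then makes the series of all
    centered terms converge almost surely ([martingale_cvg], [centered_cvg]).  The
    series of rho diverges since c1 + c2 <= 1 ([dvg_series_rho]).  Strict concavity
    bounds the drift away from 0 outside any neighborhood of the optimum
    ([descent_coercive]).

    On the event where the random series converge the remaining argument is
    deterministic ([perturbed_descent_cvg0]): a quantity that decreases by rho * psi up
    to small multiples of rho and to the terms of a convergent series tends to 0.

    Conditional expectations never appear.  A random variable is known from some of
    the inputs when it is measurable with respect to the sigma-algebra they generate,
    fresh inputs are those not yet used, and their independence
    ([known_fresh_independent]) gives the product rule for expectations. *)

(** * Independent sigma-algebras *)

Section subalgebra.
Context {d} {T : measurableType d} {R : realType} (P : probability T R).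
Implicit Types G H : set_system T.

(** Measurability with respect to the sigma-algebra generated by [G], through the
    type that carries this sigma-algebra, so that the closure properties of
    measurable functions apply as they stand.  A record, so that it does not unfold. *)
Record adapted G d' (E : measurableType d') (f : T -> E) : Prop := Adapted {
  adapted_fun : @measurable_fun _ _ (g_sigma_algebraType G) E setT f }.

Lemma adapted_preimage G d' (E : measurableType d') (f : T -> E) B :
  adapted G f -> measurable B -> <<s G >> (f @^-1` B).
Proof. by case=> mf mB; have := mf measurableT B mB; rewrite setTI. Qed.

Lemma adapted_sub G H d' (E : measurableType d') (f : T -> E) :
  G `<=` <<s H >> -> adapted G f -> adapted H f.
Proof.
move=> GH af; split=> _ B mB; rewrite setTI.
have := adapted_preimage af mB; rewrite /measurable /=.
apply: smallest_sub => //; exact: smallest_sigma_algebra.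
Qed.

Lemma adapted_measurable G d' (E : measurableType d') (f : T -> E) :
  G `<=` measurable -> adapted G f -> measurable_fun setT f.
Proof.
move=> Gm af _ B mB; rewrite setTI; have := adapted_preimage af mB.
apply: smallest_sub => //; exact: sigma_algebra_measurable.
Qed.

Lemma events_adapted d' (E : measurableType d') (f : T -> E) G :
  events f `<=` <<s G >> -> adapted G f.
Proof. by move=> fG; split=> _ B mB; apply: fG; exists B. Qed.

Lemma adapted_cst G d' (E : measurableType d') (c : E) : adapted G (fun=> c).
Proof. by split; exact: measurable_cst. Qed.

Lemma adaptedD G (f g : T -> R) : adapted G f -> adapted G g ->
  adapted G (fun w => f w + g w).
Proof. by move=> [mf] [mg]; split; exact: measurable_funD. Qed.

Lemma adaptedB G (f g : T -> R) : adapted G f -> adapted G g ->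
  adapted G (fun w => f w - g w).
Proof. by move=> [mf] [mg]; split; exact: measurable_funB. Qed.

Lemma adaptedM G (f g : T -> R) : adapted G f -> adapted G g ->
  adapted G (fun w => f w * g w).
Proof. by move=> [mf] [mg]; split; exact: measurable_funM. Qed.

Lemma adapted_sum G (I : Type) (r : seq I) (p : pred I) (f : I -> T -> R) :
  (forall i, adapted G (f i)) -> adapted G (fun w => \sum_(i <- r | p i) f i w).
Proof.
move=> af; under eq_fun do rewrite big_mkcond.
split; apply: measurable_sum => i; case: (p i); last exact: measurable_cst.
exact: adapted_fun (af i).
Qed.

Lemma adapted_if G d' (E : measurableType d') (b : T -> bool) (f g : T -> E) :
  adapted G b -> adapted G f -> adapted G g ->
  adapted G (fun w => if b w then f w else g w).
Proof. by move=> [mb] [mf] [mg]; split; exact: measurable_fun_ifT. Qed.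

Lemma adapted_comp G d1 (E1 : measurableType d1) d2 (E2 : measurableType d2)
    (h : E1 -> E2) (f : T -> E1) :
  measurable_fun setT h -> adapted G f -> adapted G (fun w => h (f w)).
Proof. by move=> mh [mf]; split; exact: measurableT_comp. Qed.

Lemma adapted_and G (a b : T -> bool) : adapted G a -> adapted G b ->
  adapted G (fun w => a w && b w).
Proof. by move=> [ma] [mb]; split; exact: measurable_and. Qed.

Lemma adapted_le G (f g : T -> R) : adapted G f -> adapted G g ->
  adapted G (fun w => f w <= g w).
Proof. by move=> [mf] [mg]; split; exact: measurable_fun_ler. Qed.

Lemma adapted_max G (f g : T -> R) : adapted G f -> adapted G g ->
  adapted G (fun w => Num.max (f w) (g w)).
Proof. by move=> [mf] [mg]; split; exact: measurable_maxr. Qed.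

Lemma adapted_min G (f g : T -> R) : adapted G f -> adapted G g ->
  adapted G (fun w => Num.min (f w) (g w)).
Proof. by move=> [mf] [mg]; split; exact: measurable_minr. Qed.

Lemma adapted_natr G (b : T -> bool) : adapted G b ->
  adapted G (fun w => (b w)%:R : R).
Proof.
move=> ab; have -> : (fun w => (b w)%:R : R) = (fun w => if b w then 1 else 0).
  by apply/funext => w; case: (b w).
by apply: adapted_if => //; exact: adapted_cst.
Qed.

(** Two applications of the pi-lambda theorem, one for each side. *)
Lemma independent_sigma_pi G H :
  setI_closed G -> setI_closed H -> G `<=` measurable -> H `<=` measurable ->
  (forall A B, G A -> H B -> P (A `&` B) = (P A * P B)%E) ->
  independent_sigma P G H.
Proof.
move=> IG IH mG mH GH.
have half (G1 : set_system T) (B : set T) : setI_closed G1 -> G1 `<=` measurable ->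
    measurable B -> (forall A, G1 A -> P (A `&` B) = (P A * P B)%E) ->
    forall A, <<s G1 >> A -> P (A `&` B) = (P A * P B)%E.
  move=> IG1 mG1 mB G1B A sA.
  suff : <<s G1 >> `<=` [set A | measurable A /\ P (A `&` B) = (P A * P B)%E].
    by move=> /(_ _ sA)[].
  apply: lambda_system_subset => //.
  - apply/dynkin_lambda_system; split.
    + by split => //; rewrite setTI probability_setT mul1e.
    + move=> C [mC PC]; split; first exact: measurableC.
      have -> : ~` C `&` B = B `\` C by rewrite setDE setIC.
      rewrite measureD//; last by rewrite -ge0_fin_numE ?fin_num_measure.
      rewrite probability_setC// [B `&` C]setIC.
      have -> : (P B - P (C `&` B) = P B - P C * P B)%E by congr (_ - _)%E.
      by rewrite muleBl ?mul1e// ?fin_num_measure// fin_num_adde_defr.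
    + move=> F tF PF; split; first by apply: bigcup_measurable => k _; exact: (PF k).1.
      rewrite setI_bigcupl measure_bigcup//; last 2 first.
      * by move=> k _; apply: measurableI => //; exact: (PF k).1.
      * by apply: trivIset_setIr.
      rewrite measure_bigcup//; last by move=> k _; exact: (PF k).1.
      have PBE : P B = (fine (P B))%:E by rewrite fineK ?fin_num_measure.
      rewrite muleC PBE -nneseriesZl//.
      by apply: eq_eseriesr => k _; rewrite [LHS](PF k).2 PBE muleC.
  - by move=> C GC; split; [exact: mG1|exact: G1B].
move=> A B sA sB.
have mB : measurable B.
  by move: B sB; apply: smallest_sub => //; exact: sigma_algebra_measurable.
apply: (half G) => // A' GA'; have mA' := mG _ GA'.
rewrite setIC muleC; apply: (half H) => // B' HB'.
by rewrite setIC muleC GH.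
Qed.

Definition integrableR (X : T -> R) := P.-integrable setT (EFin \o X).

Lemma integrableR_fin (X : T -> R) : integrableR X ->
  (\int[P]_w (X w)%:E)%E = (\int[P]_w X w)%:E.
Proof. by move=> iX; rewrite /Rintegral fineK//; exact: integrable_fin_num. Qed.

Lemma integrableR_measurable (X : T -> R) : integrableR X -> measurable_fun setT X.
Proof. by move/measurable_int/measurable_EFinP. Qed.

Lemma integrableR_le (X Y : T -> R) : measurable_fun setT X ->
  (forall w, `|X w| <= `|Y w|) -> integrableR Y -> integrableR X.
Proof.
move=> mX XY iY; apply: (@le_integrable _ _ _ P _ _ _ (EFin \o Y)) => //.
- exact/measurable_EFinP.
- by move=> w _; rewrite /= lee_fin.
Qed.

Lemma integrableR_cst c : integrableR (fun=> c).
Proof.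
apply/integrableP; split; first exact/measurable_EFinP/measurable_cst.
rewrite integral_cst//= probability_setT mule1; exact: ltry.
Qed.

Lemma integrableRD (X Y : T -> R) : integrableR X -> integrableR Y ->
  integrableR (fun w => X w + Y w).
Proof. by move=> iX iY; have := integrableD measurableT iX iY. Qed.

Lemma integrableRB (X Y : T -> R) : integrableR X -> integrableR Y ->
  integrableR (fun w => X w - Y w).
Proof. by move=> iX iY; have := integrableB measurableT iX iY. Qed.

Lemma integrableRZ c (X : T -> R) : integrableR X -> integrableR (fun w => c * X w).
Proof. by move=> iX; have := integrableZl measurableT c iX. Qed.

Lemma integrableR_norm (X : T -> R) : integrableR X -> integrableR (fun w => `|X w|).
Proof.
move=> iX; apply: (integrableR_le _ _ iX) => [|w]; last by rewrite normr_id.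
by apply: measurableT_comp => //; exact: integrableR_measurable.
Qed.

Lemma integrableR_bounded (X : T -> R) c : measurable_fun setT X ->
  (forall w, `|X w| <= c) -> integrableR X.
Proof.
move=> mX Xc; apply: (integrableR_le mX _ (integrableR_cst c)) => w.
exact: le_trans (Xc w) (ler_norm c).
Qed.

Lemma integrableR_sum (I : Type) (r : seq I) (p : pred I) (X : I -> T -> R) :
  (forall i, p i -> integrableR (X i)) ->
  integrableR (fun w => \sum_(i <- r | p i) X i w).
Proof.
move=> iX; have := integrable_sum measurableT r iX.
by congr (P.-integrable _ _); apply/funext => w /=; rewrite sumEFin.
Qed.

Lemma expectationRD (X Y : T -> R) : integrableR X -> integrableR Y ->
  \int[P]_w (X w + Y w) = \int[P]_w X w + \int[P]_w Y w.
Proof. by move=> iX iY; exact: RintegralD. Qed.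

Lemma expectationRB (X Y : T -> R) : integrableR X -> integrableR Y ->
  \int[P]_w (X w - Y w) = \int[P]_w X w - \int[P]_w Y w.
Proof. by move=> iX iY; exact: RintegralB. Qed.

Lemma expectationRZ c (X : T -> R) : integrableR X ->
  \int[P]_w (c * X w) = c * \int[P]_w X w.
Proof. by move=> iX; exact: RintegralZl. Qed.

Lemma expectationR_cst c : \int[P]_w (c : R) = c.
Proof.
rewrite Rintegral_cst//.
have -> : fine (P setT) = 1 by rewrite probability_setT.
by rewrite mulr1.
Qed.

Lemma expectationR_sum (I : Type) (r : seq I) (p : pred I) (X : I -> T -> R) :
  (forall i, p i -> integrableR (X i)) ->
  \int[P]_w (\sum_(i <- r | p i) X i w) = \sum_(i <- r | p i) \int[P]_w X i w.
Proof.
move=> iX; elim: r => [|i r IH].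
  under eq_Rintegral do rewrite big_nil.
  by rewrite big_nil expectationR_cst.
under eq_Rintegral do rewrite big_cons.
rewrite big_cons; case: ifPn => // pi.
by rewrite expectationRD ?IH//; [exact: iX|exact: integrableR_sum].
Qed.

Lemma expectationR_le (X Y : T -> R) : integrableR X -> integrableR Y ->
  (forall w, X w <= Y w) -> \int[P]_w X w <= \int[P]_w Y w.
Proof. by move=> iX iY XY; apply: le_Rintegral. Qed.

(** The two measures agree on rectangles. *)
Lemma independent_law G H d1 (T1 : measurableType d1) d2 (T2 : measurableType d2)
    (X : {mfun T >-> T1}) (Y : {mfun T >-> T2}) (XY : {mfun T >-> (T1 * T2)%type}) :
  (forall w, XY w = (X w, Y w)) ->
  independent_sigma P G H -> adapted G X -> adapted H Y ->
  forall C, measurable C ->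
  (distribution P X \x distribution P Y)%E C = distribution P XY C.
Proof.
move=> XYE ind aX aY C.
apply: product_measure_unique => A B mA mB.
rewrite -[LHS]/(P (XY @^-1` (A `*` B))).
have -> : XY @^-1` (A `*` B) = (X @^-1` A) `&` (Y @^-1` B).
  by apply/seteqP; split => w /=; rewrite XYE.
rewrite [LHS]ind//.
- exact: adapted_preimage aX mA.
- exact: adapted_preimage aY mB.
Qed.

(** Fubini's theorem for the joint law of the two factors. *)
Lemma independent_mul_expectation G H (X Y : T -> R) :
  G `<=` measurable -> H `<=` measurable ->
  independent_sigma P G H -> adapted G X -> adapted H Y ->
  integrableR X -> integrableR Y ->
  integrableR (fun w => X w * Y w) /\
  \int[P]_w (X w * Y w) = (\int[P]_w X w) * \int[P]_w Y w.
Proof.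
move=> mG mH ind aX aY iX iY.
have mX := adapted_measurable mG aX; have mY := adapted_measurable mH aY.
pose X' : {mfun T >-> R} := HB.pack X (isMeasurableFun.Build _ _ _ _ _ mX).
pose Y' : {mfun T >-> R} := HB.pack Y (isMeasurableFun.Build _ _ _ _ _ mY).
have mXY : measurable_fun setT (fun w => (X w, Y w)) by exact/measurable_fun_pair.
pose XY' : {mfun T >-> (R * R)%type} := HB.pack (fun w => (X w, Y w))
  (isMeasurableFun.Build _ _ _ _ _ mXY).
pose m1 := distribution P X'; pose m2 := distribution P Y'.
have mid : measurable_fun setT (EFin : R -> \bar R) by exact/measurable_EFinP.
have m12E := @independent_law G H _ R _ R X' Y' XY' (fun=> erefl) ind aX aY.
pose h (z : R * R) : \bar R := (z.1 * z.2)%:E.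
have mh : measurable_fun setT h.
  by apply/measurable_EFinP; apply: measurable_funM; [exact: measurable_fst|exact: measurable_snd].
have iX1 : m1.-integrable setT (EFin \o id) by apply: integrable_pushforward.
have iY1 : m2.-integrable setT (EFin \o id) by apply: integrable_pushforward.
have ih : (m1 \x m2)%E.-integrable setT h.
  apply/integrable12ltyP => //.
  under eq_integral => x _.
    under eq_integral => y _ do rewrite /h /= normrM EFinM.
    rewrite ge0_integralZl//; last first.
      by apply/measurable_EFinP; exact: normr_measurable.
    over.
  have ig0 : (0 <= \int[m2]_y `|y|%:E)%E by exact: integral_ge0.
  rewrite ge0_integralZr//; last first.
    by apply/measurable_EFinP; exact: normr_measurable.
  apply: lte_mul_pinfty => //.
  - exact: integral_ge0.
  - rewrite ge0_fin_numE ?integral_ge0//.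
    by case/integrableP : iX1.
  - by case/integrableP : iY1.
have iXY : integrableR (fun w => X w * Y w).
  apply/integrableP; split.
    by apply/measurable_EFinP; exact: measurable_funM.
  case/integrableP : ih => _.
  rewrite (eq_measure_integral (distribution P XY')); last by move=> C mC _; exact: m12E.
  by rewrite ge0_integral_distribution//; exact: measurableT_comp.
split => //; rewrite /Rintegral.
transitivity (fine (\int[m1 \x m2]_z h z)%E).
  congr fine; rewrite (eq_measure_integral (distribution P XY')); last first.
    by move=> C mC _; exact: m12E.
  by rewrite integral_distribution.
have HY : (\int[m2]_y y%:E)%E = (\int[P]_w Y w)%:E.
  by rewrite -integrableR_fin// integral_distribution.
have HF x : (\int[m2]_y h (x, y))%E = ((\int[P]_w Y w)%:E * x%:E)%E.
  by under eq_integral => y _ do rewrite /h /= EFinM; rewrite integralZl// HY muleC.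
rewrite -(integral12_prod_meas1 ih) (eq_integral _ _ (fun x _ => HF x)).
rewrite integralZl//.
rewrite integral_distribution//.
by rewrite (integrableR_fin iX) -EFinM mulrC.
Qed.

End subalgebra.

(** * Convergence of sums of martingale differences *)

Section martingale.
Context {d} {T : measurableType d} {R : realType} (P : probability T R).
Implicit Types (F : nat -> set_system T) (m : nat -> T -> R) (v : nat -> R).

(** A square-integrable sequence of martingale differences for the filtration
    generated by [F].  Conditional expectations are avoided: vanishing given
    the past means orthogonality to the bounded functions of the past. *)
Record martingale_differences F m v : Prop := MartingaleDifferences {
  md_measurable : forall n, F n `<=` measurable;
  md_filtration : forall n, F n `<=` <<s F n.+1 >>;
  md_adapted : forall n, adapted (F n.+1) (m n);
  md_square_integrable : forall n, integrableR P (fun w => m n w ^+ 2);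
  md_square_le : forall n, \int[P]_w (m n w ^+ 2) <= v n;
  md_orthogonal : forall n (Z : T -> R) c, adapted (F n) Z ->
    (forall w, `|Z w| <= c) -> \int[P]_w (m n w * Z w) = 0 }.

Arguments md_measurable {F m v} _ _ [_] _.
Arguments md_filtration {F m v} _ _ [_] _.

Lemma martingale_differences_shift F m v k : martingale_differences F m v ->
  martingale_differences (fun n => F (k + n)%N) (fun n => m (k + n)%N)
    (fun n => v (k + n)%N).
Proof.
case=> mF Fm am im vm om; split => n; rewrite ?addnS //.
exact: om.
Qed.

Definition exceeds m (c : R) n : set T :=
  [set w | exists2 j, (j <= n)%N & c < `|\sum_(i < j) m i w|].

Section maximal.
Variables (F : nat -> set_system T) (m : nat -> T -> R) (v : nat -> R).
Hypothesis mdm : martingale_differences F m v.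
Variable c : R.
Hypothesis c_ge0 : 0 <= c.

Let S n w := \sum_(j < n) m j w.

(* [alive n] says that the partial sums have stayed within c up to time n, and
   [stopped n] is the sum stopped when they first leave. *)
Let alive n w := [forall j : 'I_n.+1, `|S j w| <= c].

Fixpoint stopped n w : R :=
  if n is n'.+1 then stopped n' w + (alive n' w)%:R * m n' w else 0.

Let aliveS n w : alive n.+1 w = alive n w && (`|S n.+1 w| <= c).
Proof.
apply/forallP/andP => [h|[/forallP h1 h2] j].
  split; last exact: (h ord_max).
  by apply/forallP => j; have := h (widen_ord (leqnSn _) j).
by have [jn|] := ltnP j n.+1;
  [exact: (h1 (Ordinal jn))|move=> nj; have -> : (j : nat) = n.+1 by
     apply/eqP; rewrite eqn_leq nj -ltnS ltn_ord].
Qed.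

Let alive0 w : alive 0 w.
Proof. by apply/forallP => j; rewrite ord1 /S big_ord0 normr0. Qed.

Let stoppedE n w : if alive n w then stopped n w = S n w else c < `|stopped n w|.
Proof.
elim: n => [|n]; first by rewrite alive0 /= /S big_ord0.
rewrite aliveS /=; case: (alive n w) => /= [->|h]; last by rewrite mul0r addr0.
have -> : S n w + true%:R * m n w = S n.+1 w by rewrite /S big_ord_recr/= mul1r.
by case: leP.
Qed.

Let F_mono n k : (n <= k)%N -> F n `<=` <<s F k >>.
Proof.
elim: k => [|k IH]; first by rewrite leqn0 => /eqP->; exact: sub_gen_smallest.
rewrite leq_eqVlt => /predU1P[->|]; first exact: sub_gen_smallest.
rewrite ltnS => /IH h A /h; apply: smallest_sub; first exact: smallest_sigma_algebra.
exact: md_filtration mdm k.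
Qed.

Let S_adapted n : adapted (F n) (S n).
Proof.
apply: adapted_sum => j; apply: (adapted_sub _ (md_adapted mdm j)).
exact: F_mono.
Qed.

Let alive_adapted n : adapted (F n) (alive n).
Proof.
elim: n => [|n IH].
  have -> : alive 0 = cst true by apply/funext => w; rewrite alive0.
  exact: adapted_cst.
have -> : alive n.+1 = (fun w => alive n w && (`|S n.+1 w| <= c)).
  by apply/funext => w; rewrite aliveS.
apply: adapted_and; first exact: (adapted_sub (F_mono (leqnSn n)) IH).
apply: adapted_le; last exact: adapted_cst.
by apply: adapted_comp => //; exact: S_adapted.
Qed.

Let alive_adaptedR n : adapted (F n) (fun w => (alive n w)%:R : R).
Proof. exact: adapted_natr. Qed.

Let stopped_alive n w : (alive n w)%:R * stopped n w = (alive n w)%:R * S n w.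
Proof. by have := stoppedE n w; case: alive => [->//|_]; rewrite !mul0r. Qed.

Let stopped_alive_le n w : `|(alive n w)%:R * stopped n w| <= c.
Proof.
rewrite stopped_alive; case: (boolP (alive n w)) => [|_]; last by rewrite mul0r normr0.
by move/forallP/(_ ord_max); rewrite mul1r.
Qed.

Let stopped_alive_adapted n : adapted (F n) (fun w => (alive n w)%:R * stopped n w).
Proof.
under eq_fun do rewrite stopped_alive.
by apply: adaptedM; [exact: alive_adaptedR|exact: S_adapted].
Qed.

Let m_measurable n : measurable_fun setT (m n).
Proof. exact: adapted_measurable (md_measurable mdm n.+1) (md_adapted mdm n). Qed.

Let stopped_measurable n : measurable_fun setT (stopped n).
Proof.
elim: n => [|n IH]; first exact: measurable_cst.
apply: measurable_funD => //; apply: measurable_funM => //.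
exact: adapted_measurable (md_measurable mdm n) (alive_adaptedR n).
Qed.

Let stopped_sqr n : integrableR P (fun w => stopped n w ^+ 2) /\
  \int[P]_w (stopped n w ^+ 2) <= \sum_(j < n) v j.
Proof.
elim: n => [|n [IH1 IH2]].
  rewrite big_ord0; split.
    by under eq_fun do rewrite /= expr0n/=; exact: integrableR_cst.
  by under eq_Rintegral do rewrite /= expr0n/=; rewrite expectationR_cst.
pose Z w := 2 * ((alive n w)%:R * stopped n w).
have E w : stopped n.+1 w ^+ 2 =
    (stopped n w ^+ 2 + m n w * Z w) + (alive n w)%:R * m n w ^+ 2.
  rewrite /= /Z; case: alive => /=; rewrite ?(mul1r, mul0r, mulr0, addr0)//.
  by rewrite sqrrD -mulr_natl; ring.
have aZ : adapted (F n) Z.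
  by apply: adaptedM; [exact: adapted_cst|exact: stopped_alive_adapted].
have bZ w : `|Z w| <= 2 * c.
  by rewrite normrM ger0_norm// ler_wpM2l// stopped_alive_le.
have im2 : integrableR P (fun w => (alive n w)%:R * m n w ^+ 2).
  apply: integrableR_le (md_square_integrable mdm n).
    apply: measurable_funM; last by apply: measurable_funX.
    exact: adapted_measurable (md_measurable mdm n) (alive_adaptedR n).
  by move=> w; case: alive; rewrite ?mul1r// mul0r normr0.
have imZ : integrableR P (fun w => m n w * Z w).
  apply: (@integrableR_le _ _ _ _ _ (fun w => 2 * c * (1 + m n w ^+ 2))).
  - apply: measurable_funM => //.
    exact: adapted_measurable (md_measurable mdm n) aZ.
  - move=> w; rewrite normrM mulrC [leRHS]ger0_norm; last first.
      by rewrite mulr_ge0 ?mulr_ge0// addr_ge0// sqr_ge0.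
    apply: ler_pM => //; rewrite -[m n w ^+ 2]real_normK ?num_real//.
    by have := sqr_ge0 (`|m n w| - 1); have := normr_ge0 (m n w); nra.
  - apply/integrableRZ/integrableRD; first exact: integrableR_cst.
    exact: md_square_integrable mdm n.
have iS : integrableR P (fun w => stopped n w ^+ 2 + m n w * Z w).
  exact: integrableRD.
rewrite (funext E); split; first exact: integrableRD.
rewrite expectationRD// expectationRD// (md_orthogonal mdm aZ bZ) addr0.
rewrite big_ord_recr/= lerD// (le_trans _ (md_square_le mdm n))//.
apply: expectationR_le => // [|w]; first exact: md_square_integrable mdm n.
by case: alive; rewrite ?mul1r// mul0r sqr_ge0.
Qed.

(** Kolmogorov's maximal inequality.  The differences of the stopped sum are
    still orthogonal, and the stopped sum exceeds c exactly when some partial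
    sum does, so that Chebyshev's inequality applies to it. *)
Lemma maximal_inequality n : measurable (exceeds m c n) /\
  ((c ^+ 2)%:E * P (exceeds m c n) <= (\sum_(j < n) v j)%:E)%E.
Proof.
set B := exceeds m c n.
have BE : B = [set w | ~~ alive n w].
  apply/seteqP; split => w /=.
    by move=> [j jn cj]; apply/forallPn; exists (Ordinal (jn : j < n.+1)%N); rewrite -ltNge.
  by move/forallPn => [j]; rewrite -ltNge => cj; exists j => //; rewrite -ltnS.
have mB : measurable B.
  have mal := adapted_measurable (md_measurable mdm n) (alive_adapted n).
  have mfalse : measurable [set false] by [].
  have := mal measurableT [set false] mfalse; rewrite setTI BE.
  by congr (measurable _); apply/seteqP; split => w /=; [move->|move/negbTE].
split => //; have [iQ EQ] := stopped_sqr n.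
apply: le_trans (_ : (\int[P]_w (stopped n w ^+ 2)%:E <= _)%E); last first.
  by rewrite (integrableR_fin iQ) lee_fin.
rewrite -(setIT B) -integral_indic// -ge0_integralZl//; last 2 first.
- by apply/measurable_EFinP; exact: measurable_indic.
- by rewrite lee_fin sqr_ge0.
apply: ge0_le_integral => //.
- by move=> w _; rewrite mule_ge0// lee_fin ?sqr_ge0// indicE.
- by apply: emeasurable_funM => //; apply/measurable_EFinP/measurable_indic.
- by apply/measurable_EFinP/measurable_funX.
move=> w _; rewrite indicE; have [|wB] := boolP (w \in B); last first.
  by rewrite mule0 lee_fin sqr_ge0.
rewrite inE BE /= => nw; rewrite mule1 lee_fin.
have := stoppedE n w; rewrite (negbTE nw) => cw.
by rewrite -[leRHS]real_normK ?num_real// lerXn2r// ?nnegrE// ltW.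
Qed.

End maximal.

(** The probability that the partial sums oscillate by more than e after time n
    is at most the tail of the variances over e ^+ 2. *)
Lemma martingale_cvg F m v : martingale_differences F m v ->
  cvgn (series v) -> {ae P, forall w, cvgn (series (m ^~ w))}.
Proof.
move=> mdm cv.
have v_ge0 n : 0 <= v n.
  apply: le_trans (md_square_le mdm n); apply: Rintegral_ge0 => w _; exact: sqr_ge0.
(* A sum that oscillates by more than e after every n does so with probability 0; the
   tail from n on is again a sequence of martingale differences. *)
pose osc (e : R) n := \bigcup_k exceeds (fun j => m (n + j)%N) e k.
have osc_null (e : R) : 0 < e -> P.-negligible (\bigcap_n osc e n).
  move=> e0.
  have mex n k := (maximal_inequality (martingale_differences_shift n mdm) (ltW e0) k).1.
  have mosc n : measurable (osc e n) by apply: bigcupT_measurable => k; exact: mex.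
  exists (\bigcap_n osc e n); split => //; first exact: bigcapT_measurable.
  apply/eqP; rewrite eq_le measure_ge0 andbT; apply/lee_addgt0Pr => eta eta0.
  rewrite add0e.
  have eta2 : 0 < e ^+ 2 * eta by rewrite mulr_gt0// exprn_gt0.
  have /cauchy_cvgP/cauchy_seriesP/(_ _ eta2) [[A B] [[n1 _ An] [n2 _ Bn]] AB] := cv.
  pose n := maxn n1 n2.
  apply: (@le_trans _ _ (P (osc e n))).
    by rewrite le_measure ?inE//; [exact: bigcapT_measurable|exact: bigcap_inf].
  have ndex : nondecreasing_seq (exceeds (fun j => m (n + j)%N) e).
    move=> a b ab; apply/subsetPset => w [j ja cj]; exists j => //.
    exact: leq_trans ja ab.
  have Pcvg := @nondecreasing_cvg_mu _ _ _ P _ (mex n) (mosc n) ndex.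
  rewrite /osc -(cvg_lim _ Pcvg)//; apply: lime_le; first by apply/cvg_ex; eexists; exact: Pcvg.
  apply: nearW => k /=.
  have [_ ] := maximal_inequality (martingale_differences_shift n mdm) (ltW e0) k.
  rewrite -lee_pdivlMl ?exprn_gt0// => /le_trans; apply.
  rewrite -EFinM lee_fin ler_pdivrMl ?exprn_gt0// ltW//.
  have := AB (n, (n + k)%N) (conj (An n _) (Bn _ _)) => /=.
  rewrite leq_maxl (leq_trans (leq_maxr n1 n2) (leq_addr _ _)) => /(_ isT isT).
  rewrite ger0_norm; last by apply: sumr_ge0.
  rewrite -{1}[n]add0n big_addn addKn big_mkord.
  by under eq_bigr do rewrite addnC.
have : P.-negligible (\bigcup_k \bigcap_n osc (k.+1%:R^-1) n).
  by apply: negligible_bigcup => k; apply: osc_null; rewrite invr_gt0.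
apply: negligibleS => w /= ncv; apply: contrapT => nosc; apply: ncv.
apply/cauchy_cvgP/cauchy_seriesP => e e0.
pose k := Num.truncn (2 / e).
have ke : 2 * k.+1%:R^-1 < e.
  by rewrite ltr_pdivrMr// mulrC -ltr_pdivrMr// truncnS_gt.
have [n nn] : exists n, ~ osc (k.+1%:R^-1) n w.
  apply: contrapT => h; apply: nosc; exists k => // n _.
  by apply: contrapT => hn; apply: h; exists n.
have Sn j : `|\sum_(i < j) m (n + i)%N w| <= k.+1%:R^-1.
  rewrite leNgt; apply/negP => h; apply: nn; exists j => //; by exists j.
exists ([set j | (n <= j)%N], [set j | (n <= j)%N]) => /=; first by split; exists n.
move=> [a b] [/= na nb]; rewrite (le_lt_trans _ ke)//.
have [ba|ab] := leqP b a.
  by rewrite big_geq// normr0 mulr_ge0// invr_ge0.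
have E j : (n <= j)%N -> \sum_(n <= i < j) m i w = \sum_(i < j - n) m (n + i)%N w.
  move=> nj; rewrite -{1}[n]add0n big_addn big_mkord.
  by under eq_bigr do rewrite addnC.
have -> : \sum_(a <= i < b) m i w =
    \sum_(i < b - n) m (n + i)%N w - \sum_(i < a - n) m (n + i)%N w.
  by rewrite -!E// (@big_cat_nat _ _ _ a n b)//= ?(ltnW ab)// addrAC subrr add0r.
by rewrite (le_trans (ler_normB _ _))// mulr_natl mulr2n lerD.
Qed.

End martingale.

(** * Perturbed descent *)

Section descent.
Context {R : realType}.
Implicit Types (D rho psi s : nat -> R).

(** Above any level the decrease rho * psi wins against the error e * rho, and
    the remaining perturbation telescopes into a convergent sequence s.  As rho
    is not summable, D gets below the level once; after that D - s cannot climb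
    back, since it only increases when D is below the level. *)
Lemma perturbed_descent_cvg0 D rho psi M :
  (forall k, 0 <= D k) -> (forall k, 0 <= rho k <= M) ->
  ~ cvgn (series rho) -> (forall k, 0 <= psi k) ->
  (forall e, 0 < e -> exists2 kappa, 0 < kappa &
    forall k, e <= D k -> kappa <= psi k) ->
  (forall e, 0 < e -> exists s K, cvgn s /\ forall k, (K <= k)%N ->
    D k.+1 <= D k - rho k * psi k + e * rho k + (s k.+1 - s k)) ->
  D @ \oo --> 0.
Proof.
move=> D0 rhoM rho_dvg psi0 coercive dec.
have M0 : 0 <= M by have /andP[] := rhoM 0%N; exact: le_trans.
apply/cvgrPdist_le => /= e4 e40; pose e := e4 / 4; have e0 : 0 < e by rewrite divr_gt0.
have [kappa kappa0 psik] := coercive e e0.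
(* Half of the drift above level e survives, and one step below level e increases D
   by at most e on top of the variation of s. *)
pose e' := Num.min (kappa / 2) (e / (M + 1)).
have e'0 : 0 < e' by rewrite lt_min !divr_gt0// ltr_wpDl.
have e'M k : e' * rho k <= e.
  have /andP[r0 rM] := rhoM k.
  have : e' <= e / (M + 1) by rewrite ge_min lexx orbT.
  rewrite ler_pdivlMr ?ltr_wpDl// => h; apply: le_trans h.
  by rewrite ler_wpM2l ?(ltW e'0)// (le_trans rM)// lerDl.
have [s [K [/cvg_ex[/= l sl] decK]]] := dec e' e'0.
have /cvgrPdist_le/(_ e e0)[K2 _ sK2] := sl.
pose K' := maxn K K2.
have sl_le k : (K' <= k)%N -> `|l - s k| <= e.
  by move=> kk; apply: sK2 => /=; rewrite (leq_trans (leq_maxr _ _) kk).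
have step k : (K' <= k)%N -> e <= D k ->
    D k.+1 - s k.+1 <= D k - s k - kappa / 2 * rho k.
  move=> kk eD; have := decK k (leq_trans (leq_maxl _ _) kk).
  have /andP[r0 rM] := rhoM k; have := psik k eD => kp.
  have : rho k * kappa <= rho k * psi k by rewrite ler_wpM2l.
  have : e' * rho k <= kappa / 2 * rho k by rewrite ler_wpM2r// ge_min lexx.
  lra.
have [k0 k0K Dk0] : exists2 k0, (K' <= k0)%N & D k0 < e.
  apply: contrapT => /forall2NP nk.
  have {}nk k : (K' <= k)%N -> e <= D k.
    by move=> kk; have [//|/negP] := nk k; rewrite -leNgt.
  apply: rho_dvg.
  have bnd n : \sum_(K' <= k < K' + n) rho k
      <= 2 / kappa * (D K' - s K' - (D (K' + n)%N - s (K' + n)%N)).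
    elim: n => [|n IH]; first by rewrite addn0 big_geq// subrr mulr0.
    rewrite addnS big_nat_recr ?leq_addr//=.
    have := step (K' + n)%N (leq_addr _ _) (nk _ (leq_addr _ _)).
    move: IH; set x := D K' - s K'; set y := D (K' + n)%N - s (K' + n)%N.
    set z := D (K' + n).+1 - s (K' + n).+1 => IH yz.
    have : rho (K' + n)%N <= 2 / kappa * (y - z).
      have -> : rho (K' + n)%N = 2 / kappa * (kappa / 2 * rho (K' + n)%N).
        by field; rewrite gt_eqF.
      by apply: ler_wpM2l; [rewrite divr_ge0// ltW|lra].
    move=> h; apply: le_trans (lerD IH h) _.
    by rewrite -mulrDr; apply: ler_wpM2l; [rewrite divr_ge0// ltW|lra].
  apply: nondecreasing_is_cvgn.
    apply/nondecreasing_seqP => n; rewrite seriesSr lerDl.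
    by have /andP[] := rhoM n.
  exists (series rho K' + 2 / kappa * (D K' - s K' + l + e)) => _ [n _ <-].
  have h (j : nat) : series rho (K' + j)%N <= series rho K' + 2 / kappa * (D K' - s K' + l + e).
    rewrite {1}/series/= (@big_cat_nat _ _ _ K')//= ?leq_addr// lerD//.
    apply: le_trans (bnd j) _; apply: ler_wpM2l; first by rewrite divr_ge0// ltW.
    have := sl_le _ (leq_addr j K'); rewrite ler_norml => /andP[h1 h2].
    have := D0 (K' + j)%N; lra.
  apply: le_trans (h n); rewrite /series/= (@big_cat_nat _ _ _ n 0 (K' + n))//= ?leq_addl//.
  by rewrite lerDl sumr_ge0// => i _; have /andP[] := rhoM i.
have inv j : D (k0 + j)%N - s (k0 + j)%N <= 3 * e - l.
  elim: j => [|j IH].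
    rewrite addn0; have := sl_le _ k0K; rewrite ler_norml => /andP[]; lra.
  rewrite addnS; have kj : (K' <= k0 + j)%N by rewrite (leq_trans k0K)// leq_addr.
  have [eD|De] := leP e (D (k0 + j)%N).
    apply: le_trans (step _ kj eD) _; have /andP[r0 _] := rhoM (k0 + j)%N.
    have : 0 <= kappa / 2 * rho (k0 + j)%N by rewrite mulr_ge0// divr_ge0// ltW.
    lra.
  have := decK _ (leq_trans (leq_maxl _ _) kj).
  have := sl_le _ kj; rewrite ler_norml => /andP[h1 h2].
  have := e'M (k0 + j)%N; have /andP[r0 _] := rhoM (k0 + j)%N.
  have : 0 <= rho (k0 + j)%N * psi (k0 + j)%N by rewrite mulr_ge0.
  lra.
exists k0 => // k /= kk; rewrite sub0r normrN ger0_norm//.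
have := inv (k - k0)%N; rewrite subnKC// => h.
have := sl_le k (leq_trans k0K kk); rewrite ler_norml => /andP[h1 h2].
have : e4 = 4 * e by rewrite /e; field.
lra.
Qed.

End descent.

(** * Differentiable functions on a box *)

Lemma natr_mul_sum (R : pzSemiRingType) n (x : R) : n%:R * x = \sum_(i < n) x.
Proof. by rewrite sumr_const card_ord mulr_natl. Qed.

Section box_calculus.
Context {R : realType} {N : nat}.
Implicit Types (a b v lo hi : 'rV[R]_N) (A : set 'rV[R]_N).

Definition close a b (e : R) := forall i, `|b 0 i - a 0 i| < e.

(** Relative to A and in coordinates: nothing is known off the box. *)
Definition cont_on A (f : 'rV[R]_N -> R) := forall a, A a ->
  forall e, 0 < e -> exists2 del, 0 < del &
    forall b, A b -> close a b del -> `|f b - f a| <= e.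

Lemma close_minl a b d1 d2 : close a b (Num.min d1 d2) -> close a b d1.
Proof. by move=> h i; apply: lt_le_trans (h i) _; rewrite ge_min lexx. Qed.

Lemma close_minr a b d1 d2 : close a b (Num.min d1 d2) -> close a b d2.
Proof. by move=> h i; apply: lt_le_trans (h i) _; rewrite ge_min lexx orbT. Qed.

Lemma nbhs_close a e : 0 < e -> \forall b \near a, close a b e.
Proof.
move=> e0; apply/nbhs_ballP; exists e => // b [_ h] i.
by have := h 0 i; rewrite /ball /= distrC.
Qed.

Lemma near_close a (Q : set 'rV[R]_N) : (\forall b \near a, Q b) ->
  exists2 del, 0 < del & forall b, close a b del -> Q b.
Proof.
move=> /nbhs_ballP[e e0 h]; exists e => // b ab; apply: h; split => // i j.
by rewrite ord1 /ball /= distrC.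
Qed.

Lemma box_compact lo hi : compact (box lo hi).
Proof.
have := @rV_compact R N (fun i => `[lo 0 i, hi 0 i]%classic)
  (fun i => @segment_compact R _ _).
by congr compact; apply/seteqP; split => v h i; have := h i; rewrite /= in_itv.
Qed.

(** Compactness of the box turns a property that holds near each of its points
    for small parameters into a uniform one. *)
Lemma box_uniform lo hi (Q : R -> 'rV[R]_N -> Prop) :
  (forall a, box lo hi a -> exists2 del, 0 < del &
     forall b, box lo hi b -> close a b del -> forall eta, 0 < eta < del -> Q eta b) ->
  exists2 eta, 0 < eta & forall a, box lo hi a -> Q eta a.
Proof.
move=> Qloc; have /compact_near_coveringP cov := @box_compact lo hi.
have := cov R (0 : R)^'+ (fun eta a => box lo hi a -> 0 < eta -> Q eta a).
case=> [a ba|].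
  have [del del0 h] := Qloc a ba.
  exists ([set b | close a b del], [set eta | eta < del]) => /=.
    by split; [exact: nbhs_close|exact: nbhs_right_lt].
  by move=> [b eta] /= [ab etad] bb eta0; apply: h => //; rewrite eta0.
move=> del /= del0 h.
exists (del / 2); first by rewrite divr_gt0.
move=> a ba; apply: h => //=; last by rewrite divr_gt0.
- rewrite sub0r normrN ger0_norm ?divr_ge0// ?ltW//.
  by rewrite ltr_pdivrMr// ltr_pMr// ltr1n.
- by rewrite divr_gt0.
Qed.

Lemma cont_on_uniform lo hi f : cont_on (box lo hi) f ->
  forall e, 0 < e -> exists2 del, 0 < del &
    forall a b, box lo hi a -> box lo hi b -> close a b del -> `|f b - f a| <= e.
Proof.
move=> cf e e0.
have [|del del0 h] := @box_uniform lo hi (fun del a =>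
    forall b, box lo hi b -> close a b del -> `|f b - f a| <= e).
  have e20 : 0 < e / 2 by rewrite divr_gt0.
  move=> a ba; have [del del0 h] := cf a ba (e / 2) e20.
  exists (del / 2); first by rewrite divr_gt0.
  move=> a' ba' aa' eta /andP[eta0 etad] b bb a'b.
  have h1 : `|f a' - f a| <= e / 2.
    apply: h => // i; apply: lt_le_trans (aa' i) _.
    by rewrite ler_pdivrMr// ler_peMr ?ltW// ltr1n.
  have h2 : `|f b - f a| <= e / 2.
    apply: h => // i; have := aa' i; have := a'b i.
    have := ler_normD (b 0 i - a' 0 i) (a' 0 i - a 0 i).
    rewrite addrA subrK; lra.
  have := ler_normB (f b - f a) (f a' - f a).
  have -> : f b - f a - (f a' - f a) = f b - f a' by ring.
  lra.
by exists del => // a b ba bb ab; exact: h.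
Qed.

Lemma cont_on_bounded lo hi f : cont_on (box lo hi) f ->
  exists c, forall a, box lo hi a -> `|f a| <= c.
Proof.
move=> cf.
have [|eta eta0 h] := @box_uniform lo hi (fun eta a => `|f a| <= eta^-1).
  move=> a ba; have [del del0 h] := cf a ba 1 ltr01.
  exists (Num.min del (`|f a| + 1)^-1).
    by rewrite lt_min del0 invr_gt0 ltr_wpDl.
  move=> b bb ab eta /andP[eta0]; rewrite lt_min => /andP[_ etaf].
  have fb : `|f b - f a| <= 1.
    by apply: h => // i; apply: lt_le_trans (ab i) _; rewrite ge_min lexx.
  have : `|f b| <= `|f a| + 1.
    by have := ler_normD (f b - f a) (f a); rewrite subrK; lra.
  have f1 : 0 < `|f a| + 1 by rewrite ltr_wpDl.
  by move=> /le_trans; apply; rewrite -[leLHS]invrK lef_pV2 ?posrE ?invr_gt0// ltW.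
by exists eta^-1.
Qed.

Definition sqdist a b : R := \sum_i (a 0 i - b 0 i) ^+ 2.

(** Near a0 the hypothesis on sqdist fails, and elsewhere f stays above a positive
    number locally. *)
Lemma cont_on_coercive lo hi f a0 : cont_on (box lo hi) f ->
  (forall a, box lo hi a -> a != a0 -> 0 < f a) ->
  forall e, 0 < e -> exists2 kappa, 0 < kappa &
    forall a, box lo hi a -> e <= sqdist a a0 -> kappa <= f a.
Proof.
move=> cf f_gt0 e e0.
have [|eta eta0 h] := @box_uniform lo hi (fun eta a => e <= sqdist a a0 -> eta <= f a).
  move=> a ba; have [aa0|aa0] := eqVneq a a0.
    have del0 : 0 < Num.min 1 (e / (N%:R + 1)) by rewrite lt_min ltr01 divr_gt0// ltr_wpDl.
    exists (Num.min 1 (e / (N%:R + 1))) => // b bb ab eta _ eb; exfalso.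
    have : sqdist b a0 <= N%:R * (e / (N%:R + 1)).
      rewrite natr_mul_sum; apply: ler_sum => i _; have := ab i; rewrite aa0 lt_min => /andP[h1 h2].
      rewrite -real_normK ?num_real// expr2.
      by apply: le_trans (ltW h2); rewrite ler_piMl// ltW.
    move=> /(le_trans eb); rewrite leNgt => /negP; apply.
    by rewrite mulrCA gtr_pMr// ltr_pdivrMr ?ltr_wpDl// mul1r ltrDl.
  have fa0 := f_gt0 a ba aa0; have fa2 : 0 < f a / 2 by rewrite divr_gt0.
  have [del del0 h] := cf a ba _ fa2.
  exists (Num.min del (f a / 2)); first by rewrite lt_min del0.
  move=> b bb ab eta /andP[eta0]; rewrite lt_min => /andP[_ etaf] _.
  have : `|f b - f a| <= f a / 2.
    by apply: h => // i; apply: lt_le_trans (ab i) _; rewrite ge_min lexx.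
  rewrite ler_norml => /andP[+ _]; lra.
by exists eta.
Qed.

Lemma cont_on_sum A (I : Type) (r : seq I) (f : I -> 'rV[R]_N -> R) :
  (forall i, cont_on A (f i)) -> cont_on A (fun a => \sum_(i <- r) f i a).
Proof.
move=> cf a Aa; elim: r => [|i r IH] e e0.
  by exists 1 => // b _ _; rewrite !big_nil subrr normr0 ltW.
have e20 : 0 < e / 2 by rewrite divr_gt0.
have [d1 d10 h1] := cf i a Aa _ e20; have [d2 d20 h2] := IH _ e20.
exists (Num.min d1 d2); first by rewrite lt_min d10.
move=> b Ab ab; rewrite !big_cons.
have k1 := h1 b Ab (close_minl ab); have k2 := h2 b Ab (close_minr ab).
have := ler_normD (f i b - f i a) (\sum_(j <- r) f j b - \sum_(j <- r) f j a).
rewrite addrACA -opprD; lra.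
Qed.

Lemma cont_on_mul A f g : cont_on A f -> cont_on A g ->
  cont_on A (fun a => f a * g a).
Proof.
move=> cf cg a Aa e e0.
pose c := `|f a| + `|g a| + 1.
have c0 : 0 < c by rewrite ltr_wpDl// addr_ge0.
have e'0 : 0 < Num.min 1 (e / (2 * c)) by rewrite lt_min ltr01 divr_gt0// mulr_gt0.
have [d1 d10 h1] := cf a Aa _ e'0; have [d2 d20 h2] := cg a Aa _ e'0.
exists (Num.min d1 d2); first by rewrite lt_min d10.
move=> b Ab ab.
have : `|f b - f a| <= Num.min 1 (e / (2 * c)).
  by apply: h1 => // j; apply: lt_le_trans (ab j) _; rewrite ge_min lexx.
rewrite le_min => /andP[f1 fe].
have : `|g b - g a| <= Num.min 1 (e / (2 * c)).
  by apply: h2 => // j; apply: lt_le_trans (ab j) _; rewrite ge_min lexx orbT.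
rewrite le_min => /andP[g1 ge].
have -> : f b * g b - f a * g a =
    (f b - f a) * (g b - g a) + (f a * (g b - g a) + (f b - f a) * g a) by ring.
have E : e = (e / (2 * c)) * c + (e / (2 * c)) * c.
  by field; rewrite gt_eqF.
apply: le_trans (ler_normD _ _) _; rewrite normrM.
apply: le_trans (lerD (lexx _) (ler_normD _ _)) _; rewrite !normrM.
have k1 : `|f b - f a| * `|g b - g a| <= (e / (2 * c)) * 1 by exact: ler_pM.
have k2 : `|f a| * `|g b - g a| <= `|f a| * (e / (2 * c)) by exact: ler_wpM2l.
have k3 : `|f b - f a| * `|g a| <= (e / (2 * c)) * `|g a| by exact: ler_wpM2r.
have k4 : 0 <= (e / (2 * c)) * c by rewrite mulr_ge0// ltW// divr_gt0// mulr_gt0.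
have cE : e / (2 * c) * c = `|f a| * (e / (2 * c)) + e / (2 * c) * `|g a| + e / (2 * c).
  by move: (e / (2 * c)) => t; rewrite /c; ring.
rewrite [leRHS]E; lra.
Qed.

Lemma cont_on_coord A v i : cont_on A (fun a => a 0 i - v 0 i).
Proof.
move=> a _ e e0; exists e => // b _ ab; rewrite opprB addrA subrK.
exact: ltW.
Qed.

Lemma locally_lipschitz_cont_on A f :
  (forall a, A a -> exists L del, 0 < del /\ forall b, A b -> close a b del ->
     `|f b - f a| <= L * \sum_i `|b 0 i - a 0 i|) -> cont_on A f.
Proof.
move=> fL a Aa e e0; have [L [del [del0 {}fL]]] := fL a Aa.
pose c := (`|L| + 1) * (N%:R + 1).
have L1 : 0 < `|L| + 1 by rewrite ltr_wpDl.
have N1 : 0 < N%:R + 1 :> R by rewrite ltr_wpDl.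
have c0 : 0 < c by rewrite mulr_gt0.
exists (Num.min del (e / c)); first by rewrite lt_min del0 divr_gt0.
move=> b Ab ab; apply: le_trans (fL b Ab (close_minl ab)) _.
have s0 : 0 <= \sum_i `|b 0 i - a 0 i| by rewrite sumr_ge0.
have s1 : \sum_i `|b 0 i - a 0 i| <= N%:R * (e / c).
  by rewrite natr_mul_sum; apply: ler_sum => i _; exact: ltW (close_minr ab i).
have -> : e = (`|L| + 1) * ((N%:R + 1) * (e / c)) by rewrite /c; field; rewrite !gt_eqF.
apply: (@le_trans _ _ ((`|L| + 1) * \sum_i `|b 0 i - a 0 i|)).
  by rewrite ler_wpM2r// (le_trans (ler_norm _))// lerDl.
rewrite ler_wpM2l ?(ltW L1)// (le_trans s1)// ler_wpM2r ?lerDl//.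
by rewrite divr_ge0 ?ltW.
Qed.

Lemma lipschitz_cont_on A f L :
  (forall a b, A a -> A b -> `|f b - f a| <= L * \sum_i `|b 0 i - a 0 i|) -> cont_on A f.
Proof.
move=> fL; apply: locally_lipschitz_cont_on => a Aa; exists L, 1; split => // b Ab _.
exact: fL.
Qed.

Lemma norm_le_sum v i : `|v 0 i| <= \sum_j `|v 0 j|.
Proof. by rewrite (bigD1 i)//= lerDl sumr_ge0. Qed.

Lemma euclid_le v : euclid v <= \sum_i `|v 0 i|.
Proof.
rewrite /euclid -(@ler_pXn2r _ 2)// ?nnegrE ?sqrtr_ge0 ?sumr_ge0//.
rewrite sqr_sqrtr ?sumr_ge0// => [|i _]; last exact: sqr_ge0.
rewrite expr2 mulr_suml; apply: ler_sum => i _.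
by rewrite -real_normK ?num_real// expr2 ler_wpM2l// norm_le_sum.
Qed.

Lemma euclid_ge0 v : 0 <= euclid v. Proof. exact: sqrtr_ge0. Qed.

Lemma euclid_gt0 v : v != 0 -> 0 < euclid v.
Proof.
move=> v0; rewrite /euclid sqrtr_gt0 lt_neqAle sumr_ge0 ?andbT => [|i _]; last exact: sqr_ge0.
apply: contraNneq v0 => s0; apply/eqP/rowP => i; rewrite mxE.
have /psumr_eq0P := esym s0 => /(_ (fun i _ => sqr_ge0 _))/(_ i isT)/eqP.
by rewrite sqrf_eq0 => /eqP.
Qed.

Lemma dot_le a v : `|dot a v| <= (\sum_i `|a 0 i|) * \sum_i `|v 0 i|.
Proof.
apply: le_trans (ler_norm_sum _ _ _) _; rewrite mulr_suml; apply: ler_sum => i _.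
by rewrite normrM ler_wpM2l// norm_le_sum.
Qed.

Lemma dotZ s a v : dot a (s *: v) = s * dot a v.
Proof. by rewrite /dot mulr_sumr; apply: eq_bigr => i _; rewrite mxE mulrCA. Qed.

(** Differentiability with the sum of the coordinate distances in place of the
    Euclidean norm, and without division. *)
Lemma gradient_onP A f g a e : gradient_on A f g -> A a -> 0 < e ->
  exists2 del, 0 < del & forall b, A b -> close a b del ->
    `|f b - f a - dot (g a) (b - a)| <= e * \sum_i `|b 0 i - a 0 i|.
Proof.
move=> gf Aa e0; have /cvgrPdist_le/(_ e e0) := gf a Aa.
rewrite near_withinE near_withinE => /near_close[del del0 h].
exists del => // b Ab ab; have [->|ba] := eqVneq b a.
  rewrite subrr /dot big1 => [|i _]; last by rewrite !mxE subrr mulr0.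
  by rewrite subrr normr0 mulr_ge0 ?sumr_ge0// ltW.
have := h b ab ba Ab; rewrite sub0r normrN normrM normfV.
have ba0 : b - a != 0 by rewrite subr_eq0.
rewrite ler_pdivrMr ?normr_gt0 ?gt_eqF ?euclid_gt0// => /le_trans; apply.
rewrite ger0_norm ?euclid_ge0// ler_wpM2l ?(ltW e0)//.
apply: le_trans (euclid_le _) _.
by apply: ler_sum => i _; rewrite !mxE.
Qed.

Lemma gradient_on_cont A f g : gradient_on A f g -> cont_on A f.
Proof.
move=> gf; apply: locally_lipschitz_cont_on => a Aa.
have [del del0 h] := gradient_onP gf Aa ltr01.
exists (1 + \sum_i `|g a 0 i|), del; split => // b Ab ab.
have db := dot_le (g a) (b - a).
have sE : \sum_i `|(b - a) 0 i| = \sum_i `|b 0 i - a 0 i|.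
  by apply: eq_bigr => i _; rewrite !mxE.
have := ler_normD (f b - f a - dot (g a) (b - a)) (dot (g a) (b - a)).
rewrite subrK => /le_trans; apply; apply: le_trans (lerD (h b Ab ab) db) _.
by rewrite sE -mulrDl.
Qed.

Lemma gradient_on_sum A (I : finType) (c : I -> R) f g :
  (forall x, gradient_on A (f x) (g x)) ->
  gradient_on A (fun v => \sum_x c x * f x v) (fun v => \sum_x c x *: g x v).
Proof.
move=> fg a Aa.
have -> : (fun b => (\sum_x c x * f x b - \sum_x c x * f x a -
      dot (\sum_x c x *: g x a) (b - a)) / euclid (b - a)) =
    (fun b => \sum_x c x * ((f x b - f x a - dot (g x a) (b - a)) / euclid (b - a))).
  apply/funext => b.
  have -> : dot (\sum_x c x *: g x a) (b - a) = \sum_x c x * dot (g x a) (b - a).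
    rewrite /dot; under [RHS]eq_bigr do rewrite mulr_sumr.
    rewrite exchange_big/=; apply: eq_bigr => i _; rewrite summxE mulr_suml.
    by apply: eq_bigr => x _; rewrite mxE mulrA.
  by rewrite -!sumrB mulr_suml; apply: eq_bigr => x _; ring.
elim: (index_enum I) => [|x r IH].
  by under eq_fun do rewrite big_nil; exact: cvg_cst.
under eq_fun do rewrite big_cons.
have FF : Filter (within A a^') by exact: within_filter.
have cx : (c x * ((f x b - f x a - dot (g x a) (b - a)) / euclid (b - a)))
    @[b --> within A a^'] --> c x * 0.
  by apply: cvgM; [exact: cvg_cst|exact: fg].
by have := cvgD cx IH; rewrite mulr0 addr0; exact.
Qed.

(** Only the values on the segment from a to b matter for the derivative in
    the direction b - a. *)
Lemma gradient_on_unique A f f' g g' a b :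
  gradient_on A f g -> gradient_on A f' g' ->
  (forall s, 0 <= s <= 1 -> A (a + s *: (b - a)) /\
     f (a + s *: (b - a)) = f' (a + s *: (b - a))) ->
  dot (g a) (b - a) = dot (g' a) (b - a).
Proof.
move=> gf gf' seg; apply/eqP; rewrite -subr_eq0 -normr_le0; apply/ler_addgt0Pr => e e0.
rewrite add0r.
have [Aa faa] : A a /\ f a = f' a.
  by have := seg 0; rewrite lexx ler01 scale0r addr0; apply.
pose c := \sum_i `|b 0 i - a 0 i| + 1.
have c0 : 0 < c by rewrite ltr_wpDl// sumr_ge0.
have ec0 : 0 < e / (2 * c) by rewrite divr_gt0// mulr_gt0.
have [d1 d10 h1] := gradient_onP gf Aa ec0.
have [d2 d20 h2] := gradient_onP gf' Aa ec0.
pose s := Num.min 1 (Num.min d1 d2 / (2 * c)).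
have s0 : 0 < s by rewrite lt_min ltr01 divr_gt0 ?lt_min ?d10// mulr_gt0.
have s1 : s <= 1 by rewrite ge_min lexx.
have [As fs] : A (a + s *: (b - a)) /\ f (a + s *: (b - a)) = f' (a + s *: (b - a)).
  by apply: seg; rewrite (ltW s0).
have sv i : (a + s *: (b - a)) 0 i - a 0 i = s * (b 0 i - a 0 i).
  by rewrite !mxE addrC addKr.
have scl : close a (a + s *: (b - a)) (Num.min d1 d2).
  move=> i; rewrite sv normrM gtr0_norm//.
  have h : `|b 0 i - a 0 i| <= c.
    rewrite /c; apply: ler_wpDr => //.
    by rewrite (bigD1 i)//= lerDl sumr_ge0.
  have : s <= Num.min d1 d2 / (2 * c) by rewrite ge_min lexx orbT.
  move=> /(ler_wpM2l (normr_ge0 (b 0 i - a 0 i))); rewrite mulrC => /le_lt_trans; apply.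
  rewrite mulrA ltr_pdivrMr ?mulr_gt0// mulrC ltr_pM2l ?lt_min ?d10//.
  lra.
have k1 := h1 _ As (close_minl scl); have k2 := h2 _ As (close_minr scl).
have E : \sum_i `|(a + s *: (b - a)) 0 i - a 0 i| = s * (c - 1).
  rewrite /c addrK mulr_sumr; apply: eq_bigr => i _.
  by rewrite sv normrM gtr0_norm.
have aE : a + s *: (b - a) - a = s *: (b - a) by rewrite addrC addKr.
move: k1 k2; rewrite E aE !dotZ fs faa => k1 k2.
set x := f' _ - f' a in k1 k2.
have := ler_normB (x - s * dot (g' a) (b - a)) (x - s * dot (g a) (b - a)).
have -> : x - s * dot (g' a) (b - a) - (x - s * dot (g a) (b - a)) =
   s * (dot (g a) (b - a) - dot (g' a) (b - a)) by ring.
rewrite normrM gtr0_norm// => k3.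
have k4 : s * `|dot (g a) (b - a) - dot (g' a) (b - a)| <= s * e.
  apply: le_trans k3 _; apply: le_trans (lerD k2 k1) _.
  have -> : e / (2 * c) * (s * (c - 1)) + e / (2 * c) * (s * (c - 1)) =
    s * (e * ((c - 1) / c)) by field; rewrite gt_eqF.
  rewrite ler_wpM2l ?(ltW s0)// ler_piMr ?(ltW e0)// ler_pdivrMr// mul1r.
  by rewrite lerBlDr lerDl.
by rewrite ler_pM2l in k4.
Qed.

Lemma box_segment lo hi a b s : box lo hi a -> box lo hi b -> 0 <= s <= 1 ->
  box lo hi (a + s *: (b - a)).
Proof.
move=> ba bb /andP[s0 s1] i; have /andP[a1 a2] := ba i; have /andP[b1 b2] := bb i.
by rewrite !mxE; apply/andP; split; nra.
Qed.

(** The one-variable mean value theorem on the segment from a to b. *)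
Lemma box_mean_value lo hi f g a b : gradient_on (box lo hi) f g ->
  box lo hi a -> box lo hi b ->
  exists c, [/\ box lo hi c, (forall i, `|c 0 i - a 0 i| <= `|b 0 i - a 0 i|) &
    f b - f a = dot (g c) (b - a)].
Proof.
move=> gf ba bb; pose h (s : R) := a + s *: (b - a).
have hB s : 0 <= s <= 1 -> box lo hi (h s) by exact: box_segment.
have hsub s s' : h s - h s' = (s - s') *: (b - a).
  by apply/rowP => i; rewrite !mxE; ring.
pose c := \sum_i `|b 0 i - a 0 i| + 1.
have c0 : 0 < c by rewrite ltr_wpDl// sumr_ge0.
have hclose s s' e : `|s' - s| < e / c -> close (h s) (h s') e.
  move=> ss i.
  have -> : h s' 0 i - h s 0 i = (s' - s) * (b 0 i - a 0 i) by rewrite !mxE; ring.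
  have k : `|b 0 i - a 0 i| <= c.
    by rewrite /c; apply: ler_wpDr => //; rewrite (bigD1 i)//= lerDl sumr_ge0.
  rewrite normrM; apply: le_lt_trans (ler_wpM2l (normr_ge0 _) k) _.
  by rewrite -ltr_pdivlMr.
have cf := gradient_on_cont gf.
have h0 : h 0 = a by rewrite /h scale0r addr0.
have h1 : h 1 = b by rewrite /h scale1r addrC subrK.
have [||s s01 E] := @MVT R (f \o h) (fun s => dot (g (h s)) (b - a)) 0 1 ltr01.
- move=> s; rewrite in_itv/= => /andP[s0 s1].
  have hs := hB s; rewrite !ltW// in hs; have {}hs := hs isT.
  suff D : (fun k : R => k^-1 *: ((f \o h) (k + s) - (f \o h) s)) @ 0^' -->
      dot (g (h s)) (b - a).
    have D' : (fun k : R => k^-1 *: ((f \o h \o shift s) (k *: 1) - (f \o h) s)) @ 0^' -->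
      dot (g (h s)) (b - a).
      have -> : (fun k : R => k^-1 *: ((f \o h \o shift s) (k *: 1) - (f \o h) s)) =
        (fun k : R => k^-1 *: ((f \o h) (k + s) - (f \o h) s)).
        by apply/funext => k /=; rewrite [k *: 1]mulr1.
      exact: D.
    apply: DeriveDef; first by apply/cvg_ex; eexists; exact: D'.
    exact/cvg_lim.
  apply/cvgrPdist_le => e e0; have ec0 : 0 < e / c by rewrite divr_gt0.
  have [del del0 hdel] := gradient_onP gf hs ec0.
  have dc0 : 0 < del / c by rewrite divr_gt0.
  rewrite near_withinE; near=> k => k0.
  have kd : `|k| < Num.min (del / c) (Num.min s (1 - s)).
    near: k; apply/nbhs_ballP; exists (Num.min (del / c) (Num.min s (1 - s))) => /=.
      by rewrite !lt_min dc0 s0 subr_gt0.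
    by move=> y; rewrite /ball/= sub0r normrN.
  move: kd; rewrite !lt_min => /and3P[kd ks ks1].
  have bk : box lo hi (h (k + s)).
    apply: hB; move: ks ks1; rewrite !ltr_norml => /andP[? ?] /andP[? ?].
    by apply/andP; split; lra.
  have := hdel _ bk (hclose _ _ _ _); rewrite addrK => /(_ kd).
  rewrite hsub addrK dotZ => hk.
  have Ek : \sum_i `|h (k + s) 0 i - h s 0 i| = `|k| * (c - 1).
    rewrite /c addrK mulr_sumr; apply: eq_bigr => i _; rewrite -normrM; congr `|_|.
    by rewrite !mxE; ring.
  rewrite Ek in hk.
  have -> : dot (g (h s)) (b - a) - k^-1 *: ((f \o h) (k + s) - (f \o h) s) =
     - (k^-1 * (f (h (k + s)) - f (h s) - k * dot (g (h s)) (b - a))).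
    by rewrite /= /GRing.scale/=; field.
  rewrite normrN normrM normfV ler_pdivrMl ?normr_gt0//; apply: le_trans hk _.
  rewrite mulrCA ler_wpM2l//.
  have -> : e / c * (c - 1) = e * ((c - 1) / c) by field; rewrite gt_eqF.
  rewrite ler_piMr ?(ltW e0)// ler_pdivrMr// mul1r.
  by rewrite lerBlDr lerDl.
- apply/continuous_within_itvP => //.
  have cfh s : 0 <= s <= 1 -> forall e, 0 < e -> exists2 del, 0 < del &
     forall s', 0 <= s' <= 1 -> `|s' - s| < del -> `|f (h s) - f (h s')| <= e.
    move=> s01 e e0; have [del del0 hd] := cf _ (hB s s01) e e0.
    exists (del / c); first by rewrite divr_gt0.
    by move=> s' s'01 ss; rewrite distrC; apply: hd; [exact: hB|exact: hclose].
  split.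
  + move=> s; rewrite in_itv/= => /andP[s0 s1]; apply/cvgrPdist_le => e e0.
    have [|del del0 hd] := cfh s _ e e0; first by rewrite !ltW.
    near=> s'; apply: hd.
      by apply/andP; split; apply: ltW; near: s'; [exact: lt_nbhsr|exact: lt_nbhsl].
    rewrite distrC; near: s'; apply/nbhs_ballP; by exists del.
  + apply/cvgrPdist_le => e e0; have [|del del0 hd] := cfh 0 _ e e0; first by rewrite lexx ler01.
    near=> s'; have s0 : 0 < s' by near: s'; exact: nbhs_right_gt.
    apply: hd; first by rewrite ltW//=; near: s'; exact: nbhs_right_le.
    by rewrite subr0 gtr0_norm//; near: s'; exact: nbhs_right_lt.
  + apply/cvgrPdist_le => e e0; have [|del del0 hd] := cfh 1 _ e e0; first by rewrite lexx ler01.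
    near=> s'; have s1 : s' < 1 by near: s'; exact: nbhs_left_lt.
    apply: hd; first by rewrite (ltW s1) andbT; near: s'; exact: nbhs_left_ge.
    rewrite distrC gtr0_norm ?subr_gt0// ltrBlDr -ltrBlDl; near: s'.
    by apply: nbhs_left_gt; rewrite ltrBlDr ltrDl.
exists (h s); move: s01; rewrite in_itv/= => /andP[s0 s1]; split.
- by apply: hB; rewrite !ltW.
- move=> i; have -> : h s 0 i - a 0 i = s * (b 0 i - a 0 i) by rewrite !mxE; ring.
  by rewrite normrM gtr0_norm// ler_piMl// ltW.
- by move: E; rewrite /= h0 h1 subr0 mulr1.
Unshelve. all: by end_near. Qed.

End box_calculus.

(** * Random points of a box *)

Section random_points.
Context {d} {T : measurableType d} {R : realType} (P : probability T R).
Context {N : nat}.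
Variables (lo hi : 'rV[R]_N).
Hypothesis lohi : forall i, lo 0 i < hi 0 i.
Local Notation B := (box lo hi).

(* The grid with mesh 1 / (n + 1) in each normalized coordinate. *)
Let norm_coord n (x : R) i := (x - lo 0 i) / (hi 0 i - lo 0 i) * n.+1%:R.

Definition grid_point n (k : {ffun 'I_N -> 'I_n.+2}) : 'rV[R]_N :=
  \row_i (lo 0 i + (hi 0 i - lo 0 i) * (k i)%:R / n.+1%:R).

Definition in_cell n (k : {ffun 'I_N -> 'I_n.+2}) (v : 'rV[R]_N) : bool :=
  [forall i, ((k i)%:R <= norm_coord n (v 0 i) i) &&
             (norm_coord n (v 0 i) i < (k i).+1%:R)].

Lemma grid_point_box n k : B (@grid_point n k).
Proof.
move=> i; rewrite !mxE; have h := lohi i.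
have k1 : 0 <= ((k i)%:R / n.+1%:R : R) <= 1.
  by rewrite divr_ge0//= ler_pdivrMr// mul1r ler_nat -ltnS.
rewrite -[_ * _ / _]mulrA; move: ((k i)%:R / _) k1 => t /andP[t0 t1].
by apply/andP; split; nra.
Qed.

Lemma in_cell_unique n v : B v ->
  exists k, forall k', @in_cell n k' v = (k' == k).
Proof.
move=> Bv; have h i : 0 <= norm_coord n (v 0 i) i <= n.+1%:R.
  have /andP[v1 v2] := Bv i; rewrite /norm_coord; have l := lohi i.
  rewrite mulr_ge0//=; last by rewrite divr_ge0// subr_ge0// ltW.
  by rewrite ler_piMl// ler_pdivrMr ?subr_gt0// mul1r lerD2r.
pose k : {ffun 'I_N -> 'I_n.+2} := [ffun i => inord (Num.truncn (norm_coord n (v 0 i) i))].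
have kE i : k i = Num.truncn (norm_coord n (v 0 i) i) :> nat.
  have /andP[h1 h2] := h i; rewrite ffunE inordK// ltnS.
  by rewrite -[leqRHS](@natrK R); apply: le_truncn.
exists k => k'.
apply/forallP/eqP => [h'|-> i]; last by rewrite kE; apply: truncn_itv; have /andP[] := h i.
apply/ffunP => i; apply/val_inj => /=; rewrite kE.
by apply/esym/truncn_def; exact: h'.
Qed.

Lemma in_cell_close n k v i : @in_cell n k v ->
  `|v 0 i - grid_point k 0 i| <= (hi 0 i - lo 0 i) / n.+1%:R.
Proof.
move=> /forallP/(_ i)/andP[h1 h2]; have l := lohi i; rewrite mxE.
have l0 : 0 < hi 0 i - lo 0 i by rewrite subr_gt0.
have -> : v 0 i - (lo 0 i + (hi 0 i - lo 0 i) * (k i)%:R / n.+1%:R) =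
    (hi 0 i - lo 0 i) / n.+1%:R * (norm_coord n (v 0 i) i - (k i)%:R).
  by rewrite /norm_coord; field; rewrite ?gt_eqF// nmulrn.
have q0 : 0 <= (hi 0 i - lo 0 i) / n.+1%:R by rewrite divr_ge0// ltW.
rewrite normrM (ger0_norm q0) ler_piMr// ger0_norm ?subr_ge0// ltW// ltrBlDr.
by rewrite -natr1 addrC in h2.
Qed.

(** The value of f at the grid point of the cell of b w. *)
Definition discretize n (f : 'rV[R]_N -> T -> R) (b : T -> 'rV[R]_N) (w : T) : R :=
  \sum_(k : {ffun 'I_N -> 'I_n.+2}) (in_cell k (b w))%:R * f (grid_point k) w.

Lemma discretizeE n f b w : B (b w) ->
  exists k : {ffun 'I_N -> 'I_n.+2}, in_cell k (b w) /\
    discretize n f b w = f (grid_point k) w.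
Proof.
move=> Bb; have [k kP] := in_cell_unique n Bb.
have kb : in_cell k (b w) by rewrite kP.
exists k; split => //; rewrite /discretize (bigD1 k)//= kb mul1r big1 ?addr0// => k' k'k.
by rewrite kP (negbTE k'k) mul0r.
Qed.

Variable G : set_system T.

Lemma adapted_in_cell n k (b : T -> 'rV[R]_N) : (forall i, adapted G (fun w => b w 0 i)) ->
  adapted G (fun w => @in_cell n k (b w)).
Proof.
move=> ab.
suff h (r : seq 'I_N) : adapted G (fun w => all (fun i =>
    ((k i)%:R <= norm_coord n (b w 0 i) i) && (norm_coord n (b w 0 i) i < (k i).+1%:R)) r).
  have := h (enum 'I_N); congr adapted; apply/funext => w.
  apply/allP/forallP => [hk i|hk i _]; last exact: hk.
  by apply: hk; rewrite mem_enum.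
elim: r => [|i r IH] /=; first exact: adapted_cst.
have an : adapted G (fun w => norm_coord n (b w 0 i) i).
  apply: adaptedM; last exact: adapted_cst.
  apply: adaptedM; last exact: adapted_cst.
  by apply: adaptedB => //; exact: adapted_cst.
apply: adapted_and => //; apply: adapted_and.
  by apply: adapted_le => //; exact: adapted_cst.
by split; apply: measurable_fun_ltr; [exact: adapted_fun|exact: measurable_cst].
Qed.

(** A function measurable in the outcome and continuous in the point is
    measurable at a measurable random point: it is the limit of its
    discretizations. *)
Lemma caratheodory_adapted (f : 'rV[R]_N -> T -> R) (b : T -> 'rV[R]_N) :
  (forall v, B v -> adapted G (f v)) -> (forall w, cont_on B (f^~ w)) ->
  (forall i, adapted G (fun w => b w 0 i)) -> (forall w, B (b w)) ->
  adapted G (fun w => f (b w) w).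
Proof.
move=> af cf ab Bb; split.
apply: (@measurable_fun_cvg _ (g_sigma_algebraType G) _ setT
  (fun n => discretize n f b)) => [n|w _].
   apply: adapted_fun; apply: adapted_sum => k; apply: adaptedM.
    exact/adapted_natr/adapted_in_cell.
  exact/af/grid_point_box.
apply/cvgrPdist_le => e e0.
have [del del0 h] := cf w (b w) (Bb w) e e0.
pose c := \sum_i (hi 0 i - lo 0 i) + 1.
have c0 : 0 < c by rewrite ltr_wpDl// sumr_ge0// => i _; rewrite subr_ge0 ltW.
have [n0 n0P] : exists n0, forall n, (n0 <= n)%N -> c / n.+1%:R < del.
  exists (Num.truncn (c / del)) => n hn.
  rewrite ltr_pdivrMr// mulrC -ltr_pdivrMr//.
  by apply: lt_le_trans (truncnS_gt _) _; rewrite ler_nat.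
exists n0 => // n /= hn; have [k [kb ->]] := discretizeE n f (Bb w).
rewrite distrC; apply: h; first exact: grid_point_box.
move=> i; rewrite distrC; apply: le_lt_trans (in_cell_close i kb) _.
apply: le_lt_trans (n0P n hn); rewrite ler_wpM2r ?invr_ge0//.
rewrite /c ler_wpDr// (bigD1 i)//= lerDl sumr_ge0// => j _.
by rewrite subr_ge0 ltW.
Qed.

(** Freezing: a random point independent of the randomness of a centered family
    may be treated as fixed.  On the grid the expectation splits into products;
    the Lipschitz bound controls the error. *)
Lemma freezing_mean0 H (f : 'rV[R]_N -> T -> R) (b : T -> 'rV[R]_N)
    (Lf Psi : T -> R) c :
  G `<=` measurable -> H `<=` measurable -> independent_sigma P G H ->
  (forall v, B v -> adapted H (f v)) -> (forall v, B v -> integrableR P (f v)) ->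
  (forall v, B v -> \int[P]_w f v w = 0) ->
  (forall w v v', B v -> B v' -> `|f v w - f v' w| <= Lf w * \sum_i `|v 0 i - v' 0 i|) ->
  integrableR P Lf -> (forall w, 0 <= Lf w) ->
  (forall i, adapted G (fun w => b w 0 i)) -> (forall w, B (b w)) ->
  adapted G Psi -> (forall w, `|Psi w| <= c) ->
  integrableR P (fun w => Psi w * f (b w) w) ->
  \int[P]_w (Psi w * f (b w) w) = 0.
Proof.
move=> mG mH ind af jf f0 Lip iL L0 ab Bb aPsi Psic iPf.
have c0 (w : T) : 0 <= c by exact: le_trans (normr_ge0 _) (Psic w).
pose X n w := Psi w * discretize n f b w.
have XE n w : X n w = \sum_(k : {ffun 'I_N -> 'I_n.+2})
    (Psi w * (in_cell k (b w))%:R) * f (grid_point k) w.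
  by rewrite /X mulr_sumr; apply: eq_bigr => k _; rewrite mulrA.
have aPk n (k : {ffun 'I_N -> 'I_n.+2}) : adapted G (fun w => Psi w * (in_cell k (b w))%:R).
  by apply: adaptedM => //; exact/adapted_natr/adapted_in_cell.
have iPk n (k : {ffun 'I_N -> 'I_n.+2}) :
    integrableR P (fun w => Psi w * (in_cell k (b w))%:R).
  apply: (@integrableR_bounded _ _ _ _ _ c) => [|w].
    exact: adapted_measurable mG (aPk n k).
  rewrite normrM; case: in_cell; rewrite ?normr1 ?mulr1// normr0 mulr0.
  exact: c0 w.
have prodk n (k : {ffun 'I_N -> 'I_n.+2}) := independent_mul_expectation mG mH ind
  (aPk n k) (af _ (grid_point_box k)) (iPk n k) (jf _ (grid_point_box k)).
have iX n : integrableR P (X n).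
  by rewrite (funext (XE n)); apply: integrableR_sum => k _; exact: (prodk n k).1.
have EX n : \int[P]_w X n w = 0.
  rewrite (funext (XE n)) expectationR_sum => [|k _]; last exact: (prodk n k).1.
  by rewrite big1// => k _; rewrite (prodk n k).2 f0 ?mulr0//; exact: grid_point_box.
pose l := \sum_i (hi 0 i - lo 0 i).
have l0 : 0 <= l by rewrite sumr_ge0// => i _; rewrite subr_ge0 ltW.
have bound n w : `|Psi w * f (b w) w - X n w| <= (c * l / n.+1%:R) * Lf w.
  rewrite /X -mulrBr normrM; have [k [kb ->]] := discretizeE n f (Bb w).
  have h := Lip w _ _ (Bb w) (grid_point_box k).
  have h' : \sum_i `|b w 0 i - grid_point k 0 i| <= l / n.+1%:R.
    by rewrite mulr_suml; apply: ler_sum => i _; exact: in_cell_close.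
  have -> : c * l / n.+1%:R * Lf w = c * (Lf w * (l / n.+1%:R)) by ring.
  by apply: ler_pM => //; apply: le_trans h _; rewrite ler_wpM2l.
have Ebound n : `|\int[P]_w (Psi w * f (b w) w)| <= c * l * (\int[P]_w Lf w) / n.+1%:R.
  have -> : \int[P]_w (Psi w * f (b w) w) = \int[P]_w (Psi w * f (b w) w - X n w).
    by rewrite expectationRB// EX subr0.
  have iD : integrableR P (fun w => Psi w * f (b w) w - X n w) by exact: integrableRB.
  apply: le_trans (le_normr_Rintegral measurableT iD) _.
  have -> : c * l * (\int[P]_w Lf w) / n.+1%:R = \int[P]_w ((c * l / n.+1%:R) * Lf w).
    by rewrite expectationRZ//; ring.
  apply: expectationR_le => //; [exact: integrableR_norm|exact: integrableRZ].
apply/eqP; rewrite -normr_le0; apply/ler_addgt0Pr => e e0; rewrite add0r.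
pose K := c * l * (\int[P]_w Lf w).
apply: le_trans (Ebound (Num.truncn (K / e))) _.
by rewrite -/K ler_pdivrMr// [leRHS]mulrC -ler_pdivrMr// ltW// truncnS_gt.
Qed.

End random_points.

(** * Random step sizes *)

Section binomial_sums.
Context {R : realType}.
Implicit Types (q : R) (g : nat -> R).

Lemma binomial_pmfS q t m :
  binomial_pmf t.+1 q m.+1 = (1 - q) * binomial_pmf t q m.+1 + q * binomial_pmf t q m.
Proof.
rewrite /binomial_pmf binS subSS [in RHS]mulrnAr [in RHS]mulrnAr.
have [tm|mt] := leqP t m.
  by rewrite bin_small// add0n mulr0n add0r exprS mulrA.
rewrite mulrnDr; congr (_ *+ _ + _ *+ _); last by rewrite exprS mulrA.
by rewrite -(subnSK mt) !exprS /unstable.onem; ring.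
Qed.

(** A Bernoulli process visits each number of successes during 1 / q slots on
    average. *)
Lemma sum_binomial_pmf_le q m n : 0 < q <= 1 ->
  \sum_(t < n) binomial_pmf t q m <= q^-1.
Proof.
move=> /andP[q0 q1]; have pmf0 t k : 0 <= binomial_pmf t q k.
  by apply: binomial_pmf_ge0; rewrite ltW.
elim: m => [|m IH].
  rewrite -[leRHS]mul1r ler_pdivlMr//.
  have -> : (\sum_(t < n) binomial_pmf t q 0) * q = 1 - (1 - q) ^+ n.
    elim: n => [|n IH]; first by rewrite big_ord0 mul0r expr0 subrr.
    rewrite big_ord_recr /= mulrDl IH /binomial_pmf bin0 subn0 expr0 mulr1n /unstable.onem exprS.
    by ring.
  by rewrite lerBlDr lerDl exprn_ge0// subr_ge0.
apply: le_trans IH.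
have rec k : \sum_(t < k.+1) binomial_pmf t q m.+1 =
    (1 - q) * \sum_(t < k) binomial_pmf t q m.+1 + q * \sum_(t < k) binomial_pmf t q m.
  rewrite big_ord_recl /= {1}/binomial_pmf bin0n mulr0n add0r.
  under eq_bigr do rewrite /bump /= add1n binomial_pmfS.
  by rewrite big_split/= -!mulr_sumr.
have le1 : \sum_(t < n) binomial_pmf t q m.+1 <= \sum_(t < n.+1) binomial_pmf t q m.+1.
  by rewrite big_ord_recr/= lerDl.
by rewrite rec in le1; rewrite -(ler_pM2l q0); lra.
Qed.

Definition binomial_mean q t g : R := \sum_(k < t.+1) binomial_pmf t q k * g k.

(** Exchange the sums: each g k is weighted by the expected number of slots with k
    successes. *)
Lemma sum_binomial_mean_le q g n : 0 < q <= 1 -> (forall k, 0 <= g k) ->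
  \sum_(t < n) binomial_mean q t g <= q^-1 * \sum_(k < n) g k.
Proof.
move=> q01 g0; have /andP[q0 q1] := q01; have pmf0 t k : 0 <= binomial_pmf t q k.
  by apply: binomial_pmf_ge0; rewrite ltW.
apply: (@le_trans _ _ (\sum_(t < n) \sum_(k < n) binomial_pmf t q k * g k)).
  apply: ler_sum => t _; rewrite /binomial_mean.
  rewrite -!(big_mkord xpredT (fun k => binomial_pmf t q k * g k)).
  by rewrite (@big_cat_nat _ _ _ t.+1 0 n)//= lerDl sumr_ge0// => k _; rewrite mulr_ge0.
rewrite exchange_big/= mulr_sumr; apply: ler_sum => k _.
by rewrite -mulr_suml ler_wpM2r// sum_binomial_pmf_le.
Qed.

Lemma binomial_expectation d (T : measurableType d) (P : probability T R)
    (X : {RV P >-> nat}) q t g : 0 < q <= 1 ->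
  (forall B, P (X @^-1` B) = binomial_prob t q B) -> (forall k, 0 <= g k) ->
  integrableR P (fun w => g (X w)) /\ \int[P]_w g (X w) = binomial_mean q t g.
Proof.
move=> /andP[q0 q1] XE g0.
have mg : measurable_fun setT (fun w => g (X w)) by exact: (measurableT_comp (f := g)).
have E : (\int[P]_w (g (X w))%:E = (binomial_mean q t g)%:E)%E.
  transitivity (\int[distribution P X]_k (g k)%:E)%E.
    by rewrite ge0_integral_distribution// => k; rewrite lee_fin.
  rewrite (eq_measure_integral (binomial_prob t q)); last by move=> B _ _; exact: XE.
  rewrite (@integral_binomial R t q (ltW q0) q1); last by move=> k; rewrite lee_fin.
  by rewrite /binomial_mean -sumEFin.
split; last by rewrite /Rintegral E.
apply/integrableP; split; first exact/measurable_EFinP.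
under eq_integral do rewrite /= ger0_norm//.
by rewrite E ltry.
Qed.

End binomial_sums.

(** Condensation: the terms between two powers of 2 are bounded by a geometric
    sequence. *)
Lemma cvg_series_powR (R : realType) (s : R) : 1 < s ->
  cvgn (series (fun n => n.+1%:R `^ (- s))).
Proof.
move=> s1.
(* The block of 2 ^ J terms from 2 ^ J on has a sum of at most r ^ J. *)
pose r : R := 2 `^ (1 - s).
have r0 : 0 < r by rewrite powR_gt0.
have r1 : r < 1.
  rewrite /r -opprB powRN invf_lt1 ?powR_gt0//.
  rewrite -[ltLHS](powRr0 2) /powR pnatr_eq0/= ltr_expR ltr_pM2r ?subr_gt0//.
  by rewrite ln_gt0// ltr1n.
apply: nondecreasing_is_cvgn.
  by apply/nondecreasing_seqP => n; rewrite seriesSr lerDl powR_ge0.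
exists ((1 - r)^-1) => _ [n _ <-].
have dyadic J : \sum_(0 <= k < 2 ^ J - 1) k.+1%:R `^ (- s) <= \sum_(j < J) r ^+ j.
  elim: J => [|J IH]; first by rewrite subnn big_geq// big_ord0.
  rewrite big_ord_recr/= (@big_cat_nat _ _ _ (2 ^ J - 1))//=; last first.
    by rewrite leq_sub2r// leq_exp2l.
  apply: lerD => //.
  have J2 : (0 < 2 ^ J)%N by rewrite expn_gt0.
  apply: (@le_trans _ _ (\sum_(2 ^ J - 1 <= k < 2 ^ J.+1 - 1) (2 ^ J)%:R `^ (- s))).
    apply: ler_sum_nat => k /andP[k1 _].
    rewrite !powRN lef_pV2 ?posrE ?powR_gt0// ?ltr0n//.
    apply: ge0_ler_powR; rewrite ?nnegrE ?ler0n//; first by rewrite ltW// (lt_trans ltr01).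
    by rewrite ler_nat -ltnS -[k.+1]addn1 -leq_subLR -ltnS subn1 prednK// in k1 *; lia.
  rewrite sumr_const_nat.
  have -> : (2 ^ J.+1 - 1 - (2 ^ J - 1) = 2 ^ J)%N by rewrite expnS; lia.
  have J2R : (2 ^ J)%:R = (2 : R) `^ J%:R by rewrite natrX -powR_mulrn.
  rewrite -[leLHS]mulr_natl J2R /r -powR_mulrn ?powR_ge0// -!powRrM.
  rewrite -powRD ?pnatr_eq0 ?implybT//.
  have -> : J%:R + J%:R * - s = (1 - s) * J%:R by ring.
  by [].
have geo J : \sum_(j < J) r ^+ j <= (1 - r)^-1.
  rewrite -[leRHS]mul1r ler_pdivlMr ?subr_gt0//.
  have -> : (\sum_(j < J) r ^+ j) * (1 - r) = 1 - r ^+ J.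
    elim: J => [|J IH]; first by rewrite big_ord0 mul0r expr0 subrr.
    by rewrite big_ord_recr/= mulrDl IH exprS; ring.
  by rewrite lerBlDr lerDl exprn_ge0// ltW.
apply: le_trans (le_trans (dyadic n) (geo n)); rewrite /series/=.
have n2 : (n <= 2 ^ n - 1)%N by have := ltn_expl n (isT : 1 < 2)%N; lia.
by rewrite (@big_cat_nat _ _ _ n 0 (2 ^ n - 1))//= lerDl sumr_ge0// => k _; rewrite powR_ge0.
Qed.

Section step_sizes.
Context {R : realType} (p : params R).
Hypothesis pok : params_ok p.

Lemma beta_ge0 l : 0 <= beta p l.
Proof. by rewrite mulr_ge0 ?powR_ge0// ltW// (beta0_gt0 pok). Qed.

Lemma gamma_ge0 l : 0 <= gamma p l.
Proof. by rewrite mulr_ge0 ?powR_ge0// ltW// (gamma0_gt0 pok). Qed.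

Lemma c1_gt0 : 0 < c1 p.
Proof. by have /andP[h _] := c1_range pok; apply: lt_trans h; rewrite invr_gt0. Qed.

Lemma c2_gt0 : 0 < c2 p. Proof. by have /andP[] := c2_range pok. Qed.

Let powR_antitone c k l : 0 < c -> (0 < k <= l)%N -> l%:R `^ (- c) <= k%:R `^ (- c) :> R.
Proof.
move=> c0 /andP[k0 kl]; have l0 := leq_trans k0 kl.
rewrite !powRN lef_pV2 ?posrE ?powR_gt0 ?ltr0n//.
by apply: ge0_ler_powR; rewrite ?nnegrE ?ler0n ?ler_nat// ltW.
Qed.

Lemma beta_antitone k l : (0 < k <= l)%N -> beta p l <= beta p k.
Proof.
by move=> kl; rewrite ler_wpM2l ?(ltW (beta0_gt0 pok))// powR_antitone// c1_gt0.
Qed.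

Lemma gamma_antitone k l : (0 < k <= l)%N -> gamma p l <= gamma p k.
Proof.
by move=> kl; rewrite ler_wpM2l ?(ltW (gamma0_gt0 pok))// powR_antitone// c2_gt0.
Qed.

Lemma beta_le l : beta p l.+1 <= beta0 p.
Proof. by apply: le_trans (@beta_antitone 1 l.+1 _) _; rewrite ?/beta ?powR1 ?mulr1. Qed.

Lemma gamma_le l : gamma p l.+1 <= gamma0 p.
Proof. by apply: le_trans (@gamma_antitone 1 l.+1 _) _; rewrite ?/gamma ?powR1 ?mulr1. Qed.

Lemma cvg_series_beta_sqr : cvgn (series (fun n => beta p n.+1 ^+ 2)).
Proof.
have -> : (fun n => beta p n.+1 ^+ 2) =
    (beta0 p ^+ 2) *: (fun n => n.+1%:R `^ (- (c1 p *+ 2)) : R).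
  apply/funext => n; rewrite fctE /= /beta exprMn -[_ `^ _ ^+ 2]powR_mulrn ?powR_ge0//.
  rewrite -powRrM; congr (_ * _ `^ _); rewrite mulNr mulr_natr//.
rewrite seriesZ; apply: is_cvgZr; apply: cvg_series_powR.
have /andP[h _] := c1_range pok; rewrite -mulr_natr.
by rewrite -ltr_pdivrMr// mul1r.
Qed.

(** Both are negative powers of the same number, so that gamma is a continuous
    function of beta which vanishes at 0. *)
Lemma gamma_cvg0 (l : nat -> nat) :
  (fun t => beta p (l t).+1) @ \oo --> 0 -> (fun t => gamma p (l t).+1) @ \oo --> 0.
Proof.
move=> /cvgrPdist_lt bl; apply/cvgrPdist_lt => e e0.
have g0 := gamma0_gt0 pok; have b0 := beta0_gt0 pok.
pose e1 : R := e / gamma0 p; have e10 : 0 < e1 by rewrite divr_gt0.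
pose e2 : R := e1 `^ (c1 p / c2 p).
have e20 : 0 < beta0 p * e2 by rewrite mulr_gt0// powR_gt0.
have [n _ nP] := bl _ e20; exists n => // t /nP /=.
rewrite !sub0r !normrN !ger0_norm ?beta_ge0 ?gamma_ge0// /beta /gamma.
rewrite ltr_pM2l// => h; rewrite mulrC -ltr_pdivlMr//.
have c20 := c2_gt0; have c10 := c1_gt0.
have cc : 0 < c2 p / c1 p by rewrite divr_gt0.
have := gt0_ltr_powR cc _ _ h; rewrite ?nnegrE ?powR_ge0// => /(_ isT isT).
rewrite /e2 -!powRrM.
have -> : - c1 p * (c2 p / c1 p) = - c2 p by field; rewrite gt_eqF.
have -> : c1 p / c2 p * (c2 p / c1 p) = 1 by field; rewrite !gt_eqF.
by rewrite powRr1 // ltW.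
Qed.

Definition beta_sqr_mean t := binomial_mean (qa p) t (fun k => beta p k.+1 ^+ 2).

(** The deterministic step size of the averaged recursion: the mean of the product
    of the two step sizes of an active node. *)
Definition rho t := binomial_mean (qa p) t (fun k => beta p k.+1 * gamma p k.+1).

Let pmf0 t k : 0 <= binomial_pmf t (qa p) k.
Proof. by apply: binomial_pmf_ge0; have /andP[/ltW-> ->] := qa_range pok. Qed.

Lemma beta_sqr_mean_ge0 t : 0 <= beta_sqr_mean t.
Proof. by apply: sumr_ge0 => k _; rewrite mulr_ge0// sqr_ge0. Qed.

Lemma cvg_series_beta_sqr_mean : cvgn (series beta_sqr_mean).
Proof.
apply: nondecreasing_is_cvgn.
  by apply/nondecreasing_seqP => n; rewrite seriesSr lerDl beta_sqr_mean_ge0.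
exists ((qa p)^-1 * limn (series (fun n => beta p n.+1 ^+ 2))) => _ [n _ <-].
rewrite /series/= big_mkord; apply: le_trans (sum_binomial_mean_le n (qa_range pok) _) _.
  by move=> k; exact: sqr_ge0.
have /andP[q0 _] := qa_range pok; rewrite ler_wpM2l ?invr_ge0 ?(ltW q0)//.
have nd : nondecreasing_seq (series (fun n => beta p n.+1 ^+ 2)).
  by apply/nondecreasing_seqP => k; rewrite seriesSr lerDl sqr_ge0.
by have := nondecreasing_cvgn_le nd cvg_series_beta_sqr n; rewrite {1}/series/= big_mkord.
Qed.

Lemma binomial_mean_cst t (c : R) : binomial_mean (qa p) t (fun=> c) = c.
Proof.
rewrite /binomial_mean -mulr_suml; have -> : \sum_(k < t.+1) binomial_pmf t (qa p) k = 1.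
  have := exprDn (1 - qa p) (qa p) t; rewrite subrK expr1n => ->.
  by apply: eq_bigr => k _; rewrite /binomial_pmf mulrC.
by rewrite mul1r.
Qed.

Lemma rho_ge0 t : 0 <= rho t.
Proof. by apply: sumr_ge0 => k _; rewrite mulr_ge0// mulr_ge0 ?beta_ge0 ?gamma_ge0. Qed.

Lemma rho_le t : rho t <= beta0 p * gamma0 p.
Proof.
rewrite -[leRHS](binomial_mean_cst t); apply: ler_sum => k _.
by rewrite ler_wpM2l// ler_pM ?beta_ge0 ?gamma_ge0 ?beta_le ?gamma_le.
Qed.

(** The square of a mean is at most the mean of the squares. *)
Lemma rho_sqr_le t : rho t ^+ 2 <= gamma0 p ^+ 2 * beta_sqr_mean t.
Proof.
have g0 := gamma0_gt0 pok.
have : 0 <= binomial_mean (qa p) t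
   (fun k => (beta p k.+1 * gamma p k.+1 - rho t) ^+ 2).
  by apply: sumr_ge0 => k _; rewrite mulr_ge0// sqr_ge0.
have -> : binomial_mean (qa p) t (fun k => (beta p k.+1 * gamma p k.+1 - rho t) ^+ 2) =
    binomial_mean (qa p) t (fun k => (beta p k.+1 * gamma p k.+1) ^+ 2) - rho t ^+ 2.
  transitivity (binomial_mean (qa p) t (fun k => (beta p k.+1 * gamma p k.+1) ^+ 2)
     - 2 * rho t * rho t + binomial_mean (qa p) t (fun=> rho t ^+ 2)).
    rewrite {3}/rho /binomial_mean mulr_sumr -sumrB -big_split/=.
    by apply: eq_bigr => k _; ring.
  by rewrite binomial_mean_cst; ring.
rewrite subr_ge0 => /le_trans; apply; rewrite /beta_sqr_mean /binomial_mean mulr_sumr.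
apply: ler_sum => k _; rewrite [leRHS]mulrCA ler_wpM2l// exprMn mulrC ler_wpM2r ?sqr_ge0//.
by rewrite lerXn2r ?nnegrE ?gamma_ge0 ?gamma_le// ltW.
Qed.

(** As c1 + c2 <= 1 and a node has counter at most t in slot t, rho t is at
    least a multiple of 1 / (t + 1). *)
Lemma dvg_series_rho : ~ cvgn (series rho).
Proof.
have b0 := beta0_gt0 pok; have g0 := gamma0_gt0 pok.
have bg : 0 < beta0 p * gamma0 p by rewrite mulr_gt0.
have h n : harmonic n <= (beta0 p * gamma0 p)^-1 * rho n.
  rewrite ler_pdivlMl//; rewrite -[leLHS](binomial_mean_cst n); apply: ler_sum => k _.
  rewrite ler_wpM2l//.
  have kn : (0 < k.+1 <= n.+1)%N by rewrite ltn_ord.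
  apply: le_trans (ler_pM _ _ (beta_antitone kn) (gamma_antitone kn));
    rewrite ?beta_ge0 ?gamma_ge0//.
  rewrite /beta /gamma mulrACA ler_wpM2l ?(ltW bg)// -powRD; last by rewrite pnatr_eq0 implybT.
  rewrite -opprD powRN lef_pV2 ?posrE ?powR_gt0 ?ltr0n//.
  apply: ler1_powR; first by rewrite ler1n.
  by have /andP[_] := c2_range pok; lra.
move=> cr; apply: (@dvg_harmonic R).
apply: (series_le_cvg _ _ h) => [n|n|]; first exact: harmonic_ge0.
  by rewrite mulr_ge0 ?rho_ge0// invr_ge0 ltW.
exact: (is_cvg_seriesZ (k := (beta0 p * gamma0 p)^-1) cr).
Qed.

End step_sizes.

(** * Grouping independent sources *)

Section grouping.
Context {d} {T : measurableType d} {R : realType} (P : probability T R).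
Variables (J : Type) (Gs : J -> set_system T).
Hypothesis Gs_sigma : forall j, sigma_algebra setT (Gs j).
Hypothesis Gs_measurable : forall j, Gs j `<=` measurable.
Hypothesis Gs_indep : mutually_independent P Gs.

Let GsT j : Gs j setT.
Proof. by have [G0 GC _] := Gs_sigma j; have := GC _ G0; rewrite setD0. Qed.

Let GsI j A B : Gs j A -> Gs j B -> Gs j (A `&` B).
Proof.
rewrite -(sigma_algebra_id (Gs_sigma j)); exact: (@measurableI _ (g_sigma_algebraType (Gs j))).
Qed.

(** The finite intersections of events of the sigma-algebras indexed by D: the
    pi-system that generates their join. *)
Definition finite_inter (D : set J) : set_system T := [set A |
  exists (r : seq {classic J}) (B : J -> set T), [/\ forall j, Gs j (B j),
    forall j, j \in r -> D j & A = \bigcap_(j in [set` r]) B j]].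

Let merge (r1 r2 : seq {classic J}) (B1 B2 : J -> set T) (j : {classic J}) : set T :=
  (if j \in r1 then B1 j else setT) `&` (if j \in r2 then B2 j else setT).

Let merge_bigcap r1 r2 B1 B2 :
  (\bigcap_(j in [set` r1]) B1 j) `&` (\bigcap_(j in [set` r2]) B2 j) =
  \bigcap_(j in [set` r1 ++ r2]) merge r1 r2 B1 B2 j.
Proof.
apply/seteqP; split => [w [h1 h2] j _|w h]; rewrite /merge.
  by split; case: ifPn => // jr; [exact: h1|exact: h2].
split => j /= jr.
  by have := h j; rewrite /= mem_cat jr => /(_ isT) [+ _]; rewrite jr.
by have := h j; rewrite /= mem_cat jr orbT => /(_ isT) [_ +]; rewrite jr.
Qed.

Let merge_Gs r1 r2 B1 B2 j : (forall j, Gs j (B1 j)) -> (forall j, Gs j (B2 j)) ->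
  Gs j (merge r1 r2 B1 B2 j).
Proof. by move=> h1 h2; apply: GsI; case: ifP. Qed.

Lemma finite_inter_setI D : setI_closed (finite_inter D).
Proof.
move=> _ _ [r1 [B1 [h1 D1 ->]]] [r2 [B2 [h2 D2 ->]]].
exists (r1 ++ r2), (merge r1 r2 B1 B2); split.
- by move=> j; exact: merge_Gs.
- by move=> j; rewrite mem_cat => /orP[/D1|/D2].
- exact: merge_bigcap.
Qed.

Lemma sub_finite_inter (D : set J) j : D j -> Gs j `<=` finite_inter D.
Proof.
move=> Dj A GA; exists [:: (j : {classic J})].
exists (fun k : {classic J} => if k == j then A else setT); split.
- by move=> k; case: eqP => [->|].
- by move=> k; rewrite inE => /eqP ->.
- apply/seteqP; split => [w Aw k /=|w /(_ j) /=]; first by rewrite inE => ->.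
  by rewrite inE eqxx; apply.
Qed.

Lemma finite_inter_measurable D : finite_inter D `<=` measurable.
Proof.
move=> _ [r [B [h _ ->]]]; rewrite bigcap_seq.
elim: r => [|j r IH]; rewrite ?big_nil// big_cons.
by apply: measurableI => //; exact: (Gs_measurable (h j)).
Qed.

Lemma finite_interT D : finite_inter D setT.
Proof. by exists [::], (fun=> setT); split => //; rewrite bigcap_seq big_nil. Qed.

Let product_rule (r : seq {classic J}) (B : J -> set T) : uniq r ->
  (forall j, Gs j (B j)) ->
  P (\bigcap_(j in [set` r]) B j) = (\prod_(j <- r) P (B j))%E.
Proof.
move=> ur h; have := @Gs_indep (size r) (fun m => tnth (in_tuple r) m)
  (fun m => B (tnth (in_tuple r) m)).
rewrite -(big_tuple _ _ (in_tuple r) xpredT (fun j => P (B j)))/= => <- //.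
- congr (P _); apply/seteqP; split => w hw.
    by move=> m _; apply: hw => /=; exact: mem_tnth.
  move=> j /= jr; have [m ->] := seq_tnthP jr.
  exact: hw.
- by have /tuple_uniqP inj : uniq (in_tuple r) := ur.
Qed.

Lemma finite_inter_independent D1 D2 A1 A2 : D1 `&` D2 = set0 ->
  finite_inter D1 A1 -> finite_inter D2 A2 -> P (A1 `&` A2) = (P A1 * P A2)%E.
Proof.
move=> D12 [r1' [B1 [h1 D1r ->]]] [r2' [B2 [h2 D2r ->]]].
have undupE (r : seq {classic J}) (B : J -> set T) :
    \bigcap_(j in [set` r]) B j = \bigcap_(j in [set` undup r]) B j.
  by apply/seteqP; split => w h j /= jr; apply: h => /=; move: jr; rewrite mem_undup.
rewrite (undupE r1') (undupE r2').
have {}D1r j : j \in undup r1' -> D1 j by rewrite mem_undup; exact: D1r.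
have {}D2r j : j \in undup r2' -> D2 j by rewrite mem_undup; exact: D2r.
have := undup_uniq r1'; have := undup_uniq r2'.
move: (undup r1') (undup r2') D1r D2r => r1 r2 D1r D2r u2 u1.
have dis j : j \in r1 -> j \in r2 -> False.
  by move=> /D1r d1 /D2r d2; have : (D1 `&` D2) j by []; rewrite D12.
rewrite merge_bigcap product_rule => [||j]; last exact: merge_Gs.
  rewrite big_cat/= !product_rule//; congr (_ * _)%E; apply: eq_big_seq => j jr.
    by rewrite /merge jr; case: ifP => [/(dis _ jr)//|_]; rewrite setIT.
  by rewrite /merge jr; case: ifP => [/dis/(_ jr)//|_]; rewrite setTI.
rewrite cat_uniq u1 u2 andbT; apply/hasPn => j j2; apply/negP => j1.
exact: (dis j).
Qed.

End grouping.

Section sources.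
Context {d} {T : measurableType d} {R : realType} {P : probability T R}.
Context {dS} {St : measurableType dS} {N : nat}.
Variables (W : inputs P St N) (p : params R).
Hypothesis law : inputs_law W p.
Implicit Types D : set (source N).

Lemma events_sigma d' (E : measurableType d') (X : T -> E) : sigma_algebra setT (events X).
Proof.
have := @sigma_algebra_preimage T E measurable setT X; apply.
exact: (sigma_algebra_measurable E).
Qed.

Lemma events_measurable d' (E : measurableType d') (X : T -> E) :
  measurable_fun setT X -> events X `<=` measurable.
Proof. by move=> mX _ [B mB <-]; exact: mX. Qed.

Lemma source_events_sigma (s : source N) : sigma_algebra setT (source_events W s).
Proof.
case: s => *; try exact: events_sigma.
exact: smallest_sigma_algebra.
Qed.

Lemma source_events_measurable (s : source N) : source_events W s `<=` measurable.
Proof.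
case: s => [i t|i t|i t|i t|t|t]; try exact: events_measurable.
apply: smallest_sub; first exact: sigma_algebra_measurable.
by move=> A [ij _]; exact: events_measurable.
Qed.

Definition fresh D : set_system T := \bigcup_(s in D) source_events W s.

Variable a0 : 'I_N -> T -> R.
Hypothesis a0_measurable : forall i, measurable_fun setT (a0 i).

Definition initial : set_system T :=
  \bigcup_(i in [set: 'I_N]) (events (a0 i) `|` source_events W (SrcActive i 0)).

Hypothesis initial_independent : independent_sigma P initial
  (\bigcup_(s in [set s | forall i, s <> SrcActive i 0]) source_events W s).

(** The initial action comes with the first activities because the two may be
    dependent. *)
Definition known D : set_system T := initial `|` \bigcup_(s in D) source_events W s.

Lemma initial_measurable : initial `<=` measurable.
Proof.
move=> A [i _ [|]]; first exact: events_measurable.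
exact: source_events_measurable.
Qed.

Lemma known_measurable D : known D `<=` measurable.
Proof. by move=> A [/initial_measurable//|[s _ /source_events_measurable]]. Qed.

Lemma fresh_measurable D : fresh D `<=` measurable.
Proof. by move=> A [s _ /source_events_measurable]. Qed.

(** Both sides are generated by pi-systems of finite intersections, on which the
    independence of the sources gives the product rule.  The first activities are
    tied to the initial action, so they always count as known. *)
Lemma known_fresh_independent D : (forall i, ~ D (SrcActive i 0)) ->
  independent_sigma P (known (~` D)) (fresh D).
Proof.
move=> D0; pose D1 := ~` D `&` [set s | forall i, s <> SrcActive i 0].
pose Gs := source_events W.
pose PI := finite_inter Gs.
have pisub E : (forall i, ~ E (SrcActive i 0)) ->
    PI E `<=` <<s \bigcup_(s in [set s | forall i, s <> SrcActive i 0]) Gs s >>.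
  move=> E0 _ [r [B [h hD ->]]]; rewrite bigcap_seq.
  elim: r hD => [|j r IH] hD.
    by rewrite big_nil; exact: (@measurableT _ (g_sigma_algebraType _)).
  rewrite big_cons; apply: (@measurableI _ (g_sigma_algebraType _)).
    apply: sub_gen_smallest; exists (j : source N) => //= i ji.
    by apply: (E0 i); rewrite -ji; apply: hD; rewrite inE eqxx.
  by apply: IH => k kr; apply: hD; rewrite inE kr orbT.
pose K : set_system T := [set A | exists A1 A2, [/\ <<s initial >> A1, PI D1 A2 & A = A1 `&` A2]].
have sI := @source_events_sigma; have mI := @source_events_measurable.
have initI : setI_closed <<s initial >>.
  by move=> A B; exact: (@measurableI _ (g_sigma_algebraType initial)).
have minit : <<s initial >> `<=` measurable.
  by apply: smallest_sub; [exact: sigma_algebra_measurable|exact: initial_measurable].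
have piI E : setI_closed (PI E) by exact: finite_inter_setI.
have piM E : PI E `<=` measurable by exact: finite_inter_measurable.
have indK : independent_sigma P K (PI D).
  apply: independent_sigma_pi => //.
  - move=> _ _ [A1 [A2 [h1 h2 ->]]] [B1 [B2 [k1 k2 ->]]].
    exists (A1 `&` B1), (A2 `&` B2); rewrite setIACA; split => //.
      exact: initI.
    exact: piI.
  - by move=> _ [A1 [A2 [h1 h2 ->]]]; apply: measurableI; [exact: minit|exact: piM h2].
  - move=> _ C [A1 [A2 [h1 h2 ->]]] hC.
    have D10 i : ~ D1 (SrcActive i 0) by move=> [_ /(_ i)].
    have dis : D1 `&` D = set0.
      by apply/seteqP; split => // s [[]].
    have m2 := pisub _ D10 _ h2; have mC := pisub _ D0 _ hC.
    rewrite -setIA initial_independent//; last first.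
      exact: (@measurableI _ (g_sigma_algebraType _)).
    rewrite (finite_inter_independent sI (sources_independent law) dis h2 hC).
    by rewrite muleA initial_independent.
move=> A B hA hB; apply: indK.
- move: A hA; apply: smallest_sub; first exact: smallest_sigma_algebra.
  have i0 : initial `<=` <<s K >>.
    move=> A hA; apply: sub_gen_smallest; exists A, setT; rewrite setIT; split => //.
      exact: sub_gen_smallest.
    exact: finite_interT.
  move=> A [/i0//|[s Ds hA]].
  have [[i si]|ns] := pselect (exists i, s = SrcActive i 0).
    by apply: i0; exists i => //; right; rewrite -si.
  apply: sub_gen_smallest; exists setT, A; rewrite setTI; split => //.
    exact: (@measurableT _ (g_sigma_algebraType initial)).
  apply: (sub_finite_inter sI (D := D1) _ hA); split => // i si; apply: ns.
  by exists i.
- move: B hB; apply: smallest_sub; first exact: smallest_sigma_algebra.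
  move=> B [s Ds hB]; apply: sub_gen_smallest.
  exact: (sub_finite_inter sI Ds hB).
Qed.

End sources.

(** * Second moments *)

Section laws.
Context {d} {T : measurableType d} {R : realType} (P : probability T R).
Implicit Types (X Y : T -> R) (K L c : R).

Definition second_moment_le (X : T -> R) (K : R) :=
  [/\ measurable_fun setT X, integrableR P (fun w => X w ^+ 2) &
      \int[P]_w (X w ^+ 2) <= K].

Lemma second_moment_integrable X K : second_moment_le X K -> integrableR P X.
Proof.
case=> mX iX _; apply: (integrableR_le mX _ (integrableRD (integrableR_cst P 1) iX)) => w.
rewrite [leRHS]ger0_norm ?addr_ge0 ?sqr_ge0// -[X w ^+ 2]real_normK ?num_real//.
by have := sqr_ge0 (`|X w| - 1); have := normr_ge0 (X w); nra.
Qed.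

Lemma second_moment_cst (c : R) : second_moment_le (fun=> c) (c ^+ 2).
Proof.
split; [exact: measurable_cst|exact: integrableR_cst|].
by rewrite expectationR_cst.
Qed.

Lemma second_moment_le_dom X Y K : measurable_fun setT X ->
  (forall w, `|X w| <= Y w) -> second_moment_le Y K -> second_moment_le X K.
Proof.
move=> mX XY [mY iY KY].
have h w : X w ^+ 2 <= Y w ^+ 2.
  rewrite -[X w ^+ 2]real_normK ?num_real// lerXn2r ?nnegrE//.
  exact: le_trans (XY w).
have iX : integrableR P (fun w => X w ^+ 2).
  apply: (integrableR_le _ _ iY); first exact: measurable_funX.
  by move=> w; rewrite !ger0_norm ?sqr_ge0.
by split => //; apply: le_trans KY; exact: expectationR_le.
Qed.

Lemma second_momentD X Y K L : second_moment_le X K -> second_moment_le Y L ->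
  second_moment_le (fun w => X w + Y w) (2 * (K + L)).
Proof.
move=> [mX iX KX] [mY iY LY]; have mXY := measurable_funD mX mY.
have iS : integrableR P (fun w => 2 * (X w ^+ 2 + Y w ^+ 2)).
  exact/integrableRZ/integrableRD.
have h w : (X w + Y w) ^+ 2 <= 2 * (X w ^+ 2 + Y w ^+ 2).
  by have := sqr_ge0 (X w - Y w); rewrite !expr2; nra.
have iXY : integrableR P (fun w => (X w + Y w) ^+ 2).
  apply: (integrableR_le _ _ iS) => [|w]; first exact: measurable_funX.
  rewrite (ger0_norm (sqr_ge0 _)); apply: le_trans (h w) _; exact: ler_norm.
split => //; apply: le_trans (expectationR_le iXY iS h) _.
rewrite expectationRZ; last exact: integrableRD.
by rewrite expectationRD// ler_wpM2l// lerD.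
Qed.

Lemma second_momentZ c X K : second_moment_le X K ->
  second_moment_le (fun w => c * X w) (c ^+ 2 * K).
Proof.
move=> [mX iX KX].
have E : (fun w => (c * X w) ^+ 2) = (fun w => c ^+ 2 * X w ^+ 2).
  by apply/funext => w; rewrite exprMn.
split.
- by apply: measurable_funM => //; exact: measurable_cst.
- by rewrite E; exact: integrableRZ.
- by rewrite E expectationRZ// ler_wpM2l ?sqr_ge0.
Qed.

Lemma second_moment_norm X K : second_moment_le X K ->
  second_moment_le (fun w => `|X w|) K.
Proof.
move=> [mX iX KX].
have E : (fun w => `|X w| ^+ 2) = (fun w => X w ^+ 2).
  by apply/funext => w; rewrite real_normK ?num_real.
by split; rewrite ?E//; exact: measurableT_comp.
Qed.

Lemma second_moment_sum (I : Type) (r : seq I) (K : I -> R) :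
  exists L, forall (Y : I -> T -> R), (forall i, second_moment_le (Y i) (K i)) ->
    second_moment_le (fun w => \sum_(i <- r) Y i w) L.
Proof.
elim: r => [|i r [L IH]].
  exists 0 => Y hY; under eq_fun do rewrite big_nil.
  by have := second_moment_cst 0; rewrite expr0n.
exists (2 * (K i + L)) => Y hY; under eq_fun do rewrite big_cons.
by apply: second_momentD => //; exact: IH.
Qed.

Lemma identically_distributed_integrableR d' (E : measurableType d') (X Y : {RV P >-> E})
    (h : E -> R) : identically_distributed P X Y -> measurable_fun setT h ->
  integrableR P (fun w => h (X w)) ->
  integrableR P (fun w => h (Y w)) /\ \int[P]_w h (Y w) = \int[P]_w h (X w).
Proof.
move=> XY mh iX.
have mhE : measurable_fun setT (EFin \o h) by exact/measurable_EFinP.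
have lawE (g : E -> \bar R) : (\int[distribution P X]_y g y = \int[distribution P Y]_y g y)%E.
  by apply: eq_measure_integral => A mA _; exact: XY.
have iY : integrableR P (fun w => h (Y w)).
  apply/integrableP; split.
    by apply/measurable_EFinP; exact: measurableT_comp.
  have mn : measurable_fun setT (fun y => `|(h y)%:E|%E) by exact: measurableT_comp.
  have -> : (\int[P]_w `|(h (Y w))%:E| = \int[distribution P Y]_y `|(h y)%:E|)%E.
    by rewrite ge0_integral_distribution.
  by rewrite -lawE ge0_integral_distribution//; case/integrableP : iX.
split => //; rewrite /Rintegral; congr fine.
have EX := integral_distribution mhE iX; have EY := integral_distribution mhE iY.
by rewrite -[LHS]EY -[RHS]EX.
Qed.

(** By monotone convergence the sum has a finite mean, hence is finite almost surely. *)
Lemma expectation_series_cvg (X : nat -> T -> R) (v : nat -> R) :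
  (forall n, integrableR P (X n)) -> (forall n w, 0 <= X n w) ->
  (forall n, \int[P]_w X n w <= v n) -> cvgn (series v) ->
  {ae P, forall w, cvgn (series (X ^~ w))}.
Proof.
move=> iX X0 Xv cv.
have mX n : measurable_fun setT (EFin \o X n) by case/integrableP : (iX n).
have X0' n w : (0 <= (X n w)%:E)%E by rewrite lee_fin.
pose S w := (\sum_(n <oo) (X n w)%:E)%E.
have mS : measurable_fun setT S.
  apply: (@ge0_emeasurable_sum _ _ _ _ (fun n w => (X n w)%:E) xpredT) => // n _.
  exact: mX n.
have S0 w : (0 <= S w)%E by apply: nneseries_ge0.
have v0 n : 0 <= v n by apply: le_trans (Xv n); exact: Rintegral_ge0.
have iS : P.-integrable setT S.
  apply/integrableP; split => //.
  under eq_integral do rewrite gee0_abs//.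
  rewrite integral_nneseries//.
  apply: (@le_lt_trans _ _ (limn (series v))%:E); last exact: ltry.
  apply: lime_le; first by apply: is_cvg_nneseries => n _ _; apply: integral_ge0.
  apply: nearW => n /=.
  have -> : (\sum_(0 <= k < n) \int[P]_w (X k w)%:E = (\sum_(0 <= k < n) \int[P]_w X k w)%:E)%E.
    by rewrite -sumEFin; apply: eq_bigr => k _; exact: integrableR_fin.
  rewrite lee_fin; apply: (@le_trans _ _ (series v n)); first exact: ler_sum.
  apply: nondecreasing_cvgn_le => //; apply/nondecreasing_seqP => k.
  by rewrite seriesSr lerDl.
have := integrable_ae measurableT iS.
apply: filterS => w /(_ I) fS.
apply: nondecreasing_is_cvgn.
  by apply/nondecreasing_seqP => k; rewrite seriesSr lerDl.
exists (fine (S w)) => _ [n _ <-]; rewrite -lee_fin fineK//.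
rewrite /series/= -sumEFin /S.
by apply: nneseries_lim_ge => k _.
Qed.

End laws.

(** * The iterates stay in the box *)

Ltac split_minmax := repeat match goal with
  | |- context [Order.max ?x ?y] => lazymatch x with
      | context [Order.max _ _] => fail | context [Order.min _ _] => fail
      | _ => have [?|?] := leP x y end
  | |- context [Order.min ?x ?y] => lazymatch x with
      | context [Order.max _ _] => fail | context [Order.min _ _] => fail
      | _ => have [?|?] := leP x y end
  end.

Lemma clip_sqr (R : realType) (x y l h : R) : l <= y <= h ->
  (Num.min (Num.max x l) h - y) ^+ 2 <= (x - y) ^+ 2.
Proof.
move=> /andP[ly yh].
rewrite -[leLHS]real_normK ?num_real// -[leRHS]real_normK ?num_real//.
rewrite lerXn2r ?nnegrE// ler_norml.
have h1 := ler_norm (x - y); have h2 := ler_norm (- (x - y)).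
rewrite normrN in h2; have h3 := normr_ge0 (x - y).
by split_minmax; apply/andP; split; lra.
Qed.

Section algorithm.
Context {R : realType} {d : measure_display} {T : measurableType d}
  {P : probability T R} {dS : measure_display} {St : measurableType dS} {N : nat}.
Variables (p : params R) (W : inputs P St N)
  (u : 'I_N -> 'rV[R]_N -> {ffun 'I_N -> bool} -> St -> R)
  (lo hi astar : 'rV[R]_N)
  (dF : 'rV[R]_N -> 'rV[R]_N) (d2F : 'rV[R]_N -> 'M[R]_N)
  (dG : {ffun 'I_N -> bool} -> 'rV[R]_N -> 'rV[R]_N)
  (d2G : {ffun 'I_N -> bool} -> 'rV[R]_N -> 'M[R]_N)
  (a : nat -> T -> 'rV[R]_N).
Hypotheses (pok : params_ok p) (law : inputs_law W p)
  (uok : utilities_ok W u lo hi)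
  (reg : regularity W p u lo hi astar dF d2F dG d2G)
  (alg : dosp_s W p u lo hi a).
Variable Lip : St -> R.
Hypotheses (Lip_measurable : measurable_fun setT Lip)
  (Lip_moment : (\int[P]_w ((Lip (env W 0%N w)) ^+ 2)%:E < +oo)%E)
  (Lip_le : forall i v v' dl s, box lo hi v -> box lo hi v' ->
     `|u i v dl s - u i v' dl s| <= Lip s * euclid (masked (v - v') dl)).

Local Notation B0 := (box lo hi).
Local Notation act := (active W).
Local Notation tg := (tgamma W p).
Local Notation tb := (tbeta W p).
Local Notation Phi := (pert W).
Local Notation known_from := (known W (fun i w => a 0%N w 0 i)).
Implicit Types (D : set (source N)) (t : nat) (w : T) (i j : 'I_N).
Implicit Types (dl : {ffun 'I_N -> bool}) (v : 'rV[R]_N).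

Let lohi i : lo 0 i < hi 0 i.
Proof. by have /andP[h1 h2] := astar_interior reg i; exact: lt_trans h2. Qed.

Let astar_box : B0 astar.
Proof. by move=> i; have /andP[h1 h2] := astar_interior reg i; rewrite !ltW. Qed.

Lemma tgammaE i t w : tg i t w = (act i t w)%:R * gamma p (counter W i t w).+1.
Proof. by rewrite /tgamma /step; case: (act i t w); rewrite ?mul1r ?mul0r ?addn1. Qed.

Lemma tbetaE i t w : tb i t w = (act i t w)%:R * beta p (counter W i t w).+1.
Proof. by rewrite /tbeta /step; case: (act i t w); rewrite ?mul1r ?mul0r ?addn1. Qed.

Definition bstep i t w := beta p (counter W i t w).+1.

Lemma tbeta_ge0 i t w : 0 <= tb i t w.
Proof. by rewrite tbetaE mulr_ge0 ?beta_ge0. Qed.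

Lemma tgamma_ge0 i t w : 0 <= tg i t w.
Proof. by rewrite tgammaE mulr_ge0 ?gamma_ge0. Qed.

Lemma tbeta_le i t w : tb i t w <= bstep i t w.
Proof.
by rewrite tbetaE; case: (act i t w); rewrite ?mul1r// mul0r beta_ge0.
Qed.

Lemma tgamma_le i t w : tg i t w <= gamma0 p.
Proof.
rewrite tgammaE; case: (act i t w); rewrite ?mul1r ?gamma_le// mul0r.
exact/ltW/gamma0_gt0.
Qed.

(** Some outcome has node i active with counter 0 in the first slot, so the range of
    the initial action shows that the largest perturbation fits into half of the
    interval of node i; later step sizes are smaller. *)
Lemma tgamma_small i t w : alpha_Phi p * tg i t w <= (hi 0 i - lo 0 i) / 2.
Proof.
have aP := alpha_Phi_gt0 pok.
have h1 : alpha_Phi p * gamma p 1 <= (hi 0 i - lo 0 i) / 2.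
  have [w' [aw cw]] : exists w', act i 0%N w' /\ counter W i 0%N w' = 0%N.
    have mA : measurable (act i 0%N @^-1` [set true]).
      rewrite -[X in measurable X]setTI; exact: measurable_funP.
    have mC : measurable (counter W i 0%N @^-1` [set 0%N]).
      rewrite -[X in measurable X]setTI; exact: measurable_funP.
    apply: contrapT => nex.
    have sub : act i 0%N @^-1` [set true] `<=` ~` (counter W i 0%N @^-1` [set 0%N]).
      by move=> w' aw cw; apply: nex; exists w'.
    have : (P (act i 0%N @^-1` [set true]) <= P (~` (counter W i 0%N @^-1` [set 0%N])))%E.
      by apply: le_measure => //; rewrite inE//; exact: measurableC.
    rewrite probability_setC// (active_law law) (count_law law).
    have /andP[q0 q1] := qa_range pok.
    have -> : binomial_prob 0 (qa p) [set 0%N] = 1%E.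
      rewrite (@binomial_probE R 0 (qa p) (ltW q0) q1) big_ord1 diracE mem_set//.
      by rewrite mule1 /= expr0 mulr1n mulr1.
    by rewrite subee// leNgt lte_fin q0.
  have := init_range alg i w'; rewrite /tgamma /step aw cw /= => /andP[h1 h2].
  have := le_trans h1 h2; lra.
rewrite tgammaE; case: (act i t w); rewrite ?mul1r ?mul0r ?mulr0.
  by apply: le_trans h1; rewrite ler_pM2l// gamma_antitone.
by rewrite divr_ge0// subr_ge0 ltW.
Qed.

Lemma action_range i t w : lo 0 i + alpha_Phi p * tg i t w <= a t w 0 i
  <= hi 0 i - alpha_Phi p * tg i t w.
Proof.
case: t => [|t]; first exact: init_range alg i w.
rewrite (projected_update alg); have := tgamma_small i t.+1 w => h.
rewrite ge_min lexx orbT andbT le_min le_max lexx orbT/=; lra.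
Qed.

Lemma pert_tgamma i t w : `|tg i t w * Phi i t w| <= alpha_Phi p * tg i t w.
Proof.
rewrite normrM (ger0_norm (tgamma_ge0 i t w)) mulrC ler_wpM2r ?tgamma_ge0//.
exact: pert_bound law i t w.
Qed.

Lemma action_box t w : B0 (a t w).
Proof.
move=> i; have /andP[h1 h2] := action_range i t w.
have : 0 <= alpha_Phi p * tg i t w by rewrite mulr_ge0 ?tgamma_ge0// ltW// (alpha_Phi_gt0 pok).
by move=> h; apply/andP; split; lra.
Qed.

Lemma performed_box t w : B0 (performed W p a t w).
Proof.
move=> i; rewrite mxE; have /andP[h1 h2] := action_range i t w.
have := pert_tgamma i t w; rewrite ler_norml => /andP[h3 h4].
by apply/andP; split; lra.
Qed.

(** Close to the performed action, but independent of the perturbation of node i. *)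
Definition unperturbed i t w : 'rV[R]_N :=
  \row_j (if j == i then a t w 0 j else performed W p a t w 0 j).

Lemma unperturbed_box i t w : B0 (unperturbed i t w).
Proof.
by move=> j; rewrite mxE; case: eqP => _; [exact: action_box|exact: performed_box].
Qed.

Definition move i t w := tb i t w * Phi i t w * tf W p u a i t w.

(** The updated action, clipped to the box only.  The next action also depends on the
    activity and the counter of the next slot, through its projection interval; the
    target does not, and differs from it by at most the size of a perturbation. *)
Definition target t w : 'rV[R]_N :=
  \row_i Num.min (Num.max (a t w 0 i + move i t w) (lo 0 i)) (hi 0 i).

Lemma target_box t w : B0 (target t w).
Proof.
move=> i; rewrite mxE; have h := lohi i.
by rewrite ge_min lexx orbT andbT le_min le_max lexx orbT/= ltW.
Qed.

Lemma action_target i t w : a t.+1 w 0 i =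
  Num.min (Num.max (target t w 0 i) (lo 0 i + alpha_Phi p * tg i t.+1 w))
    (hi 0 i - alpha_Phi p * tg i t.+1 w).
Proof.
rewrite (projected_update alg) mxE -/(move i t w).
have h0 : 0 <= alpha_Phi p * tg i t.+1 w.
  by rewrite mulr_ge0 ?tgamma_ge0// ltW// (alpha_Phi_gt0 pok).
have h1 := tgamma_small i t.+1 w; have h2 := lohi i.
move: (alpha_Phi p * _) h0 h1 => g h0 h1; move: (a t w 0 i + move i t w) => x.
by split_minmax; lra.
Qed.

Lemma action_target_close i t w : `|a t.+1 w 0 i - target t w 0 i| <= alpha_Phi p * tg i t.+1 w.
Proof.
rewrite action_target; have /andP[t1 t2] := target_box t w i.
have h0 : 0 <= alpha_Phi p * tg i t.+1 w.
  by rewrite mulr_ge0 ?tgamma_ge0// ltW// (alpha_Phi_gt0 pok).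
have h1 := tgamma_small i t.+1 w; have h2 := lohi i.
move: (alpha_Phi p * _) h0 h1 => g h0 h1; move: (target t w 0 i) t1 t2 => x t1 t2.
by rewrite ler_norml; split_minmax; apply/andP; split; lra.
Qed.

(** Once the projection intervals contain the optimum, projecting does not move
    the action away from it. *)
Lemma action_target_sqr i t w :
  lo 0 i + alpha_Phi p * tg i t.+1 w <= astar 0 i <= hi 0 i - alpha_Phi p * tg i t.+1 w ->
  (a t.+1 w 0 i - astar 0 i) ^+ 2 <= (target t w 0 i - astar 0 i) ^+ 2.
Proof.
by move=> h; rewrite action_target; exact: clip_sqr.
Qed.

Lemma target_sqr i t w : (target t w 0 i - astar 0 i) ^+ 2 <=
  (a t w 0 i + move i t w - astar 0 i) ^+ 2.
Proof.
by rewrite mxE; apply: clip_sqr; exact: astar_box.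
Qed.

(** * Measurability of the iterates *)

Definition slot (s : source N) : nat :=
  match s with
  | SrcActive _ t => t | SrcCount _ t => t | SrcPert _ t => t
  | SrcNoise _ t => t | SrcEnv t => t | SrcRecv t => t
  end.

Definition before t : set (source N) := [set s | (slot s < t)%N].

Lemma activity_split t (h : {ffun 'I_N -> bool} -> T -> R) w :
  h (activity W t w) w = \sum_dl (activity W t w == dl)%:R * h dl w.
Proof.
rewrite (bigD1 (activity W t w))//= eqxx mul1r big1 ?addr0// => dl hdl.
by rewrite eq_sym (negbTE hdl) mul0r.
Qed.

Lemma utility_lipschitz_sum i v v' dl s : B0 v -> B0 v' ->
  `|u i v' dl s - u i v dl s| <= `|Lip s| * \sum_j `|v' 0 j - v 0 j|.
Proof.
move=> Bv Bv'; apply: le_trans (Lip_le i dl s Bv' Bv) _.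
apply: (@le_trans _ _ (`|Lip s| * euclid (masked (v' - v) dl))).
  by rewrite ler_wpM2r ?euclid_ge0// ler_norm.
rewrite ler_wpM2l//; apply: le_trans (euclid_le _) _; apply: ler_sum => j _.
by rewrite !mxE; case: (dl j); rewrite ?mulr1// mulr0 normr0.
Qed.

Lemma utility_cont_on i dl s : cont_on B0 (fun v => u i v dl s).
Proof. by apply: (@lipschitz_cont_on _ _ _ _ `|Lip s|) => v v'; exact: utility_lipschitz_sum. Qed.

Section adaptedness.
Variable G0 : set_system T.

Record slot_adapted t : Prop := SlotAdapted {
  slot_active : forall i, adapted G0 (act i t);
  slot_count : forall i, adapted G0 (counter W i t);
  slot_pert : forall i, adapted G0 (Phi i t);
  slot_noise : forall i, adapted G0 (noise W i t);
  slot_env : adapted G0 (env W t);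
  slot_recv : forall i j, adapted G0 (recv W i j t) }.

Lemma bstep_adapted i t : adapted G0 (counter W i t) -> adapted G0 (bstep i t).
Proof. by move=> h; apply: (adapted_comp (h := fun k => beta p k.+1)) h. Qed.

Lemma tbeta_adapted i t : adapted G0 (act i t) -> adapted G0 (counter W i t) ->
  adapted G0 (tb i t).
Proof.
move=> ha hc; rewrite (funext (tbetaE i t)); apply: adaptedM; first exact: adapted_natr.
exact: bstep_adapted.
Qed.

Lemma tgamma_adapted i t : adapted G0 (act i t) -> adapted G0 (counter W i t) ->
  adapted G0 (tg i t).
Proof.
move=> ha hc; rewrite (funext (tgammaE i t)); apply: adaptedM; first exact: adapted_natr.
by apply: (adapted_comp (h := fun k => gamma p k.+1)) hc.
Qed.

Lemma activity_adapted t dl : (forall i, adapted G0 (act i t)) ->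
  adapted G0 (fun w => activity W t w == dl).
Proof.
move=> ha.
suff h (r : seq 'I_N) : adapted G0 (fun w => all (fun i => act i t w == dl i) r).
  have := h (enum 'I_N); congr adapted; apply/funext => w.
  apply/allP/eqP => [hw|<- i _]; last by rewrite ffunE.
  by apply/ffunP => i; rewrite ffunE; apply/eqP/hw; rewrite mem_enum.
elim: r => [|i r IH] /=; first exact: adapted_cst.
apply: adapted_and => //; exact: (adapted_comp (h := fun b => b == dl i)).
Qed.

Lemma at_activity_adapted t (h : {ffun 'I_N -> bool} -> T -> R) :
  (forall i, adapted G0 (act i t)) -> (forall dl, adapted G0 (h dl)) ->
  adapted G0 (fun w => h (activity W t w) w).
Proof.
move=> ha hh; rewrite (funext (activity_split t h)); apply: adapted_sum => dl.
by apply: adaptedM => //; exact/adapted_natr/activity_adapted.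
Qed.

Lemma utility_adapted j t (b : T -> 'rV[R]_N) :
  (forall i, adapted G0 (act i t)) -> adapted G0 (env W t) ->
  (forall i, adapted G0 (fun w => b w 0 i)) -> (forall w, B0 (b w)) ->
  adapted G0 (fun w => u j (b w) (activity W t w) (env W t w)).
Proof.
move=> ha he hb Bb.
apply: (at_activity_adapted (h := fun dl w => u j (b w) dl (env W t w))) => // dl.
apply: (caratheodory_adapted lohi (f := fun v w => u j v dl (env W t w))) => //.
- by move=> v Bv; apply: adapted_comp he; exact: (utility_measurable uok).
- by move=> w; exact: utility_cont_on.
Qed.

Lemma performed_adapted t i : adapted G0 (fun w => a t w 0 i) ->
  adapted G0 (act i t) -> adapted G0 (counter W i t) -> adapted G0 (Phi i t) ->
  adapted G0 (fun w => performed W p a t w 0 i).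
Proof.
move=> h1 h2 h3 h4; under eq_fun do rewrite mxE.
by apply: adaptedD => //; apply: adaptedM => //; exact: tgamma_adapted.
Qed.

Lemma tu_adapted t j : slot_adapted t -> (forall i, adapted G0 (fun w => a t w 0 i)) ->
  adapted G0 (tu W p u a j t).
Proof.
move=> [ha hc hp hn he hr] hA; apply: adaptedD => //; apply: utility_adapted => //.
  by move=> i; exact: performed_adapted.
by move=> w; exact: performed_box.
Qed.

Lemma move_adapted t i : slot_adapted t -> (forall i, adapted G0 (fun w => a t w 0 i)) ->
  adapted G0 (move i t).
Proof.
move=> hs hA; have [ha hc hp hn he hr] := hs.
apply: adaptedM; first by apply: adaptedM => //; exact: tbeta_adapted.
have -> : tf W p u a i t = (fun w => tu W p u a i t w + (qr p)^-1 *
    \sum_j (act j t w && (j != i) && recv W i j t w)%:R * tu W p u a j t w).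
  apply/funext => w; rewrite /tf; congr (_ + _ * _).
  rewrite big_mkcond; apply: eq_bigr => j _; rewrite inE -andbA.
  by case: ifP; rewrite ?mul1r ?mul0r.
apply: adaptedD; first exact: tu_adapted.
apply: adaptedM; first exact: adapted_cst.
apply: adapted_sum => j; apply: adaptedM; last exact: tu_adapted.
by apply: adapted_natr; apply: adapted_and => //; apply: adapted_and.
Qed.

Lemma target_adapted t i : slot_adapted t -> (forall i, adapted G0 (fun w => a t w 0 i)) ->
  adapted G0 (fun w => target t w 0 i).
Proof.
move=> hs hA; under eq_fun do rewrite mxE.
apply: adapted_min; last exact: adapted_cst.
apply: adapted_max; last exact: adapted_cst.
by apply: adaptedD => //; exact: move_adapted.
Qed.

Lemma next_action_adapted t i : adapted G0 (fun w => target t w 0 i) ->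
  adapted G0 (act i t.+1) -> adapted G0 (counter W i t.+1) ->
  adapted G0 (fun w => a t.+1 w 0 i).
Proof.
move=> hT ha hc; rewrite (funext (action_target i t)).
have hg : adapted G0 (fun w => alpha_Phi p * tg i t.+1 w).
  by apply: adaptedM; [exact: adapted_cst|exact: tgamma_adapted].
apply: adapted_min; last by apply: adaptedB => //; exact: adapted_cst.
by apply: adapted_max => //; apply: adaptedD => //; exact: adapted_cst.
Qed.

End adaptedness.

Lemma source_known D s d' (E : measurableType d') (X : T -> E) :
  D s -> events X `<=` source_events W s -> adapted (known_from D) X.
Proof.
move=> Ds Xs; apply: events_adapted => A hA; apply: sub_gen_smallest; right.
by exists s => //; exact: Xs.
Qed.

Lemma source_fresh D s d' (E : measurableType d') (X : T -> E) :
  D s -> events X `<=` source_events W s -> adapted (fresh W D) X.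
Proof.
move=> Ds Xs; apply: events_adapted => A hA; apply: sub_gen_smallest.
by exists s => //; exact: Xs.
Qed.

Lemma recv_events i j t : events (recv W i j t) `<=` source_events W (SrcRecv t).
Proof. by move=> A hA; apply: sub_gen_smallest; exists (i, j). Qed.

Lemma known_sub D D' : D `<=` D' -> known_from D `<=` <<s known_from D' >>.
Proof.
move=> DD A [hA|[s Ds hA]]; apply: sub_gen_smallest; first by left.
by right; exists s => //; exact: DD.
Qed.

Lemma known_slot D t : (forall s, slot s = t -> D s) -> slot_adapted (known_from D) t.
Proof.
move=> h; split.
- by move=> i; apply: (source_known (s := SrcActive i t)) => //; exact: h.
- by move=> i; apply: (source_known (s := SrcCount i t)) => //; exact: h.
- by move=> i; apply: (source_known (s := SrcPert i t)) => //; exact: h.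
- by move=> i; apply: (source_known (s := SrcNoise i t)) => //; exact: h.
- by apply: (source_known (s := SrcEnv t)) => //; exact: h.
- by move=> i j; apply: (source_known (s := SrcRecv t)); [exact: h|exact: recv_events].
Qed.

(** By induction: the action of a slot is a function of the preceding target and of
    the activities and counters of the slot. *)
Lemma target_known D t i : before t.+1 `<=` D ->
  adapted (known_from D) (fun w => target t w 0 i).
Proof.
elim: t i => [|t IH] i hD.
  apply: target_adapted => [|j].
    by apply: known_slot => s st; apply: hD; rewrite /before/= st.
  apply: events_adapted => A hA; apply: sub_gen_smallest; left; exists j => //; left.
  exact: hA.
have hs : slot_adapted (known_from D) t.+1.
  by apply: known_slot => s st; apply: hD; rewrite /before/= st.
apply: target_adapted => // j; apply: next_action_adapted.
- by apply: IH => s; rewrite /before/= => st; apply: hD; exact: ltnW.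
- exact: slot_active hs j.
- exact: slot_count hs j.
Qed.

(** The projection interval is the reason why the past alone does not determine the
    action. *)
Lemma action_known D t i : before t.+1 `<=` D -> D (SrcActive i t.+1) ->
  D (SrcCount i t.+1) -> adapted (known_from D) (fun w => a t.+1 w 0 i).
Proof.
move=> hD ha hc; apply: next_action_adapted; first exact: target_known.
- exact: source_known ha _.
- exact: source_known hc _.
Qed.

(** * Sums of centered terms *)

Definition diameter : R := \sum_i (hi 0 i - lo 0 i).

Lemma diameter_ge0 : 0 <= diameter.
Proof. by apply: sumr_ge0 => i _; rewrite subr_ge0 ltW. Qed.

Lemma dist_le_diameter v v' : B0 v -> B0 v' -> \sum_j `|v' 0 j - v 0 j| <= diameter.
Proof.
move=> Bv Bv'; apply: ler_sum => i _; rewrite ler_norml.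
have /andP[? ?] := Bv i; have /andP[? ?] := Bv' i; apply/andP; split; lra.
Qed.

Lemma coord_le_diameter v v' i : B0 v -> B0 v' -> `|v' 0 i - v 0 i| <= diameter.
Proof.
move=> Bv Bv'; apply: le_trans (dist_le_diameter Bv Bv').
by rewrite (bigD1 i)//= lerDl sumr_ge0.
Qed.

(** By the Lipschitz condition, the values at the optimum control those on the whole
    box. *)
Definition utility_bound (s : St) : R :=
  `|Lip s| * diameter + \sum_i \sum_dl `|u i astar dl s|.

Lemma utility_le i v dl s : B0 v -> `|u i v dl s| <= utility_bound s.
Proof.
move=> Bv; have h := utility_lipschitz_sum i dl s astar_box Bv.
have := ler_normD (u i v dl s - u i astar dl s) (u i astar dl s); rewrite subrK => /le_trans; apply.
apply: lerD.
  by apply: le_trans h _; rewrite ler_wpM2l// dist_le_diameter.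
rewrite (bigD1 i)//= (bigD1 dl)//= -addrA lerDl addr_ge0 ?sumr_ge0// => j _.
by rewrite sumr_ge0.
Qed.

Lemma utility_bound_ge0 s : 0 <= utility_bound s.
Proof.
rewrite addr_ge0 ?mulr_ge0 ?diameter_ge0// sumr_ge0// => i _.
by rewrite sumr_ge0.
Qed.

Lemma utility_bound_measurable : measurable_fun setT utility_bound.
Proof.
apply: measurable_funD.
  apply: measurable_funM; last exact: measurable_cst.
  exact: measurableT_comp.
apply: measurable_sum => i; apply: measurable_sum => dl.
by apply: measurableT_comp => //; exact: (utility_measurable uok).
Qed.

(** A square-integrable bound on all that is observed in slot t, independent of the
    counters and hence of the step sizes. *)
Definition magnitude t w : R :=
  1 + utility_bound (env W t w) + \sum_j `|noise W j t w|.

Lemma magnitude_ge1 t w : 1 <= magnitude t w.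
Proof.
by rewrite /magnitude -addrA lerDl addr_ge0 ?utility_bound_ge0// sumr_ge0.
Qed.

Lemma magnitude_ge0 t w : 0 <= magnitude t w.
Proof. exact: le_trans (magnitude_ge1 t w). Qed.

Lemma utility_bound_magnitude t w : utility_bound (env W t w) <= magnitude t w.
Proof. by rewrite /magnitude addrAC lerDr addr_ge0// sumr_ge0. Qed.

Lemma noise_magnitude j t w : `|noise W j t w| <= magnitude t w.
Proof.
rewrite /magnitude; apply: ler_wpDl; first by rewrite addr_ge0// utility_bound_ge0.
by rewrite (bigD1 j)//= lerDl sumr_ge0.
Qed.

Lemma observation_magnitude v dl j t w : B0 v ->
  `|u j v dl (env W t w) + noise W j t w| <= magnitude t w.
Proof.
move=> Bv; apply: le_trans (ler_normD _ _) _; rewrite /magnitude.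
apply: lerD.
  by apply: ler_wpDl => //; exact: utility_le.
by rewrite (bigD1 j)//= lerDl sumr_ge0.
Qed.

Let second_moment_of (X : T -> R) : measurable_fun setT X ->
  (\int[P]_w (X w ^+ 2)%:E < +oo)%E -> exists K, second_moment_le P X K.
Proof.
move=> mX iX; exists (\int[P]_w (X w ^+ 2)); split => //.
apply/integrableP; split; first by apply/measurable_EFinP; exact: measurable_funX.
by under eq_integral do rewrite /= ger0_norm ?sqr_ge0//.
Qed.

Lemma noise_second_moment j t : second_moment_le P (noise W j t) (sigma_eta p ^+ 2).
Proof.
have E : (\int[P]_w (noise W j t w ^+ 2)%:E = (sigma_eta p ^+ 2)%:E)%E.
  by have := noise_var law j t; rewrite unlock.
have [||K [h1 h2 h3]] := @second_moment_of (noise W j t); first exact: measurable_funP.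
  by rewrite E ltry.
by split => //; rewrite /Rintegral E.
Qed.

Lemma magnitude_second_moment : exists K, forall t, second_moment_le P (magnitude t) K.
Proof.
have mU t : measurable_fun setT (fun w => utility_bound (env W t w)).
  by apply: measurableT_comp; [exact: utility_bound_measurable|exact: measurable_funP].
have [KU [_ iU hU]] : exists K, second_moment_le P (fun w => utility_bound (env W 0%N w)) K.
  have [|//|KL hL] := @second_moment_of (fun w => Lip (env W 0%N w)).
    by apply: measurableT_comp => //; exact: measurable_funP.
  have hu (i : 'I_N) dl : exists K, second_moment_le P (fun w => `|u i astar dl (env W 0%N w)|) K.
    have [||K hK] := @second_moment_of (fun w => u i astar dl (env W 0%N w)).
    - apply: measurableT_comp; last exact: measurable_funP.
      exact: (utility_measurable uok).
    - exact: (utility_moment uok).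
    by exists K; exact: second_moment_norm.
  have [Ku hKu] := @choice _ _ (fun (x : 'I_N * {ffun 'I_N -> bool}) K =>
    second_moment_le P (fun w => `|u x.1 astar x.2 (env W 0%N w)|) K) (fun x => hu x.1 x.2).
  have [L1 h1] := second_moment_sum P (index_enum _) Ku.
  have := h1 _ hKu => h2.
  exists (2 * (diameter ^+ 2 * KL + L1)).
  have := second_momentD (second_momentZ diameter (second_moment_norm hL)) h2.
  congr second_moment_le; apply/funext => w; rewrite /utility_bound mulrC; congr (_ + _).
  by rewrite pair_bigA.
have [L2 hL2] := second_moment_sum P (index_enum 'I_N) (fun=> sigma_eta p ^+ 2).
exists (2 * (2 * (1 ^+ 2 + KU) + L2)) => t.
apply: second_momentD; last first.
  by apply: hL2 => j; apply: second_moment_norm; exact: noise_second_moment.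
apply: second_momentD; first exact: second_moment_cst.
have mU2 : measurable_fun setT (fun s => utility_bound s ^+ 2).
  by apply: measurable_funX; exact: utility_bound_measurable.
have [h1 h2] := identically_distributed_integrableR (env_law law 0 t) mU2 iU.
by split => //; rewrite h2.
Qed.

Lemma bstep_ge0 i t w : 0 <= bstep i t w. Proof. exact: beta_ge0. Qed.

Lemma bstep_le i t w : bstep i t w <= beta0 p. Proof. exact: beta_le. Qed.

Lemma bstep_sqr i t : integrableR P (fun w => bstep i t w ^+ 2) /\
  \int[P]_w (bstep i t w ^+ 2) = beta_sqr_mean p t.
Proof.
apply: (binomial_expectation (qa_range pok) (count_law law i t) (g := fun k => beta p k.+1 ^+ 2)).
by move=> k; exact: sqr_ge0.
Qed.

Let initE : independent_sigma P (initial W (fun i w => a 0%N w 0 i))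
  (\bigcup_(s in [set s | forall i, s <> SrcActive i 0]) source_events W s).
Proof. exact: (init_independent alg). Qed.

Lemma known_from_measurable D : known_from D `<=` measurable.
Proof. by apply: known_measurable => i; exact: (init_measurable alg). Qed.

Lemma expectation_known_fresh D (U V : T -> R) : (forall i, ~ D (SrcActive i 0)) ->
  adapted (known_from (~` D)) U -> adapted (fresh W D) V ->
  integrableR P U -> integrableR P V ->
  integrableR P (fun w => U w * V w) /\
  \int[P]_w (U w * V w) = (\int[P]_w U w) * \int[P]_w V w.
Proof.
move=> D0; apply: independent_mul_expectation.
- exact: known_from_measurable.
- exact: fresh_measurable.
- exact: (known_fresh_independent law (fun i => init_measurable alg i) initE D0).
Qed.

Lemma step_magnitude_second_moment K i t : second_moment_le P (magnitude t) K ->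
  second_moment_le P (fun w => bstep i t w * magnitude t w) (beta_sqr_mean p t * K).
Proof.
move=> [mM iM KM]; have [ib Eb] := bstep_sqr i t.
pose D : set (source N) := [set s | s = SrcEnv t \/ exists j, s = SrcNoise j t].
have D0 j : ~ D (SrcActive j 0) by case=> [//|[? //]].
have ab : adapted (known_from (~` D)) (bstep i t).
  apply: bstep_adapted; apply: (source_known (s := SrcCount i t)) => //.
  by case=> [//|[? //]].
have aM : adapted (fresh W D) (magnitude t).
  apply: adaptedD; last first.
    apply: adapted_sum => j; apply: (adapted_comp (h := fun x : R => `|x|)) => //.
    by apply: (source_fresh (s := SrcNoise j t)) => //; right; exists j.
  apply: adaptedD; first exact: adapted_cst.
  apply: (adapted_comp utility_bound_measurable).
  by apply: (source_fresh (s := SrcEnv t)) => //; left.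
have ab2 : adapted (known_from (~` D)) (fun w => bstep i t w ^+ 2) by exact: adaptedM.
have aM2 : adapted (fresh W D) (fun w => magnitude t w ^+ 2) by exact: adaptedM.
have [iP EP] := expectation_known_fresh D0 ab2 aM2 ib iM.
have E : (fun w => (bstep i t w * magnitude t w) ^+ 2) =
    (fun w => bstep i t w ^+ 2 * magnitude t w ^+ 2).
  by apply/funext => w; rewrite exprMn.
split; rewrite ?E//.
  apply: measurable_funM => //.
  exact: adapted_measurable (@known_from_measurable _) ab.
by rewrite EP Eb ler_wpM2l// beta_sqr_mean_ge0.
Qed.

Let cvg_beta_sqr_shift c : cvgn (series (fun t => c * beta_sqr_mean p t.+1)).
Proof.
apply: (is_cvg_seriesZ (k := c) (f := fun t => beta_sqr_mean p t.+1)).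
have /cvg_ex[l hl] := cvg_series_beta_sqr_mean pok.
apply/cvg_ex; exists (l - beta_sqr_mean p 0).
have -> : series (fun t => beta_sqr_mean p t.+1) =
    (fun n => series (beta_sqr_mean p) n.+1 - beta_sqr_mean p 0).
  by apply/funext => n; rewrite /series/= big_nat_recl//= [RHS]addrC addKr.
by apply: cvgB; [rewrite cvg_shiftS|exact: cvg_cst].
Qed.

(** The form of all terms below: a random step size times an observation, up to a
    multiple of the mean gain rho left over by centering. *)
Definition dominated (X : nat -> T -> R) (C : R) i := forall t w,
  `|X t w| <= C * (bstep i t.+1 w * magnitude t.+1 w + rho p t.+1).

Lemma dominated_second_moment (X : nat -> T -> R) C i :
  (forall t, measurable_fun setT (X t)) -> dominated X C i ->
  exists c, forall t, second_moment_le P (X t) (c * beta_sqr_mean p t.+1).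
Proof.
move=> mX XC; have [K hK] := magnitude_second_moment.
exists (C ^+ 2 * (2 * (K + gamma0 p ^+ 2))) => t.
have h := second_momentZ C (second_momentD (step_magnitude_second_moment i (hK t.+1))
  (second_moment_cst P (rho p t.+1))).
have [h1 h2 h3] := second_moment_le_dom (mX t) (XC t) h.
split => //; apply: le_trans h3 _.
have le1 : beta_sqr_mean p t.+1 * K + rho p t.+1 ^+ 2 <=
    (K + gamma0 p ^+ 2) * beta_sqr_mean p t.+1.
  by rewrite mulrDl [leLHS]addrC [leRHS]addrC mulrC lerD ?rho_sqr_le// mulrC.
have -> : C ^+ 2 * (2 * (K + gamma0 p ^+ 2)) * beta_sqr_mean p t.+1 =
    C ^+ 2 * (2 * ((K + gamma0 p ^+ 2) * beta_sqr_mean p t.+1)) by ring.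
by rewrite ler_wpM2l ?sqr_ge0// ler_wpM2l.
Qed.

(** Second moments of dominated sequences are at most multiples of those of the step
    sizes beta, which are summable. *)
Lemma dominated_sqr_cvg (X : nat -> T -> R) C i :
  (forall t, measurable_fun setT (X t)) -> dominated X C i ->
  {ae P, forall w, cvgn (series (fun t => X t w ^+ 2))}.
Proof.
move=> mX XC; have [c hc] := dominated_second_moment mX XC.
apply: (expectation_series_cvg (X := fun t w => X t w ^+ 2)
  (v := fun t => c * beta_sqr_mean p t.+1)) => //.
- by move=> t; have [_ h _] := hc t.
- by move=> t w; exact: sqr_ge0.
- by move=> t; have [_ _ h] := hc t.
Qed.

(** The second moments are summable, so martingale convergence applies. *)
Lemma centered_cvg (X : nat -> T -> R) C i :
  (forall t, adapted (known_from (before t.+2)) (X t)) -> dominated X C i ->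
  (forall t (Z : T -> R) c, adapted (known_from (before t.+1)) Z ->
    (forall w, `|Z w| <= c) -> \int[P]_w (X t w * Z w) = 0) ->
  {ae P, forall w, cvgn (series (X ^~ w))}.
Proof.
move=> aX XC oX.
have mX t : measurable_fun setT (X t).
  exact: adapted_measurable (@known_from_measurable _) (aX t).
have [c hc] := dominated_second_moment mX XC.
apply: (martingale_cvg (F := fun t => known_from (before t.+1))
  (v := fun t => c * beta_sqr_mean p t.+1)) => //.
split => //.
- by move=> t; exact: known_from_measurable.
- by move=> t; apply: known_sub => s; exact: ltnW.
- by move=> t; have [_ h _] := hc t.
- by move=> t; have [_ _ h] := hc t.
Qed.

(** V t is drawn from the sources D t of slot t + 1 and is independent of U t and of
    the past, so the product inherits from V t that it vanishes given the past. *)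
Lemma product_centered_cvg (D : nat -> set (source N)) (U V : nat -> T -> R) C i :
  (forall t s, D t s -> slot s = t.+1) ->
  (forall t, adapted (known_from (before t.+2 `\` D t)) (U t)) ->
  (forall t, adapted (fresh W (D t)) (V t)) ->
  (forall t, integrableR P (U t)) -> (forall t, integrableR P (V t)) ->
  (forall t, \int[P]_w V t w = 0) ->
  dominated (fun t w => U t w * V t w) C i ->
  {ae P, forall w, cvgn (series (fun t => U t w * V t w))}.
Proof.
move=> Dslot aU aV iU iV V0 XC.
apply: (centered_cvg (X := fun t w => U t w * V t w) _ XC) => [t|t Z c aZ Zc].
  apply: adaptedM; first by apply: adapted_sub (aU t); apply: known_sub => s [].
  apply: adapted_sub (aV t) => A [s Ds hA]; apply: sub_gen_smallest; right.
  by exists s => //; rewrite /before/= (Dslot _ _ Ds).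
have D0 j : ~ D t (SrcActive j 0) by move/Dslot.
have aU' : adapted (known_from (~` D t)) (U t).
  by apply: adapted_sub (aU t); apply: known_sub => s [].
have aZ' : adapted (known_from (~` D t)) Z.
  apply: adapted_sub aZ; apply: known_sub => s; rewrite /before/= => st Ds.
  by rewrite (Dslot _ _ Ds) ltnn in st.
have iUZ : integrableR P (fun w => U t w * Z w).
  have m : measurable_fun setT (fun w => U t w * Z w).
    exact: adapted_measurable (@known_from_measurable _) (adaptedM aU' aZ').
  apply: (integrableR_le m _ (integrableRZ c (iU t))) => w.
  rewrite !normrM mulrC ler_wpM2r//; apply: le_trans (Zc w) _; exact: ler_norm.
have [_ E] := expectation_known_fresh D0 (adaptedM aU' aZ') (aV t) iUZ (iV t).
have -> : (fun w => U t w * V t w * Z w) = (fun w => U t w * Z w * V t w).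
  by apply/funext => w; rewrite mulrAC.
by rewrite E V0 mulr0.
Qed.

(** * The centered terms of an update *)

Definition offset i t w := a t w 0 i - astar 0 i.

(** The update of node i is driven by its estimate of the global utility; this is the
    coefficient of that estimate in the scalar product of the update with the
    offset from the optimum. *)
Definition gain i t w := tb i t w * Phi i t w * offset i t w.

(** The weight that node i gives to the observation of an active node j; its mean is
    1 whatever j. *)
Definition weight i j t w : R := if j == i then 1 else (qr p)^-1 * (recv W i j t w)%:R.

Definition utility j t w := u j (performed W p a t w) (activity W t w) (env W t w).

Let aP_ge0 : 0 <= alpha_Phi p. Proof. exact/ltW/alpha_Phi_gt0. Qed.

Let qr_gt0 : 0 < qr p. Proof. by have /andP[] := qr_range pok. Qed.

Lemma offset_le i t w : `|offset i t w| <= diameter.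
Proof. exact: coord_le_diameter astar_box (action_box t w). Qed.

Lemma tbeta_pert_le i t w : `|tb i t w * Phi i t w| <= bstep i t w * alpha_Phi p.
Proof.
rewrite normrM (ger0_norm (tbeta_ge0 i t w)); apply: ler_pM => //.
- exact: tbeta_ge0.
- exact: tbeta_le.
- exact: pert_bound law i t w.
Qed.

Definition gain_bound := alpha_Phi p * diameter.

Lemma gain_bound_ge0 : 0 <= gain_bound.
Proof. by rewrite mulr_ge0// diameter_ge0. Qed.

Lemma gain_le i t w : `|gain i t w| <= bstep i t w * gain_bound.
Proof.
rewrite /gain normrM /gain_bound mulrA; apply: ler_pM => //.
- exact: tbeta_pert_le.
- exact: offset_le.
Qed.

Lemma gain_le_cst i t w : `|gain i t w| <= beta0 p * gain_bound.
Proof.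
apply: le_trans (gain_le i t w) _; rewrite ler_wpM2r ?gain_bound_ge0//; exact: bstep_le.
Qed.

Lemma weight_le i j t w : `|weight i j t w| <= 1 + (qr p)^-1.
Proof.
have q0 : 0 <= (qr p)^-1 by rewrite invr_ge0 ltW.
rewrite /weight; case: eqP => _; first by rewrite normr1 lerDl.
rewrite normrM (ger0_norm q0); apply: ler_wpDl => //.
by case: (recv W i j t w); rewrite ?normr1 ?mulr1// normr0 mulr0.
Qed.

Lemma dominated_intro (X : nat -> T -> R) C i : 0 <= C ->
  (forall t w, `|X t w| <= C * (bstep i t.+1 w * magnitude t.+1 w)) -> dominated X C i.
Proof.
move=> C0 h t w; apply: le_trans (h t w) _; rewrite ler_wpM2l// lerDl.
exact: rho_ge0.
Qed.

Section known_terms.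
Variables (D : set (source N)) (t : nat).
Hypothesis past : before t.+1 `<=` D.

Lemma known_tbeta i : D (SrcActive i t.+1) -> D (SrcCount i t.+1) ->
  adapted (known_from D) (tb i t.+1).
Proof.
move=> ha hc; apply: tbeta_adapted; [exact: source_known ha _|exact: source_known hc _].
Qed.

Lemma known_offset i : D (SrcActive i t.+1) -> D (SrcCount i t.+1) ->
  adapted (known_from D) (offset i t.+1).
Proof.
by move=> ha hc; apply: adaptedB; [exact: action_known|exact: adapted_cst].
Qed.

Lemma known_gain i : D (SrcActive i t.+1) -> D (SrcCount i t.+1) ->
  D (SrcPert i t.+1) -> adapted (known_from D) (gain i t.+1).
Proof.
move=> ha hc hp; apply: adaptedM; last exact: known_offset.
by apply: adaptedM; [exact: known_tbeta|exact: source_known hp _].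
Qed.

Lemma known_performed i : D (SrcActive i t.+1) -> D (SrcCount i t.+1) ->
  D (SrcPert i t.+1) -> adapted (known_from D) (fun w => performed W p a t.+1 w 0 i).
Proof.
move=> ha hc hp; apply: performed_adapted.
- exact: action_known.
- exact: source_known ha _.
- exact: source_known hc _.
- exact: source_known hp _.
Qed.

Lemma known_utility j : (forall i, D (SrcActive i t.+1)) ->
  (forall i, D (SrcCount i t.+1)) -> (forall i, D (SrcPert i t.+1)) ->
  D (SrcEnv t.+1) -> adapted (known_from D) (utility j t.+1).
Proof.
move=> ha hc hp he; apply: utility_adapted.
- by move=> i; exact: source_known (ha i) _.
- exact: source_known he _.
- by move=> i; exact: known_performed.
- exact: performed_box.
Qed.

End known_terms.

Lemma known_bounded_integrable D (X : T -> R) c : adapted (known_from D) X ->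
  (forall w, `|X w| <= c) -> integrableR P X.
Proof.
move=> aX Xc; apply: integrableR_bounded Xc.
exact: adapted_measurable (@known_from_measurable _) aX.
Qed.

Lemma before_split t D : (forall s, D s -> slot s = t.+1) ->
  before t.+1 `<=` before t.+2 `\` D.
Proof.
move=> Ds s st; split; first exact: ltnW.
by move=> /Ds st'; move: st; rewrite /before/= st' ltnn.
Qed.

(** The contribution of the observation noise of node j. *)
Definition noise_term i j t w :=
  (gain i t.+1 w * (weight i j t.+1 w * (act j t.+1 w)%:R)) * noise W j t.+1 w.

Lemma weight_known D t i j : D (SrcRecv t) -> adapted (known_from D) (weight i j t).
Proof.
move=> hr; rewrite /weight; case: eqP => _; first exact: adapted_cst.
apply: adaptedM; first exact: adapted_cst.
by apply: adapted_natr; apply: source_known hr _; exact: recv_events.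
Qed.

Lemma noise_term_cvg i j : {ae P, forall w, cvgn (series (noise_term i j ^~ w))}.
Proof.
pose D t : set (source N) := [set SrcNoise j t.+1].
have Dslot t s : D t s -> slot s = t.+1 by move=> ->.
have q0 : 0 <= 1 + (qr p)^-1 by rewrite addr_ge0// invr_ge0 ltW.
have aU t : adapted (known_from (before t.+2 `\` D t))
    (fun w => gain i t.+1 w * (weight i j t.+1 w * (act j t.+1 w)%:R)).
  have sub := before_split (@Dslot t).
  apply: adaptedM.
    by apply: known_gain => //; split => //=; rewrite /before/=.
  apply: adaptedM; first by apply: weight_known; split => //=; rewrite /before/=.
  apply: adapted_natr; apply: (source_known (s := SrcActive j t.+1)) => //.
  by split => //=; rewrite /before/=.
have U_le t w : `|gain i t.+1 w * (weight i j t.+1 w * (act j t.+1 w)%:R)| <=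
    bstep i t.+1 w * gain_bound * (1 + (qr p)^-1).
  rewrite normrM; apply: ler_pM => //; first exact: gain_le.
  rewrite normrM; apply: le_trans (weight_le i j t.+1 w).
  by rewrite ler_piMr//; case: (act j t.+1 w); rewrite ?normr1 ?normr0.
apply: (product_centered_cvg (C := gain_bound * (1 + (qr p)^-1)) (i := i) Dslot aU) => [t|t|t|t|].
- by apply: (source_fresh (s := SrcNoise j t.+1)).
- apply: (known_bounded_integrable (c := beta0 p * gain_bound * (1 + (qr p)^-1)) (aU t)) => w.
  apply: le_trans (U_le t w) _; rewrite ler_wpM2r// ler_wpM2r ?gain_bound_ge0//.
  exact: bstep_le.
- exact: second_moment_integrable (noise_second_moment j t.+1).
- have := noise_mean law j t.+1; rewrite unlock /Rintegral => ->.
  by [].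
- apply: dominated_intro => [|t w]; first by rewrite mulr_ge0// gain_bound_ge0.
  rewrite normrM.
  have -> : gain_bound * (1 + (qr p)^-1) * (bstep i t.+1 w * magnitude t.+1 w) =
    bstep i t.+1 w * gain_bound * (1 + (qr p)^-1) * magnitude t.+1 w by ring.
  by apply: ler_pM => //; exact: noise_magnitude.
Qed.

(** The error due to missing receptions, centered because they are compensated by the
    factor 1 / qr. *)
Definition recv_term i j t w :=
  (gain i t.+1 w * utility j t.+1 w) * ((qr p)^-1 * (recv W i j t.+1 w)%:R - 1).

Lemma bool_RV_integrable (X : {RV P >-> bool}) : integrableR P (fun w => (X w)%:R).
Proof.
apply: (@integrableR_bounded _ _ _ _ _ 1) => [|w].
  by apply: (measurableT_comp (f := fun b : bool => b%:R : R)) => //; exact: measurable_funP.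
by case: (X w); rewrite ?normr1 ?normr0.
Qed.

Lemma bool_RV_expectation (X : {RV P >-> bool}) q : P (X @^-1` [set true]) = q%:E ->
  \int[P]_w (X w)%:R = q.
Proof.
move=> Xq; have mX : measurable (X @^-1` [set true]).
  by rewrite -[Y in measurable Y]setTI; exact: measurable_funP.
have E : (fun w => (X w)%:R) = (\1_(X @^-1` [set true]) : T -> R).
  apply/funext => w; rewrite indicE; congr (_%:R).
  by case E : (X w); [rewrite mem_set|rewrite memNset//= E].
by rewrite E /Rintegral integral_indic// setIT [X in fine X]Xq.
Qed.

Lemma recv_term_cvg i j : j != i -> {ae P, forall w, cvgn (series (recv_term i j ^~ w))}.
Proof.
move=> ji.
pose D t : set (source N) := [set SrcRecv t.+1].
have Dslot t s : D t s -> slot s = t.+1 by move=> ->.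
have q0 : 0 <= 1 + (qr p)^-1 by rewrite addr_ge0// invr_ge0 ltW.
have aU t : adapted (known_from (before t.+2 `\` D t))
    (fun w => gain i t.+1 w * utility j t.+1 w).
  have sub := before_split (@Dslot t).
  apply: adaptedM.
    by apply: known_gain => //; split => //=; rewrite /before/=.
  by apply: known_utility => // *; split => //=; rewrite /before/=.
have U_le t w : `|gain i t.+1 w * utility j t.+1 w| <=
    bstep i t.+1 w * gain_bound * magnitude t.+1 w.
  rewrite normrM; apply: ler_pM => //; first exact: gain_le.
  apply: le_trans (utility_bound_magnitude t.+1 w); apply: utility_le.
  exact: performed_box.
have V_int t : integrableR P (fun w => (qr p)^-1 * (recv W i j t w)%:R - 1).
  by apply: integrableRB; [exact/integrableRZ/bool_RV_integrable|exact: integrableR_cst].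
have [K hK] := magnitude_second_moment.
apply: (product_centered_cvg (C := gain_bound * (1 + (qr p)^-1)) (i := i) Dslot aU) => [t|t|t|t|].
- apply: adaptedB; last exact: adapted_cst.
  apply: adaptedM; first exact: adapted_cst.
  apply: adapted_natr; apply: (source_fresh (s := SrcRecv t.+1)) => //.
  exact: recv_events.
- have m := adapted_measurable (@known_from_measurable _) (aU t).
  apply: (integrableR_le m _ (integrableRZ (beta0 p * gain_bound)
    (second_moment_integrable (hK t.+1)))) => w.
  apply: le_trans (U_le t w) _; apply: le_trans (ler_norm _).
  by rewrite ler_wpM2r ?magnitude_ge0// ler_wpM2r ?gain_bound_ge0//; exact: bstep_le.
- exact: V_int.
- rewrite expectationRB; last 2 first.
  + exact/integrableRZ/bool_RV_integrable.
  + exact: integrableR_cst.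
  rewrite expectationRZ; last exact: bool_RV_integrable.
  rewrite (bool_RV_expectation (recv_law law t.+1 ji)) expectationR_cst.
  by rewrite mulVf ?subrr// gt_eqF.
- apply: dominated_intro => [|t w]; first by rewrite mulr_ge0// gain_bound_ge0.
  rewrite normrM.
  have -> : gain_bound * (1 + (qr p)^-1) * (bstep i t.+1 w * magnitude t.+1 w) =
    bstep i t.+1 w * gain_bound * magnitude t.+1 w * (1 + (qr p)^-1) by ring.
  apply: ler_pM => //.
  have qi : 0 <= (qr p)^-1 by rewrite invr_ge0 ltW.
  by rewrite ler_norml; case: (recv W i j t.+1 w); rewrite ?mulr1 ?mulr0; apply/andP; split; lra.
Qed.

Lemma sum_utilityE v dl s : sum_utility u v dl s = \sum_i u i v dl s.
Proof.
rewrite /sum_utility big_mkcond; apply: eq_bigr => i _; case: ifP => // hi'.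
by rewrite (utility_inactive uok).
Qed.

Lemma sum_utility_le v dl s : B0 v -> `|sum_utility u v dl s| <= N%:R * utility_bound s.
Proof.
move=> Bv; rewrite sum_utilityE; apply: le_trans (ler_norm_sum _ _ _) _.
by rewrite natr_mul_sum; apply: ler_sum => i _; exact: utility_le.
Qed.

Lemma sum_utility_lipschitz v v' dl s : B0 v -> B0 v' ->
  `|sum_utility u v' dl s - sum_utility u v dl s| <=
  N%:R * `|Lip s| * \sum_j `|v' 0 j - v 0 j|.
Proof.
move=> Bv Bv'; rewrite !sum_utilityE -sumrB; apply: le_trans (ler_norm_sum _ _ _) _.
by rewrite -mulrA natr_mul_sum; apply: ler_sum => i _; exact: utility_lipschitz_sum.
Qed.

Lemma sum_utility_measurable v dl : B0 v -> measurable_fun setT (sum_utility u v dl).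
Proof.
move=> Bv; rewrite (funext (sum_utilityE v dl)); apply: measurable_sum => i.
exact: (utility_measurable uok).
Qed.

Lemma magnitude_integrable t : integrableR P (magnitude t).
Proof. by have [K hK] := magnitude_second_moment; exact: second_moment_integrable (hK t). Qed.

Lemma sum_utility_expectation v dl t : B0 v ->
  integrableR P (fun w => sum_utility u v dl (env W t w)) /\
  \int[P]_w (sum_utility u v dl (env W t w)) = G W u dl v.
Proof.
move=> Bv; have ms := sum_utility_measurable dl Bv.
have i0 : integrableR P (fun w => sum_utility u v dl (env W 0%N w)).
  apply: (integrableR_le _ _ (integrableRZ N%:R (magnitude_integrable 0))) => [|w].
    by apply: measurableT_comp => //; exact: measurable_funP.
  apply: le_trans (sum_utility_le dl _ Bv) _; apply: le_trans (ler_norm _).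
  by rewrite ler_wpM2l// utility_bound_magnitude.
have [h1 h2] := identically_distributed_integrableR (env_law law 0 t) ms i0.
by split => //; rewrite h2 /G unlock.
Qed.

Lemma finite_bound (I : finType) (f : I -> 'rV[R]_N -> R) :
  (forall x, cont_on B0 (f x)) ->
  exists2 c, 0 <= c & forall x v, B0 v -> `|f x v| <= c.
Proof.
move=> cf; have [c hc] := @choice _ _ (fun x c => forall v, B0 v -> `|f x v| <= c)
  (fun x => cont_on_bounded (cf x)).
exists (\sum_x `|c x|) => [|x v Bv]; first by rewrite sumr_ge0.
apply: le_trans (hc x v Bv) _; rewrite (bigD1 x)//=.
by apply: ler_wpDr; [rewrite sumr_ge0|exact: ler_norm].
Qed.

Lemma G_cont dl : cont_on B0 (G W u dl).
Proof. by have [h _] := G_smooth reg dl; exact: gradient_on_cont h. Qed.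

Lemma dG_cont dl i : cont_on B0 (fun v => dG dl v 0 i).
Proof. by have [_ h] := G_smooth reg dl; exact: gradient_on_cont (h i). Qed.

Lemma unperturbed_known D t i j : before t.+1 `<=` D ->
  D (SrcActive j t.+1) -> D (SrcCount j t.+1) -> (j != i -> D (SrcPert j t.+1)) ->
  adapted (known_from D) (fun w => unperturbed i t.+1 w 0 j).
Proof.
move=> past ha hc hp.
have -> : (fun w => unperturbed i t.+1 w 0 j) = (fun w =>
    if j == i then a t.+1 w 0 j else performed W p a t.+1 w 0 j).
  by apply/funext => w; rewrite mxE.
case: eqP => [_|/eqP ji].
  exact: action_known.
by apply: known_performed => //; exact: hp.
Qed.

Lemma cont_at_adapted G0 (f : 'rV[R]_N -> R) (b : T -> 'rV[R]_N) : cont_on B0 f ->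
  (forall i, adapted G0 (fun w => b w 0 i)) -> (forall w, B0 (b w)) ->
  adapted G0 (fun w => f (b w)).
Proof.
move=> cf ab Bb; apply: (caratheodory_adapted lohi (f := fun v _ => f v)) => //.
Qed.

(** The value of G without the perturbation of node i multiplies this centered
    perturbation. *)
Definition pert_term i t w :=
  (tb i t.+1 w * offset i t.+1 w * G W u (activity W t.+1 w) (unperturbed i t.+1 w)) *
  Phi i t.+1 w.

Lemma pert_integrable i t : integrableR P (Phi i t).
Proof.
apply: (@integrableR_bounded _ _ _ _ _ (alpha_Phi p)) => [|w]; first exact: measurable_funP.
exact: pert_bound law i t w.
Qed.

Lemma pert_term_cvg i : {ae P, forall w, cvgn (series (pert_term i ^~ w))}.
Proof.
pose D t : set (source N) := [set SrcPert i t.+1].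
have Dslot t s : D t s -> slot s = t.+1 by move=> ->.
have [c c0 hc] := finite_bound G_cont.
have aU t : adapted (known_from (before t.+2 `\` D t)) (fun w => tb i t.+1 w *
    offset i t.+1 w * G W u (activity W t.+1 w) (unperturbed i t.+1 w)).
  have sub := before_split (@Dslot t).
  have ha j : (before t.+2 `\` D t) (SrcActive j t.+1) by split => //=; rewrite /before/=.
  have hk j : (before t.+2 `\` D t) (SrcCount j t.+1) by split => //=; rewrite /before/=.
  apply: adaptedM; first by apply: adaptedM; [exact: known_tbeta|exact: known_offset].
  apply: (at_activity_adapted (h := fun dl w => G W u dl (unperturbed i t.+1 w))) => [j|dl].
    exact: source_known (ha j) _.
  apply: cont_at_adapted => [|j|w]; [exact: G_cont| |exact: unperturbed_box].
  apply: unperturbed_known => // ji; split; rewrite /before//=.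
  by move=> [] ji'; rewrite ji' eqxx in ji.
have U_le t w : `|tb i t.+1 w * offset i t.+1 w *
    G W u (activity W t.+1 w) (unperturbed i t.+1 w)| <= bstep i t.+1 w * diameter * c.
  rewrite normrM; apply: ler_pM => //; last by apply: hc; exact: unperturbed_box.
  rewrite normrM (ger0_norm (tbeta_ge0 _ _ _)).
  by apply: ler_pM => //; [exact: tbeta_ge0|exact: tbeta_le|exact: offset_le].
apply: (product_centered_cvg (C := diameter * c * alpha_Phi p) (i := i) Dslot aU) => [t|t|t|t|].
- by apply: (source_fresh (s := SrcPert i t.+1)).
- apply: (known_bounded_integrable (c := beta0 p * diameter * c) (aU t)) => w.
  apply: le_trans (U_le t w) _; rewrite ler_wpM2r// ler_wpM2r ?diameter_ge0//.
  exact: bstep_le.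
- exact: pert_integrable.
- by have := pert_mean law i t.+1; rewrite unlock /Rintegral => ->.
- apply: dominated_intro => [|t w].
    by rewrite mulr_ge0// mulr_ge0// diameter_ge0.
  rewrite normrM.
  apply: (@le_trans _ _ (bstep i t.+1 w * diameter * c * alpha_Phi p)).
    by apply: ler_pM => //; exact: pert_bound law i t.+1 w.
  have -> : diameter * c * alpha_Phi p * (bstep i t.+1 w * magnitude t.+1 w) =
    bstep i t.+1 w * diameter * c * alpha_Phi p * magnitude t.+1 w by ring.
  rewrite ler_peMr ?magnitude_ge1//.
  apply: mulr_ge0 => //; apply: mulr_ge0 => //; apply: mulr_ge0; first exact: bstep_ge0.
  exact: diameter_ge0.
Qed.

(** The error due to the random environment. *)
Definition env_term i t w := gain i t.+1 w *
  (sum_utility u (performed W p a t.+1 w) (activity W t.+1 w) (env W t.+1 w) -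
   G W u (activity W t.+1 w) (performed W p a t.+1 w)).

(** Everything but the environment of the slot is known, the performed action
    included; freezing it leaves a centered family. *)
Lemma env_term_cvg i : {ae P, forall w, cvgn (series (env_term i ^~ w))}.
Proof.
have [c c0 hc] := finite_bound G_cont.
have dev_le v dl t w : B0 v ->
    `|sum_utility u v dl (env W t w) - G W u dl v| <= (N%:R + c) * magnitude t w.
  move=> Bv; apply: le_trans (ler_normB _ _) _; rewrite mulrDl; apply: lerD.
    apply: le_trans (sum_utility_le dl _ Bv) _.
    by rewrite ler_wpM2l// utility_bound_magnitude.
  by apply: le_trans (hc dl v Bv) _; rewrite ler_peMr ?magnitude_ge1.
have adev E t dl : before t.+1 `<=` E -> (forall j, E (SrcActive j t.+1)) ->
    (forall j, E (SrcCount j t.+1)) -> (forall j, E (SrcPert j t.+1)) -> E (SrcEnv t.+1) ->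
    adapted (known_from E) (fun w => sum_utility u (performed W p a t.+1 w) dl (env W t.+1 w)
      - G W u dl (performed W p a t.+1 w)).
  move=> past ha hk hp he; apply: adaptedB; last first.
    apply: cont_at_adapted => [|j|w]; [exact: G_cont|exact: known_performed|exact: performed_box].
  apply: (caratheodory_adapted lohi (f := fun v w => sum_utility u v dl (env W t.+1 w))) => //.
  - by move=> v Bv; apply: adapted_comp (source_known he _) => //; exact: sum_utility_measurable.
  - move=> w; apply: (@lipschitz_cont_on _ _ _ _ (N%:R * `|Lip (env W t.+1 w)|)) => v v'.
    exact: sum_utility_lipschitz.
  - by move=> j; exact: known_performed.
  - exact: performed_box.
have term_le t w : `|env_term i t w| <= gain_bound * (N%:R + c) *
    (bstep i t.+1 w * magnitude t.+1 w).
  rewrite /env_term normrM.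
  have -> : gain_bound * (N%:R + c) * (bstep i t.+1 w * magnitude t.+1 w) =
    (bstep i t.+1 w * gain_bound) * ((N%:R + c) * magnitude t.+1 w) by ring.
  apply: ler_pM => //; first exact: gain_le.
  by apply: dev_le; exact: performed_box.
apply: (centered_cvg (C := gain_bound * (N%:R + c)) (i := i)) => [t||t Z cz aZ Zc].
- have hs s : slot s = t.+1 -> before t.+2 s by move=> h; rewrite /before/= h.
  have past : before t.+1 `<=` before t.+2 by move=> s; exact: ltnW.
  apply: adaptedM; first by apply: known_gain => //; exact: hs.
  apply: (at_activity_adapted (h := fun dl w => sum_utility u (performed W p a t.+1 w) dl
      (env W t.+1 w) - G W u dl (performed W p a t.+1 w))) => [j|dl].
    by apply: (source_known (s := SrcActive j t.+1)) => //; exact: hs.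
  by apply: adev => // *; exact: hs.
- by apply: dominated_intro => //; rewrite mulr_ge0 ?gain_bound_ge0// addr_ge0.
pose D : set (source N) := [set SrcEnv t.+1].
have D0 j : ~ D (SrcActive j 0) by [].
have past : before t.+1 `<=` ~` D.
  by move=> s st; move: st => /[swap] ->; rewrite /before/= ltnn.
pose f dl v w := sum_utility u v dl (env W t.+1 w) - G W u dl v.
(* The activities only take finitely many values, so splitting over them freezes
   them; the performed action needs a genuine freezing argument. *)
pose Psi dl w := gain i t.+1 w * (activity W t.+1 w == dl)%:R * Z w.
have E w : env_term i t w * Z w = \sum_dl Psi dl w * f dl (performed W p a t.+1 w) w.
  transitivity (gain i t.+1 w * f (activity W t.+1 w) (performed W p a t.+1 w) w * Z w) => //.
  rewrite (@activity_split t.+1 (fun dl w => f dl (performed W p a t.+1 w) w) w).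
  by rewrite mulr_sumr mulr_suml; apply: eq_bigr => dl _; rewrite /Psi; ring.
have aZ' : adapted (known_from (~` D)) Z by apply: adapted_sub aZ; exact: known_sub.
have aPsi dl : adapted (known_from (~` D)) (Psi dl).
  apply: adaptedM => //; apply: adaptedM; first by apply: known_gain.
  apply: adapted_natr; apply: activity_adapted => j.
  by apply: (source_known (s := SrcActive j t.+1)).
have Psi_le dl w : `|Psi dl w| <= beta0 p * gain_bound * cz.
  rewrite /Psi normrM; apply: ler_pM => //; rewrite normrM.
  apply: le_trans (gain_le_cst i t.+1 w).
  by rewrite ler_piMr//; case: eqP; rewrite ?normr1 ?normr0.
have mdev dl : measurable_fun setT (fun w => f dl (performed W p a t.+1 w) w).
  exact: adapted_measurable (@known_from_measurable setT) (adev setT t dl _ _ _ _ _).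
have iPf dl : integrableR P (fun w => Psi dl w * f dl (performed W p a t.+1 w) w).
  apply: (integrableR_le _ _ (integrableRZ (beta0 p * gain_bound * cz * (N%:R + c))
    (magnitude_integrable t.+1))) => [|w].
    apply: measurable_funM => //.
    exact: adapted_measurable (@known_from_measurable _) (aPsi dl).
  rewrite normrM -mulrA; apply: le_trans (ler_norm _).
  by apply: ler_pM => //; apply: dev_le; exact: performed_box.
rewrite (funext E) expectationR_sum => [|dl _]; last exact: iPf.
apply: big1 => dl _.
have iLip : integrableR P (fun w => `|Lip (env W t.+1 w)|).
  have iL0 : integrableR P (fun w => Lip (env W 0%N w)).
    have mL0 : measurable_fun setT (fun w => Lip (env W 0%N w)).
      by apply: measurableT_comp => //; exact: measurable_funP.
    have [K hK] := second_moment_of mL0 Lip_moment.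
    exact: second_moment_integrable hK.
  have [h _] := identically_distributed_integrableR (env_law law 0 t.+1) Lip_measurable iL0.
  exact: integrableR_norm.
pose EL := \int[P]_w `|Lip (env W t.+1 w)|.
have EL0 : 0 <= EL by exact: Rintegral_ge0.
apply: (freezing_mean0 (P := P) lohi (H := fresh W D) (G := known_from (~` D))
  (Lf := fun w => N%:R * (`|Lip (env W t.+1 w)| + EL)) (c := beta0 p * gain_bound * cz)) => //.
- exact: known_from_measurable.
- exact: fresh_measurable.
- exact: (known_fresh_independent law (fun i => init_measurable alg i) initE D0).
- move=> v Bv; apply: adaptedB; last exact: adapted_cst.
  apply: (adapted_comp (sum_utility_measurable dl Bv)).
  by apply: (source_fresh (s := SrcEnv t.+1)).
- move=> v Bv; have [h _] := sum_utility_expectation dl t.+1 Bv.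
  by apply: integrableRB => //; exact: integrableR_cst.
- move=> v Bv; have [h h'] := sum_utility_expectation dl t.+1 Bv.
  rewrite expectationRB ?h' ?expectationR_cst ?subrr//.
  exact: integrableR_cst.
- move=> w v v' Bv Bv'; rewrite /f.
  have [h h'] := sum_utility_expectation dl t.+1 Bv.
  have [k k'] := sum_utility_expectation dl t.+1 Bv'.
  have GL : `|G W u dl v - G W u dl v'| <= N%:R * EL * \sum_j `|v 0 j - v' 0 j|.
    rewrite -h' -k' -RintegralB//.
    have iD : integrableR P (fun w => sum_utility u v dl (env W t.+1 w) -
        sum_utility u v' dl (env W t.+1 w)) by exact: integrableRB.
    apply: le_trans (le_normr_Rintegral measurableT iD) _.
    have -> : N%:R * EL * \sum_j `|v 0 j - v' 0 j| =
      \int[P]_w' ((N%:R * \sum_j `|v 0 j - v' 0 j|) * `|Lip (env W t.+1 w')|).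
      by rewrite expectationRZ// -/EL; ring.
    apply: expectationR_le => [||w']; [exact: integrableR_norm|exact: integrableRZ|].
    by rewrite mulrAC; exact: sum_utility_lipschitz.
  set A := sum_utility u v _ _; set A' := sum_utility u v' _ _.
  have -> : A - G W u dl v - (A' - G W u dl v') = (A - A') - (G W u dl v - G W u dl v').
    by ring.
  rewrite mulrDr mulrDl; apply: le_trans (ler_normB _ _) _; apply: lerD => //.
  exact: sum_utility_lipschitz.
- apply: (integrableRZ N%:R); apply: (integrableRD (Y := fun=> EL)) => //.
  exact: integrableR_cst.
- by move=> w; rewrite mulr_ge0// addr_ge0.
- by move=> j; apply: known_performed.
- exact: performed_box.
Qed.

Definition activity_weight dl : R := \prod_i (if dl i then qa p else 1 - qa p).

Lemma activity_weight_itv dl : 0 <= activity_weight dl <= 1.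
Proof.
have /andP[q0 q1] := qa_range pok.
apply/andP; split; first by apply: prodr_ge0 => i _; case: ifP => _; lra.
by apply: prodr_ile1 => i _; case: ifP => _; apply/andP; split; lra.
Qed.

Lemma activity_expectation t dl :
  \int[P]_w (activity W t w == dl)%:R = activity_weight dl.
Proof.
pose B i := act i t @^-1` [set dl i].
have mB i : measurable (B i).
  by rewrite -[X in measurable X]setTI; exact: measurable_funP.
have PB i : P (B i) = (if dl i then qa p else 1 - qa p)%:E.
  rewrite /B; case: (dl i); first exact: active_law law i t.
  have -> : act i t @^-1` [set false] = ~` (act i t @^-1` [set true]).
    by apply/seteqP; split => w /=; [move=> ->|move/negP/negbTE].
  have mA : measurable (act i t @^-1` [set true]).
    by rewrite -[X in measurable X]setTI; exact: measurable_funP.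
  by rewrite probability_setC// (active_law law).
have PBI : P (\bigcap_(i in [set: 'I_N]) B i) = (activity_weight dl)%:E.
  have := sources_independent law (j := fun i : 'I_N => SrcActive i t) (B := B).
  rewrite /mutually_independent => -> //.
  - by rewrite /activity_weight -prodEFin; apply: eq_bigr => i _; exact: PB.
  - by move=> i i' [].
  - by move=> i; exists [set dl i]; rewrite // setTI.
have E : (fun w => (activity W t w == dl)%:R) =
    (\1_(\bigcap_(i in [set: 'I_N]) B i) : T -> R).
  apply/funext => w; rewrite indicE; congr ((nat_of_bool _)%:R).
  apply/eqP/idP => [h|]; first by rewrite inE => i _; rewrite /B/= -h ffunE.
  by rewrite inE => h; apply/ffunP => i; rewrite ffunE; exact: h.
rewrite E /Rintegral integral_indic//; last first.
  by apply: fin_bigcap_measurable => [|i _]; [exact: finite_finset|exact: mB].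
by rewrite setIT [X in fine X]PBI.
Qed.

Definition node_gain i t w := tb i t w * tg i t w.

Lemma node_gain_ge0 i t w : 0 <= node_gain i t w.
Proof. by rewrite mulr_ge0 ?tbeta_ge0 ?tgamma_ge0. Qed.

Lemma node_gain_le i t w : node_gain i t w <= bstep i t w * gamma0 p.
Proof. by apply: ler_pM; rewrite ?tbeta_ge0 ?tgamma_ge0 ?tbeta_le ?tgamma_le. Qed.

Definition full_gain i t w := beta p (counter W i t w).+1 * gamma p (counter W i t w).+1.

Lemma node_gainE i t w : node_gain i t w = (act i t w)%:R * full_gain i t w.
Proof.
rewrite /node_gain tbetaE tgammaE /full_gain; case: (act i t w).
  by rewrite !mul1r.
by rewrite !mul0r.
Qed.

Lemma full_gain_expectation i t : integrableR P (full_gain i t) /\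
  \int[P]_w full_gain i t w = rho p t.
Proof.
apply: (binomial_expectation (qa_range pok) (count_law law i t)
  (g := fun k => beta p k.+1 * gamma p k.+1)) => k.
by rewrite mulr_ge0 ?beta_ge0 ?gamma_ge0.
Qed.

(** The counter of node i is independent of its activity and of the past. *)
Lemma gain_factors i t (X : T -> R) c : adapted (known_from (~` [set SrcCount i t])) X ->
  (forall w, `|X w| <= c) ->
  \int[P]_w (X w * full_gain i t w) = (\int[P]_w X w) * rho p t.
Proof.
move=> aX Xc; have [iF EF] := full_gain_expectation i t.
have aF : adapted (fresh W [set SrcCount i t]) (full_gain i t).
  apply: (adapted_comp (h := fun k => beta p k.+1 * gamma p k.+1)) => //.
  by apply: (source_fresh (s := SrcCount i t)).
have [|_ ->] := expectation_known_fresh _ aX aF (known_bounded_integrable aX Xc) iF.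
  by [].
by rewrite EF.
Qed.

Lemma natr_bool_le1 (b : bool) : `|b%:R : R| <= 1.
Proof. by case: b; rewrite ?normr1 ?normr0. Qed.

Lemma cell_gain_expectation i t dl :
  \int[P]_w ((activity W t w == dl)%:R * node_gain i t w) =
  activity_weight dl * (dl i)%:R * rho p t.
Proof.
have E w : (activity W t w == dl)%:R * node_gain i t w =
    ((dl i)%:R * (activity W t w == dl)%:R) * full_gain i t w.
  rewrite node_gainE mulrA; congr (_ * _); rewrite mulrC.
  by case: eqP => [<-|_]; rewrite ?mulr0// ffunE.
have acell : adapted (known_from (~` [set SrcCount i t])) (fun w => (activity W t w == dl)%:R : R).
  by apply: adapted_natr; apply: activity_adapted => j; apply: (source_known (s := SrcActive j t)).
rewrite (funext E) (@gain_factors i t _ 1); last 2 first.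
- by apply: adaptedM => //; exact: adapted_cst.
- by move=> w; rewrite normrM mulr_ile1// natr_bool_le1.
rewrite expectationRZ; last exact: known_bounded_integrable acell (fun w => natr_bool_le1 _).
by rewrite activity_expectation; congr (_ * _); rewrite mulrC.
Qed.

Lemma node_gain_expectation i t : integrableR P (node_gain i t) /\
  \int[P]_w node_gain i t w = qa p * rho p t.
Proof.
have aact : adapted (known_from (~` [set SrcCount i t])) (fun w => (act i t w)%:R : R).
  by apply: adapted_natr; apply: (source_known (s := SrcActive i t)).
have an : adapted (known_from setT) (node_gain i t).
  apply: adaptedM.
    by apply: tbeta_adapted; [apply: (source_known (s := SrcActive i t))|
      apply: (source_known (s := SrcCount i t))].
  by apply: tgamma_adapted; [apply: (source_known (s := SrcActive i t))|
    apply: (source_known (s := SrcCount i t))].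
split.
  apply: (known_bounded_integrable (c := beta0 p * gamma0 p) an) => w.
  rewrite ger0_norm ?node_gain_ge0//; apply: le_trans (node_gain_le i t w) _.
  by rewrite ler_wpM2r ?bstep_le// ltW// (gamma0_gt0 pok).
rewrite (funext (node_gainE i t)) (@gain_factors i t _ 1)// => [|w]; last exact: natr_bool_le1.
by rewrite (bool_RV_expectation (active_law law i t)).
Qed.

(** The fluctuation of the gain around its mean, which makes errors that are small
    multiples of the gain comparable to rho. *)
Definition step_term i t w := node_gain i t.+1 w - qa p * rho p t.+1.

Lemma step_term_cvg i : {ae P, forall w, cvgn (series (step_term i ^~ w))}.
Proof.
have /andP[q0 q1] := qa_range pok; have g0 := gamma0_gt0 pok.
pose D t : set (source N) := [set s | s = SrcActive i t.+1 \/ s = SrcCount i t.+1].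
have Dslot t s : D t s -> slot s = t.+1 by case=> ->.
have aU t : adapted (known_from (before t.+2 `\` D t)) (fun=> 1 : R) by exact: adapted_cst.
have [iN EN] : (forall t, integrableR P (node_gain i t)) /\
    forall t, \int[P]_w node_gain i t w = qa p * rho p t.
  by split => t; have [] := node_gain_expectation i t.
suff : {ae P, forall w, cvgn (series (fun t => 1 * step_term i t w))}.
  by apply: filterS => w; congr (cvgn (series _)); apply/funext => t; rewrite mul1r.
apply: (product_centered_cvg (V := step_term i) (C := gamma0 p + 1) (i := i)
  Dslot aU) => [t|t|t|t|t w].
- apply: adaptedB; last exact: adapted_cst.
  apply: adaptedM.
    by apply: tbeta_adapted; [apply: (source_fresh (s := SrcActive i t.+1)) => //; left|
      apply: (source_fresh (s := SrcCount i t.+1)) => //; right].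
  by apply: tgamma_adapted; [apply: (source_fresh (s := SrcActive i t.+1)) => //; left|
    apply: (source_fresh (s := SrcCount i t.+1)) => //; right].
- exact: integrableR_cst.
- by apply: integrableRB => //; exact: integrableR_cst.
- rewrite expectationRB ?EN ?expectationR_cst ?subrr//.
  exact: integrableR_cst.
- rewrite mul1r /step_term; apply: le_trans (ler_normB _ _) _.
  have r0 := rho_ge0 pok t.+1; have b0 := bstep_ge0 i t.+1 w.
  rewrite !ger0_norm ?node_gain_ge0 ?mulr_ge0 ?(ltW q0)//.
  have := node_gain_le i t.+1 w; have := magnitude_ge1 t.+1 w => m1 n1.
  have h1 : bstep i t.+1 w <= bstep i t.+1 w * magnitude t.+1 w by rewrite ler_peMr.
  have h2 : qa p * rho p t.+1 <= rho p t.+1 by rewrite ler_piMl.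
  have h3 : gamma0 p * bstep i t.+1 w <= gamma0 p * (bstep i t.+1 w * magnitude t.+1 w).
    by rewrite ler_wpM2l// ltW.
  have h4 : 0 <= gamma0 p * rho p t.+1 by rewrite mulr_ge0// ltW.
  by rewrite mulrC in n1; rewrite mulrDl !mul1r mulrDr; lra.
Qed.

(** The contribution of coordinate i to the derivative of G away from the optimum. *)
Definition slope i dl v := (v 0 i - astar 0 i) * dG dl v 0 i.

Lemma slope_cont i dl : cont_on B0 (slope i dl).
Proof. by apply: cont_on_mul; [exact: cont_on_coord|exact: dG_cont]. Qed.

(** The fluctuation of the drift around its mean.  It is split over the activity
    patterns because G, and with it the slope, depends on the activities, which are
    independent of the target but not of the gain. *)
Definition drift_term i dl t w := slope i dl (target t w) *
  ((activity W t.+1 w == dl)%:R * node_gain i t.+1 w * Phi i t.+1 w ^+ 2 -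
   activity_weight dl * (dl i)%:R * rho p t.+1 * sigma_Phi p ^+ 2).

Lemma pert_sqr_le i t w : Phi i t w ^+ 2 <= alpha_Phi p ^+ 2.
Proof.
rewrite -[leLHS]real_normK ?num_real// lerXn2r ?nnegrE//.
exact: pert_bound law i t w.
Qed.

Lemma pert_sqr_expectation i t : integrableR P (fun w => Phi i t w ^+ 2) /\
  \int[P]_w (Phi i t w ^+ 2) = sigma_Phi p ^+ 2.
Proof.
split; last by have := pert_var law i t; rewrite unlock /Rintegral => ->.
apply: (@integrableR_bounded _ _ _ _ _ (alpha_Phi p ^+ 2)) => [|w].
  by apply: measurable_funX; exact: measurable_funP.
by rewrite ger0_norm ?sqr_ge0// pert_sqr_le.
Qed.

Lemma drift_term_cvg i dl : {ae P, forall w, cvgn (series (drift_term i dl ^~ w))}.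
Proof.
have g0 := gamma0_gt0 pok.
have /andP[aw0 aw1] := activity_weight_itv dl.
have [c hc'] := cont_on_bounded (@slope_cont i dl).
have c0 : 0 <= c by apply: le_trans (hc' _ astar_box).
pose D t : set (source N) := [set s | [\/ s = SrcPert i t.+1, exists j, s = SrcActive j t.+1 |
  exists j, s = SrcCount j t.+1]].
have Dslot t s : D t s -> slot s = t.+1 by case=> [->|[j ->]|[j ->]].
have aU t : adapted (known_from (before t.+2 `\` D t)) (fun w => slope i dl (target t w)).
  apply: cont_at_adapted => [|j|w]; [exact: slope_cont| |exact: target_box].
  by apply: target_known; exact: before_split (@Dslot t).
pose X t w := (activity W t.+1 w == dl)%:R * node_gain i t.+1 w.
have X0 t w : 0 <= X t w by rewrite mulr_ge0 ?node_gain_ge0.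
have X_le t w : X t w <= bstep i t.+1 w * gamma0 p.
  apply: le_trans (node_gain_le i t.+1 w); rewrite /X.
  by case: eqP; rewrite ?mul1r ?mul0r ?node_gain_ge0.
have aXG G0 t : (forall j, adapted G0 (act j t.+1)) -> (forall j, adapted G0 (counter W j t.+1)) ->
    adapted G0 (X t).
  move=> ha hk; apply: adaptedM; first by apply: adapted_natr; exact: activity_adapted.
  by apply: adaptedM; [exact: tbeta_adapted|exact: tgamma_adapted].
have aX t : adapted (known_from (~` [set SrcPert i t.+1])) (X t).
  by apply: aXG => j; [apply: (source_known (s := SrcActive j t.+1))|
    apply: (source_known (s := SrcCount j t.+1))].
have X_cst t w : `|X t w| <= beta0 p * gamma0 p.
  rewrite ger0_norm//; apply: le_trans (X_le t w) _.
  by rewrite ler_wpM2r ?bstep_le// ltW.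
have aPhi2 t : adapted (fresh W [set SrcPert i t.+1]) (fun w => Phi i t.+1 w ^+ 2).
  have h : adapted (fresh W [set SrcPert i t.+1]) (Phi i t.+1).
    by apply: (source_fresh (s := SrcPert i t.+1)).
  exact: adaptedM.
have XPhi t : integrableR P (fun w => X t w * Phi i t.+1 w ^+ 2) /\
    \int[P]_w (X t w * Phi i t.+1 w ^+ 2) =
      activity_weight dl * (dl i)%:R * rho p t.+1 * sigma_Phi p ^+ 2.
  have [i2 E2] := pert_sqr_expectation i t.+1.
  have [|h ->] := expectation_known_fresh _ (aX t) (aPhi2 t)
    (known_bounded_integrable (aX t) (X_cst t)) i2; first by [].
  by split => //; rewrite E2 cell_gain_expectation.
apply: (product_centered_cvg (C := c * (alpha_Phi p ^+ 2 * gamma0 p + sigma_Phi p ^+ 2))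
  (i := i) Dslot aU) => [t|t|t|t|t w].
- have fP : adapted (fresh W (D t)) (Phi i t.+1).
    by apply: (source_fresh (s := SrcPert i t.+1)) => //; constructor 1.
  apply: adaptedB; last exact: adapted_cst.
  apply: adaptedM; last exact: adaptedM.
  apply: aXG => j.
    by apply: (source_fresh (s := SrcActive j t.+1)) => //; constructor 2; exists j.
  by apply: (source_fresh (s := SrcCount j t.+1)) => //; constructor 3; exists j.
- by apply: (known_bounded_integrable (c := c) (aU t)) => w; apply: hc'; exact: target_box.
- have [h _] := XPhi t.
  by apply: integrableRB h _; exact: integrableR_cst.
- have [h E] := XPhi t.
  rewrite (expectationRB h); last exact: integrableR_cst.
  by rewrite [X in X - _]E expectationR_cst subrr.
- rewrite normrM -[leRHS]mulrA; apply: ler_pM => //; first by apply: hc'; exact: target_box.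
  apply: le_trans (ler_normB _ _) _; rewrite -/(X t w).
  have r0 := rho_ge0 pok t.+1; have b0 := bstep_ge0 i t.+1 w.
  have s0 := sqr_ge0 (sigma_Phi p); have al0 := sqr_ge0 (alpha_Phi p).
  have x1 : 0 <= X t w * Phi i t.+1 w ^+ 2 by rewrite mulr_ge0 ?sqr_ge0.
  have x2 : 0 <= activity_weight dl * (dl i)%:R * rho p t.+1 * sigma_Phi p ^+ 2.
    by rewrite mulr_ge0// mulr_ge0// mulr_ge0.
  rewrite (ger0_norm x1) (ger0_norm x2).
  have h1 : X t w * Phi i t.+1 w ^+ 2 <= bstep i t.+1 w * gamma0 p * alpha_Phi p ^+ 2.
    by apply: ler_pM; rewrite ?sqr_ge0 ?pert_sqr_le.
  have h2 : activity_weight dl * (dl i)%:R * rho p t.+1 * sigma_Phi p ^+ 2 <=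
      rho p t.+1 * sigma_Phi p ^+ 2.
    rewrite ler_wpM2r// ler_piMl//; case: (dl i); rewrite ?mulr1// mulr0//.
  have m1 := magnitude_ge1 t.+1 w.
  have h3 : bstep i t.+1 w <= bstep i t.+1 w * magnitude t.+1 w by rewrite ler_peMr.
  move: (bstep i t.+1 w * magnitude t.+1 w) h3 => bm h3.
  have h4 : bstep i t.+1 w * gamma0 p * alpha_Phi p ^+ 2 <= alpha_Phi p ^+ 2 * gamma0 p * bm.
    have -> : bstep i t.+1 w * gamma0 p * alpha_Phi p ^+ 2 =
       (alpha_Phi p ^+ 2 * gamma0 p) * bstep i t.+1 w by ring.
    by rewrite ler_wpM2l// mulr_ge0// ltW.
  have h5 : 0 <= alpha_Phi p ^+ 2 * gamma0 p * rho p t.+1 by rewrite !mulr_ge0// ltW.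
  have h6 : 0 <= sigma_Phi p ^+ 2 * bm by rewrite mulr_ge0// (le_trans b0).
  by rewrite mulrDl !mulrDr; lra.
Qed.

(** * The drift *)

(** The activities are independent of the environment. *)
Lemma F_mixture v : B0 v -> F W u v = \sum_dl activity_weight dl * G W u dl v.
Proof.
move=> Bv; pose D : set (source N) := [set SrcEnv 0].
have acell dl : adapted (known_from (~` D)) (fun w => (activity W 0 w == dl)%:R : R).
  by apply: adapted_natr; apply: activity_adapted => j; apply: (source_known (s := SrcActive j 0)).
have asum dl : adapted (fresh W D) (fun w => sum_utility u v dl (env W 0%N w)).
  apply: (adapted_comp (sum_utility_measurable dl Bv)).
  by apply: (source_fresh (s := SrcEnv 0)).
have D0 j : ~ D (SrcActive j 0) by [].
have prodE dl := expectation_known_fresh D0 (acell dl) (asum dl)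
  (known_bounded_integrable (acell dl) (fun w => natr_bool_le1 _))
  (sum_utility_expectation dl 0 Bv).1.
rewrite /F unlock -[LHS]/(\int[P]_w sum_utility u v (activity W 0%N w) (env W 0%N w)).
rewrite (funext (activity_split 0 (fun dl w => sum_utility u v dl (env W 0%N w)))).
rewrite expectationR_sum => [|dl _]; last exact: (prodE dl).1.
apply: eq_bigr => dl _; rewrite (prodE dl).2 activity_expectation.
by rewrite (sum_utility_expectation dl 0 Bv).2.
Qed.

Lemma G_gradient dl : gradient_on B0 (G W u dl) (dG dl).
Proof. by have [] := G_smooth reg dl. Qed.

(** The masked Lipschitz condition makes G constant in the actions of inactive nodes. *)
Lemma slope_inactive i dl v : B0 v -> dl i = false -> slope i dl v = 0.
Proof.
move=> Bv di; pose v' : 'rV[R]_N := \row_j (if j == i then astar 0 i else v 0 j).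
have Bv' : B0 v' by move=> j; rewrite mxE; case: eqP => [->|_]; [exact: astar_box|exact: Bv].
have Gc s : 0 <= s <= 1 -> B0 (v + s *: (v' - v)) /\
    G W u dl (v + s *: (v' - v)) = cst (G W u dl v) (v + s *: (v' - v)).
  move=> s01; have Bs := box_segment Bv Bv' s01; split => //.
  rewrite /G /=; congr (fine (expectation P _)); apply/funext => w.
  rewrite !sum_utilityE; apply: eq_bigr => j _; apply/eqP.
  rewrite -subr_eq0 -normr_le0; apply: le_trans (Lip_le j dl _ Bs Bv) _.
  rewrite /euclid big1 ?sqrtr0 ?mulr0// => k _.
  rewrite !mxE; have [->|ki] := eqVneq k i; first by rewrite di mulr0 expr0n.
  by rewrite subrr mulr0 addr0 subrr mul0r expr0n.
have cg : gradient_on B0 (cst (G W u dl v)) (cst 0).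
  move=> b Bb; rewrite (_ : (fun _ => _) = cst 0); first exact: cvg_cst.
  apply/funext => b' /=; rewrite subrr sub0r /dot big1 ?oppr0 ?mul0r// => j _.
  by rewrite mxE mul0r.
have := gradient_on_unique (@G_gradient dl) cg Gc.
rewrite /dot [RHS]big1; last by move=> j _; rewrite mxE mul0r.
rewrite (bigD1 i)//= big1 ?addr0 => [|j ji]; last by rewrite !mxE (negbTE ji) subrr mulr0.
rewrite !mxE eqxx /slope => h.
by rewrite -[LHS]opprK -mulNr opprB mulrC h oppr0.
Qed.

(** F is the mixture of the functions G on the segment from v to the optimum, which
    identifies the derivatives in this direction. *)
Lemma drift_direction v : B0 v ->
  \sum_i \sum_dl slope i dl v * (activity_weight dl * (dl i)%:R) = dot (v - astar) (dF v).
Proof.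
move=> Bv.
pose dM (v' : 'rV[R]_N) : 'rV[R]_N := \sum_dl activity_weight dl *: dG dl v'.
have gM : gradient_on B0 (fun v' => \sum_dl activity_weight dl * G W u dl v') dM.
  apply: gradient_on_sum => dl; exact: G_gradient.
have [gF _] := F_smooth reg.
have seg s : 0 <= s <= 1 -> B0 (v + s *: (astar - v)) /\
    F W u (v + s *: (astar - v)) = \sum_dl activity_weight dl * G W u dl (v + s *: (astar - v)).
  by move=> s01; have Bs := box_segment Bv astar_box s01; split => //; exact: F_mixture.
have E := gradient_on_unique gF gM seg.
transitivity (- dot (dM v) (astar - v)).
  rewrite /dot /dM -sumrN; apply: eq_bigr => i _.
  rewrite summxE mulr_suml -sumrN; apply: eq_bigr => dl _.
  rewrite !mxE; case E' : (dl i); last first.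
    have := slope_inactive Bv E'; rewrite /slope mulr0 mulr0 => h.
    by rewrite -mulrA -mulrN -mulrN opprB [dG _ _ _ _ * _]mulrC h mulr0.
  by rewrite mulr1 /slope; ring.
by rewrite -E /dot -sumrN; apply: eq_bigr => i _; rewrite !mxE; ring.
Qed.

(** Strict concavity compares the gradient at v with the one at the optimum, which is
    0; compactness makes the bound uniform. *)
Lemma descent_coercive e : 0 < e -> exists2 kappa, 0 < kappa &
  forall v, B0 v -> e <= sqdist v astar -> kappa <= - dot (v - astar) (dF v).
Proof.
have [_ hF] := F_smooth reg.
apply: cont_on_coercive => [|v Bv va].
  have -> : (fun v => - dot (v - astar) (dF v)) =
      (fun v => \sum_i (v 0 i - astar 0 i) * ((-1) * dF v 0 i)).
    apply/funext => v; rewrite /dot -sumrN; apply: eq_bigr => i _.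
    by rewrite !mxE mulN1r mulrN.
  apply: cont_on_sum => i; apply: cont_on_mul; first exact: cont_on_coord.
  apply: cont_on_mul; last exact: gradient_on_cont (hF i).
  by move=> v _ e' e'0; exists 1 => // b _ _; rewrite subrr normr0 ltW.
have := F_strictly_concave reg Bv astar_box va.
suff -> : dF v - dF astar = dF v by rewrite oppr_gt0.
by apply/rowP => i; rewrite !mxE (astar_critical reg) subr0.
Qed.

Let finite_delta (I : finType) (Q : I -> R -> Prop) :
  (forall x, exists2 del, 0 < del & forall e, 0 < e <= del -> Q x e) ->
  exists2 del, 0 < del & forall x, Q x del.
Proof.
move=> h; have [del hdel] := @choice _ _ (fun x del =>
  0 < del /\ forall e, 0 < e <= del -> Q x e)
  (fun x => let: ex_intro2 e a b := h x in ex_intro _ e (conj a b)).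
have s0 : 0 <= \sum_x (del x)^-1.
  by apply: sumr_ge0 => x _; rewrite invr_ge0 ltW// (hdel x).1.
have d0 : 0 < (\sum_x (del x)^-1 + 1)^-1 by rewrite invr_gt0 ltr_wpDl.
exists (\sum_x (del x)^-1 + 1)^-1 => // x; apply: (hdel x).2; rewrite d0/=.
rewrite -[leRHS]invrK lef_pV2 ?posrE ?invr_gt0 ?(hdel x).1 ?ltr_wpDl//.
rewrite (bigD1 x)//= -addrA lerDl addr_ge0// sumr_ge0// => y _.
by rewrite invr_ge0 ltW// (hdel y).1.
Qed.

Let widths t w del := forall j, alpha_Phi p * tg j t w < del.

(** By the mean value theorem, the perturbation of node i changes G by this
    perturbation times the i-th partial derivative at a nearby point, and uniform
    continuity lets this point move to the target. *)
Lemma perturbation_error e : 0 < e -> exists2 del, 0 < del &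
  forall i t w, widths t.+1 w del ->
  `|gain i t.+1 w * (G W u (activity W t.+1 w) (performed W p a t.+1 w) -
       G W u (activity W t.+1 w) (unperturbed i t.+1 w)) -
    node_gain i t.+1 w * Phi i t.+1 w ^+ 2 * slope i (activity W t.+1 w) (target t w)|
  <= e * node_gain i t.+1 w.
Proof.
move=> e0; have al0 := alpha_Phi_gt0 pok.
(* Moving the slope and moving the offset each cost e1, times the square of the
   perturbation. *)
pose e1 := e / (2 * alpha_Phi p ^+ 2).
have e10 : 0 < e1 by rewrite divr_gt0// mulr_gt0// exprn_gt0.
have [c c0 hc] := finite_bound (fun x : 'I_N * {ffun 'I_N -> bool} => @dG_cont x.2 x.1).
have [|del1 del10 h1] := finite_delta (I := ('I_N * {ffun 'I_N -> bool})%type)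
    (Q := fun x del => forall v v', B0 v -> B0 v' -> close v v' del ->
      `|slope x.1 x.2 v' - slope x.1 x.2 v| <= e1).
  move=> x; have [del del0 h] := cont_on_uniform (@slope_cont x.1 x.2) e10.
  exists del => // e' /andP[e'0 e'd] v v' Bv Bv' vv'; apply: h => // j.
  exact: lt_le_trans (vv' j) e'd.
(* The target, the action, the unperturbed action and the point of the mean value
   theorem are successively within del1 / 3. *)
exists (Num.min (del1 / 3) (e1 / (c + 1))).
  have c1 : 0 < c + 1 by rewrite ltr_wpDl.
  have d3 : 0 < del1 / 3 by rewrite divr_gt0.
  have ec : 0 < e1 / (c + 1) by rewrite divr_gt0.
  by rewrite lt_min d3 ec.
move=> i t w hw; set dl := activity W t.+1 w.
have [xi [Bxi xiP ->]] := box_mean_value (@G_gradient dl) (unperturbed_box i t.+1 w)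
  (performed_box t.+1 w).
have dotE : dot (dG dl xi) (performed W p a t.+1 w - unperturbed i t.+1 w) =
    dG dl xi 0 i * (tg i t.+1 w * Phi i t.+1 w).
  rewrite /dot (bigD1 i)//= big1 => [|j ji]; last by rewrite !mxE (negbTE ji) subrr mulr0.
  by rewrite addr0 !mxE eqxx addrAC subrr add0r.
have unp j : `|unperturbed i t.+1 w 0 j - a t.+1 w 0 j| <= alpha_Phi p * tg j t.+1 w.
  rewrite mxE; case: eqP => _; last by rewrite mxE addrAC subrr add0r pert_tgamma.
  by rewrite subrr normr0 mulr_ge0 ?tgamma_ge0// ltW.
have pu j : `|performed W p a t.+1 w 0 j - unperturbed i t.+1 w 0 j| <= alpha_Phi p * tg j t.+1 w.
  rewrite !mxE; case: eqP => _.
    by rewrite addrAC subrr add0r pert_tgamma.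
  by rewrite subrr normr0 mulr_ge0 ?tgamma_ge0// ltW.
have cl : close (target t w) xi del1.
  move=> j; have := action_target_close j t w; have := unp j; have := le_trans (xiP j) (pu j).
  have := hw j; rewrite lt_min => /andP[+ _].
  rewrite ltr_pdivlMr// !ler_norml ltr_norml => g1 /andP[? ?] /andP[? ?] /andP[? ?].
  by apply/andP; split; lra.
have k1 := h1 (i, dl) _ _ (target_box t w) Bxi cl; rewrite /= in k1.
have k2 : `|a t.+1 w 0 i - xi 0 i| * `|dG dl xi 0 i| <= e1.
  have h := hc (i, dl) xi Bxi; rewrite /= in h.
  have h' : `|a t.+1 w 0 i - xi 0 i| <= e1 / (c + 1).
    have := le_trans (xiP i) (pu i).
    have -> : unperturbed i t.+1 w 0 i = a t.+1 w 0 i by rewrite mxE eqxx.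
    rewrite distrC => /le_trans; apply; have := hw i.
    by rewrite lt_min => /andP[_ /ltW].
  apply: (@le_trans _ _ (e1 / (c + 1) * (c + 1))).
    by apply: ler_pM => //; rewrite (le_trans h)// lerDl.
  have c1 : 0 < c + 1 by rewrite ltr_wpDl.
  by rewrite divfK// gt_eqF.
have -> : gain i t.+1 w * dot (dG dl xi) (performed W p a t.+1 w - unperturbed i t.+1 w) -
    node_gain i t.+1 w * Phi i t.+1 w ^+ 2 * slope i dl (target t w) =
    node_gain i t.+1 w * Phi i t.+1 w ^+ 2 *
    ((slope i dl xi - slope i dl (target t w)) + (a t.+1 w 0 i - xi 0 i) * dG dl xi 0 i).
  by rewrite dotE /gain /node_gain /offset /slope; ring.
rewrite normrM normrM (ger0_norm (node_gain_ge0 _ _ _)) (ger0_norm (sqr_ge0 _)).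
have -> : e * node_gain i t.+1 w = node_gain i t.+1 w * (alpha_Phi p ^+ 2 * (e1 + e1)).
  by rewrite /e1; field; rewrite gt_eqF.
rewrite -mulrA ler_wpM2l ?node_gain_ge0//; apply: ler_pM; rewrite ?sqr_ge0 ?pert_sqr_le//.
by apply: le_trans (ler_normD _ _) _; rewrite normrM lerD.
Qed.

(** * Convergence to the optimum *)

(** All parts that have mean 0 given the past in the scalar product of the update with
    the offset. *)
Definition node_noise i t w := \sum_j noise_term i j t w +
  \sum_(j | j != i) recv_term i j t w + env_term i t w + pert_term i t w +
  \sum_dl drift_term i dl t w.

(** The estimate of node i is the sum of all utilities, up to noise and missing
    receptions; inactive nodes have utility 0. *)
Lemma gain_tf i t w : gain i t.+1 w * tf W p u a i t.+1 w =
  \sum_j noise_term i j t w + \sum_(j | j != i) recv_term i j t w +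
  gain i t.+1 w * sum_utility u (performed W p a t.+1 w) (activity W t.+1 w) (env W t.+1 w).
Proof.
case hact : (act i t.+1 w); last first.
  have g0 : gain i t.+1 w = 0 by rewrite /gain tbetaE hact !mul0r.
  rewrite g0 !mul0r addr0 !big1 ?addr0// => j _.
    by rewrite /recv_term g0 !mul0r.
  by rewrite /noise_term g0 !mul0r.
pose x j := utility j t.+1 w; pose n j := noise W j t.+1 w.
have x0 j : act j t.+1 w = false -> x j = 0.
  by move=> h; rewrite /x /utility (utility_inactive uok)// ffunE.
rewrite sum_utilityE.
have tfE : tf W p u a i t.+1 w = \sum_j weight i j t.+1 w * ((act j t.+1 w)%:R * (x j + n j)).
  rewrite (bigD1 i)//= /weight eqxx hact !mul1r /tf; congr (_ + _).
  rewrite mulr_sumr big_mkcond [RHS]big_mkcond; apply: eq_bigr => j _.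
  rewrite inE; have [->|ji] /= := eqVneq j i; first by rewrite andbF.
  have E : tu W p u a j t.+1 w = x j + n j by [].
  by case: (act j t.+1 w); case: (recv W i j t.+1 w);
    rewrite ?E /= ?mul1r ?mul0r ?mulr1 ?mulr0 ?mul0r.
rewrite tfE mulr_sumr.
have -> : \sum_(j | j != i) recv_term i j t w =
    \sum_j gain i t.+1 w * (x j * (weight i j t.+1 w - 1)).
  rewrite [RHS](bigD1 i)//= /weight eqxx subrr !mulr0 add0r; apply: eq_bigr => j ji.
  by rewrite (negbTE ji) /recv_term mulrA.
rewrite mulr_sumr -!big_split/=; apply: eq_bigr => j _.
have xE : u j (performed W p a t.+1 w) (activity W t.+1 w) (env W t.+1 w) = x j by [].
rewrite xE /noise_term -/(n j); case hj : (act j t.+1 w); first by rewrite /=; ring.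
by rewrite (x0 j hj) /=; ring.
Qed.

Lemma activity_slope i t w :
  node_gain i t.+1 w * Phi i t.+1 w ^+ 2 * slope i (activity W t.+1 w) (target t w) =
  \sum_dl drift_term i dl t w + sigma_Phi p ^+ 2 * rho p t.+1 *
    \sum_dl slope i dl (target t w) * (activity_weight dl * (dl i)%:R).
Proof.
have -> : slope i (activity W t.+1 w) (target t w) =
    \sum_dl (activity W t.+1 w == dl)%:R * slope i dl (target t w).
  exact: (activity_split t.+1 (fun dl w => slope i dl (target t w)) w).
move rE : (rho p t.+1) => r.
rewrite !mulr_sumr -big_split/=; apply: eq_bigr => dl _.
rewrite /drift_term rE; move: ((activity W t.+1 w == dl)%:R : R) ((dl i)%:R : R) => x y.
by ring.
Qed.

(** Summed over the nodes, the mean drift is the derivative of F away from the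
    optimum, and what remains is centered or small. *)
Lemma update_decomposition e : 0 < e -> exists2 del, 0 < del &
  forall t w, widths t.+1 w del ->
  \sum_i move i t.+1 w * offset i t.+1 w <=
    \sum_i node_noise i t w +
    sigma_Phi p ^+ 2 * rho p t.+1 * dot (target t w - astar) (dF (target t w)) +
    e * \sum_i node_gain i t.+1 w.
Proof.
move=> e0; have [del del0 h] := perturbation_error e0; exists del => // t w hw.
rewrite -(drift_direction (target_box t w)).
move: (fun i => activity_slope i t w).
move rE : (sigma_Phi p ^+ 2 * rho p t.+1) => r slopeE.
have -> : r * \sum_i \sum_dl slope i dl (target t w) * (activity_weight dl * (dl i)%:R) =
    \sum_i r * \sum_dl slope i dl (target t w) * (activity_weight dl * (dl i)%:R).
  by rewrite mulr_sumr.
have -> : e * \sum_i node_gain i t.+1 w = \sum_i e * node_gain i t.+1 w by rewrite mulr_sumr.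
rewrite -!big_split/=; apply: ler_sum => i _; have := h i t w hw.
have -> : move i t.+1 w * offset i t.+1 w = gain i t.+1 w * tf W p u a i t.+1 w.
  by rewrite /move /gain; ring.
rewrite gain_tf slopeE /node_noise /env_term ler_norml => /andP[_].
have -> : pert_term i t w = gain i t.+1 w * G W u (activity W t.+1 w) (unperturbed i t.+1 w).
  by rewrite /pert_term /gain; ring.
move: (\sum_j noise_term i j t w) (\sum_(j | j != i) recv_term i j t w) => x1 x2.
move: (\sum_dl drift_term i dl t w) (r * _) (e * _) => x3 x4 x5.
rewrite !(mulrBr (gain i t.+1 w)).
move: (gain i t.+1 w * _) (gain i t.+1 w * _) (gain i t.+1 w * _) => y1 y2 y3.
lra.
Qed.

Let series_sum_cvg (I : Type) (r : seq I) (q : pred I) (f : I -> nat -> R) :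
  (forall x, q x -> cvgn (series (f x))) ->
  cvgn (series (fun t => \sum_(x <- r | q x) f x t)).
Proof.
move=> cf; have -> : series (fun t => \sum_(x <- r | q x) f x t) =
    (fun n => \sum_(x <- r | q x) series (f x) n).
  by apply/funext => n; rewrite /series/= exchange_big.
elim: r => [|x r IH]; first by under eq_fun do rewrite big_nil; exact: is_cvg_cst.
under eq_fun do rewrite big_cons; case qx : (q x) => //.
by apply: is_cvgD => //; exact: cf.
Qed.

Let series_add_cvg (f g : nat -> R) : cvgn (series f) -> cvgn (series g) ->
  cvgn (series (fun t => f t + g t)).
Proof. by move=> cf cg; have := is_cvg_seriesD cf cg. Qed.

Let ae_fin (I : finType) (Q : I -> T -> Prop) :
  (forall x, {ae P, forall w, Q x w}) -> {ae P, forall w, forall x, Q x w}.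
Proof.
move=> h; suff : {ae P, forall w, forall x, x \in enum I -> Q x w}.
  by apply: filterS => w hw x; apply: hw; rewrite mem_enum.
elim: (enum I) => [|y s IH]; first by apply: aeW => w x; rewrite in_nil.
apply: filterS2 (h y) IH => w hy hs x.
by rewrite inE => /orP[/eqP ->|/hs].
Qed.

Let move_measurable i t : measurable_fun setT (move i t).
Proof.
apply: (adapted_measurable (@known_from_measurable setT)).
apply: move_adapted => [|j]; first exact: known_slot.
case: t => [|t]; last exact: action_known.
apply: events_adapted => A hA; apply: sub_gen_smallest; left; exists j => //.
by left.
Qed.

Lemma move_dominated i : exists C, dominated (fun t => move i t.+1) C i.
Proof.
have q0 : 0 <= (qr p)^-1 by rewrite invr_ge0 ltW.
exists (alpha_Phi p * (1 + (qr p)^-1 * N%:R)); apply: dominated_intro => [|t w].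
  by rewrite mulr_ge0// addr_ge0// mulr_ge0.
have obs j : `|tu W p u a j t.+1 w| <= magnitude t.+1 w.
  by apply: observation_magnitude; exact: performed_box.
have tf_le : `|tf W p u a i t.+1 w| <= (1 + (qr p)^-1 * N%:R) * magnitude t.+1 w.
  rewrite /tf; apply: le_trans (ler_normD _ _) _; rewrite mulrDl mul1r; apply: lerD => //.
  rewrite normrM (ger0_norm q0) -mulrA ler_wpM2l//.
  apply: le_trans (ler_norm_sum _ _ _) _.
  rewrite natr_mul_sum big_mkcond; apply: ler_sum => j _; case: ifP => _ //; exact: magnitude_ge0.
rewrite /move normrM.
have -> : alpha_Phi p * (1 + (qr p)^-1 * N%:R) * (bstep i t.+1 w * magnitude t.+1 w) =
  (bstep i t.+1 w * alpha_Phi p) * ((1 + (qr p)^-1 * N%:R) * magnitude t.+1 w) by ring.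
by apply: ler_pM => //; exact: tbeta_pert_le.
Qed.

(** The squares are summable. *)
Lemma bstep_cvg0 i : {ae P, forall w, (fun t => bstep i t.+1 w) @ \oo --> 0}.
Proof.
have m t : measurable_fun setT (bstep i t.+1).
  apply: (adapted_measurable (@known_from_measurable setT)).
  by apply: bstep_adapted; apply: (source_known (s := SrcCount i t.+1)).
have dom : dominated (fun t => bstep i t.+1) 1 i.
  apply: dominated_intro => // t w; rewrite mul1r ger0_norm ?bstep_ge0//.
  by rewrite ler_peMr ?bstep_ge0 ?magnitude_ge1.
apply: filterS (dominated_sqr_cvg m dom) => w /cvg_series_cvg_0 b0.
apply/cvgrPdist_lt => e e0.
have e2 : 0 < e ^+ 2 by rewrite exprn_gt0.
move/cvgrPdist_lt : b0 => /(_ _ e2); apply: filterS => t.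
rewrite !sub0r !normrN (ger0_norm (sqr_ge0 _)) (ger0_norm (bstep_ge0 _ _ _)).
by rewrite ltr_pXn2r ?nnegrE ?bstep_ge0 ?ltW.
Qed.

Let series_shift_cvg (f : nat -> R) : cvgn (series (fun t => f t.+1)) -> cvgn (series f).
Proof.
move=> cf; apply/cvg_ex; have /cvg_ex[/= l hl] := cf; exists (f 0 + l).
rewrite -cvg_shiftS.
have -> : (fun n => series f n.+1) = (fun n => f 0 + series (fun t => f t.+1) n).
  by apply/funext => n; rewrite /series/= big_nat_recl.
by apply: cvgD => //; exact: cvg_cst.
Qed.

(** The step sizes beta tend to 0, hence so do the perturbations.  Eventually they are
    so small that projecting does not increase the distance to the optimum and that
    their error is a small multiple of rho, up to a convergent series.  Then the
    squared distance of the target to the optimum is a perturbed descent, and the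
    actions follow the target. *)
Lemma target_cvg w :
  (forall i, (fun t => bstep i t.+1 w) @ \oo --> 0) ->
  (forall i, cvgn (series (node_noise i ^~ w))) ->
  (forall i, cvgn (series (step_term i ^~ w))) ->
  (forall i, cvgn (series (fun t => move i t.+1 w ^+ 2))) ->
  a t w @[t --> \oo] --> astar.
Proof.
move=> b0 cnoise cstep cmove.
have aP := alpha_Phi_gt0 pok; have sP := sigma_Phi_gt0 pok.
have /andP[q0 q1] := qa_range pok.
have tg0 i e : 0 < e -> exists K, forall t, (K <= t)%N -> alpha_Phi p * tg i t.+1 w < e.
  move=> e0; have ea : 0 < e / alpha_Phi p by rewrite divr_gt0.
  have /cvgrPdist_lt/(_ _ ea)[K _ hK] := gamma_cvg0 pok (l := fun t => counter W i t.+1 w) (b0 i).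
  exists K => t /hK /=; rewrite sub0r normrN (ger0_norm (gamma_ge0 pok _)) => h.
  rewrite mulrC -ltr_pdivlMr//; apply: le_lt_trans h; rewrite tgammaE.
  by rewrite ler_piMl ?gamma_ge0//; case: (act i t.+1 w).
have small e : 0 < e -> exists K, forall t, (K <= t)%N -> widths t.+1 w e.
  move=> e0; have [K hK] := @choice _ _ (fun i K => forall t, (K <= t)%N ->
    alpha_Phi p * tg i t.+1 w < e) (fun i => tg0 i e e0).
  exists (\sum_i K i)%N => t ht i; apply: hK; apply: leq_trans ht.
  by rewrite (bigD1 i)//= leq_addr.
pose D t := sqdist (target t w) astar.
have Dcvg : D @ \oo --> 0.
  pose psi t := 2 * sigma_Phi p ^+ 2 * - dot (target t w - astar) (dF (target t w)).
  apply: (@perturbed_descent_cvg0 _ D (fun t => rho p t.+1) psi (beta0 p * gamma0 p)).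
  - by move=> t; apply: sumr_ge0 => i _; exact: sqr_ge0.
  - by move=> t; rewrite rho_ge0// rho_le.
  - by move=> h; apply: (dvg_series_rho pok); exact: series_shift_cvg h.
  - move=> t; apply: mulr_ge0; first by rewrite mulr_ge0 ?sqr_ge0.
    rewrite oppr_ge0.
    have [z|nz] := eqVneq (target t w) astar.
      by rewrite z subrr /dot big1// => i _; rewrite mxE mul0r.
    have := F_strictly_concave reg (target_box t w) astar_box nz.
    suff -> : dF (target t w) - dF astar = dF (target t w) by move/ltW.
    by apply/rowP => i; rewrite !mxE (astar_critical reg) subr0.
  - move=> e /descent_coercive[kappa kappa0 h].
    exists (2 * sigma_Phi p ^+ 2 * kappa); first by rewrite !mulr_gt0// exprn_gt0.
    move=> t ht; apply: ler_wpM2l; first by rewrite mulr_ge0 ?sqr_ge0.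
    exact: h (target_box t w) ht.
  (* The errors of the N nodes add up, and the scalar product enters twice. *)
  move=> e e0; pose e1 := e / (2 * (N%:R + 1)).
  have N1 : 0 < N%:R + 1 :> R by rewrite ltr_wpDl.
  have e10 : 0 < e1 by rewrite divr_gt0// mulr_gt0.
  have [del1 del10 h1] := update_decomposition e10.
  have [|del2 del20 h2] := finite_delta (I := 'I_N) (Q := fun i del =>
      lo 0 i + del <= astar 0 i <= hi 0 i - del).
    move=> i; have /andP[l1 l2] := astar_interior reg i.
    exists (Num.min (astar 0 i - lo 0 i) (hi 0 i - astar 0 i)).
      by rewrite lt_min !subr_gt0 l1.
    by move=> x /andP[x0]; rewrite le_min => /andP[? ?]; apply/andP; split; lra.
  have [K hK] : exists K, forall t, (K <= t)%N -> widths t.+1 w (Num.min del1 del2).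
    by apply: small; rewrite lt_min del10.
  pose noise_total t := 2 * (\sum_i node_noise i t w) + \sum_i move i t.+1 w ^+ 2 +
    2 * e1 * \sum_i step_term i t w.
  exists (series noise_total), K; split.
    apply: series_add_cvg; first apply: series_add_cvg.
    - apply: (is_cvg_seriesZ (k := 2) (f := fun t => \sum_i node_noise i t w)).
      by apply: (series_sum_cvg (f := fun i t => node_noise i t w)).
    - by apply: (series_sum_cvg (f := fun i t => move i t.+1 w ^+ 2)).
    - apply: (is_cvg_seriesZ (k := 2 * e1) (f := fun t => \sum_i step_term i t w)).
      by apply: (series_sum_cvg (f := fun i t => step_term i t w)).
  move=> t Kt.
  have wid := hK t Kt.
  have wid1 : widths t.+1 w del1 by move=> j; apply: lt_le_trans (wid j) _; rewrite ge_min lexx.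
  have wid2 j : lo 0 j + alpha_Phi p * tg j t.+1 w <= astar 0 j
      <= hi 0 j - alpha_Phi p * tg j t.+1 w.
    have /andP[? ?] := h2 j; have : alpha_Phi p * tg j t.+1 w < del2.
      by apply: lt_le_trans (wid j) _; rewrite ge_min lexx orbT.
    by move=> ?; apply/andP; split; lra.
  have seriesS : series noise_total t.+1 - series noise_total t = noise_total t.
    by rewrite seriesSr addrC addKr.
  rewrite seriesS.
  have le1 : D t.+1 <= \sum_i ((target t w 0 i - astar 0 i) ^+ 2 +
      2 * (move i t.+1 w * offset i t.+1 w) + move i t.+1 w ^+ 2).
    apply: ler_sum => i _; apply: le_trans (target_sqr i t.+1 w) _.
    have -> : (a t.+1 w 0 i + move i t.+1 w - astar 0 i) ^+ 2 =
      (a t.+1 w 0 i - astar 0 i) ^+ 2 + 2 * (move i t.+1 w * offset i t.+1 w) + move i t.+1 w ^+ 2.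
      by rewrite /offset; ring.
    by rewrite lerD2r lerD2r; exact: action_target_sqr.
  apply: le_trans le1 _; rewrite !big_split/= -mulr_sumr -/(sqdist _ _) -/(D t).
  have := h1 t w wid1.
  have -> : \sum_i node_gain i t.+1 w = \sum_i step_term i t w + N%:R * (qa p * rho p t.+1).
    by rewrite natr_mul_sum -big_split/=; apply: eq_bigr => i _; rewrite /step_term subrK.
  have r0 := rho_ge0 pok t.+1.
  have le2 : 2 * (e1 * (N%:R * (qa p * rho p t.+1))) <= e * rho p t.+1.
    have -> : e * rho p t.+1 = 2 * (e1 * ((N%:R + 1) * rho p t.+1)).
      by rewrite /e1; field; rewrite gt_eqF.
    rewrite ler_wpM2l// ler_wpM2l ?(ltW e10)//; apply: ler_pM => //.
    - by rewrite mulr_ge0// ltW.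
    - by rewrite lerDl.
    - by rewrite ler_piMl.
  rewrite /noise_total /psi; move: (rho p t.+1) r0 le2 => r r0 le2.
  move: (dot _ _) => dd; move: (\sum_i step_term i t w) => ss.
  move: (\sum_i node_noise i t w) => nn; move: (\sum_i move i t.+1 w ^+ 2) => mm.
  move: (\sum_i move i t.+1 w * offset i t.+1 w) => mo.
  set s2 := sigma_Phi p ^+ 2; move: s2 => s2.
  rewrite mulrDr => h3.
  have -> : D t - r * (2 * s2 * - dd) + e * r + (2 * nn + mm + 2 * e1 * ss) =
    D t + 2 * (nn + s2 * r * dd + e1 * ss) + mm + e * r by ring.
  have -> : D t + 2 * mo + mm = D t + 2 * (mo - e1 * (N%:R * (qa p * r))) + mm +
     2 * (e1 * (N%:R * (qa p * r))) by ring.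
  apply: lerD => //; rewrite lerD2r lerD2l ler_wpM2l//.
  by rewrite lerBlDr -addrA.
rewrite -cvg_shiftS; apply/cvg_ballP => e e0.
have e2 : 0 < e / 2 by rewrite divr_gt0.
have e4 : 0 < (e / 2) ^+ 2 by rewrite exprn_gt0.
move/cvgrPdist_lt : Dcvg => /(_ _ e4) [K1 _ hK1].
have [K2 hK2] := small _ e2.
exists (maxn K1 K2) => // t /= ht; split => // i j; rewrite ord1 /ball/=.
have Dt := hK1 t (leq_trans (leq_maxl _ _) ht); have wt := hK2 t (leq_trans (leq_maxr _ _) ht) j.
have h1 := le_lt_trans (action_target_close j t w) wt.
have h2 : `|target t w 0 j - astar 0 j| < e / 2.
  rewrite -(@ltr_pXn2r _ 2)// ?nnegrE ?ltW// real_normK ?num_real//.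
  move: Dt => /=; rewrite sub0r normrN => /(le_lt_trans (ler_norm _)); apply: le_lt_trans.
  by rewrite /D /sqdist (bigD1 j)//= lerDl sumr_ge0// => k _; exact: sqr_ge0.
have -> : astar 0 j - a t.+1 w 0 j =
  - ((a t.+1 w 0 j - target t w 0 j) + (target t w 0 j - astar 0 j)) by ring.
by rewrite normrN (le_lt_trans (ler_normD _ _))// [ltRHS](splitr e) ltrD.
Qed.

Lemma dosp_s_converges : {ae P, forall w, a t w @[t --> \oo] --> astar}.
Proof.
have A1 := ae_fin bstep_cvg0.
have A2 : {ae P, forall w, forall ij, cvgn (series (noise_term ij.1 ij.2 ^~ w))}.
  by apply: (ae_fin (I := ('I_N * 'I_N)%type)) => ij; exact: noise_term_cvg.
have A3 : {ae P, forall w, forall ij, ij.2 != ij.1 -> cvgn (series (recv_term ij.1 ij.2 ^~ w))}.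
  apply: (ae_fin (I := ('I_N * 'I_N)%type)) => ij.
  have [e|ne] := eqVneq ij.2 ij.1; first by apply: aeW.
  by apply: filterS (recv_term_cvg ne) => w hw _.
have A4 := ae_fin env_term_cvg.
have A5 := ae_fin pert_term_cvg.
have A6 : {ae P, forall w, forall x, cvgn (series (drift_term x.1 x.2 ^~ w))}.
  by apply: (ae_fin (I := ('I_N * {ffun 'I_N -> bool})%type)) => x; exact: drift_term_cvg.
have A7 := ae_fin step_term_cvg.
have A8 : {ae P, forall w, forall i, cvgn (series (fun t => move i t.+1 w ^+ 2))}.
  apply: ae_fin => i; have [C hC] := move_dominated i.
  by apply: (dominated_sqr_cvg (X := fun t => move i t.+1)) hC => t; exact: move_measurable.
have A : {ae P, forall w, forall i, cvgn (series (node_noise i ^~ w))}.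
  apply: filterS2 (filterI A2 A3) (filterI (filterI A4 A5) A6) => w [h2 h3] [[h4 h5] h6] i.
  apply: series_add_cvg; last first.
    apply: (series_sum_cvg (f := fun dl t => drift_term i dl t w)) => dl _.
    exact: h6 (i, dl).
  apply: series_add_cvg; last exact: h5.
  apply: series_add_cvg; last exact: h4.
  apply: series_add_cvg.
    by apply: (series_sum_cvg (f := fun j t => noise_term i j t w)) => j _; exact: h2 (i, j).
  by apply: (series_sum_cvg (f := fun j t => recv_term i j t w)) => j; exact: h3 (i, j).
by apply: filterS2 (filterI A1 A) (filterI A7 A8) => w [h1 h2] [h3 h4]; exact: target_cvg.
Qed.

End algorithm.

Theorem theorem2 (R : realType) (d : measure_display) (T : measurableType d)
  (P : probability T R) (dS : measure_display) (St : measurableType dS)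
  (N : nat) (p : params R) (W : inputs P St N)
  (u : 'I_N -> 'rV[R]_N -> {ffun 'I_N -> bool} -> St -> R)
  (lo hi astar : 'rV[R]_N)
  (dF : 'rV[R]_N -> 'rV[R]_N) (d2F : 'rV[R]_N -> 'M[R]_N)
  (dG : {ffun 'I_N -> bool} -> 'rV[R]_N -> 'rV[R]_N)
  (d2G : {ffun 'I_N -> bool} -> 'rV[R]_N -> 'M[R]_N)
  (a : nat -> T -> 'rV[R]_N) :
  params_ok p ->
  inputs_law W p ->
  utilities_ok W u lo hi ->
  regularity W p u lo hi astar dF d2F dG d2G ->
  dosp_s W p u lo hi a ->
  {ae P, forall w, a t w @[t --> \oo] --> astar}.
Proof.
move=> pok law uok reg alg; have [Lip [mLip momLip LipP]] := utility_lipschitz uok.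
exact (dosp_s_converges pok law uok reg alg mLip momLip LipP).
Qed.
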